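(* Let $P(D)$ denote any linear, constant coefficient differential operator, with symbol $P(\xi)$, $\xi\in\mathbb{R}^n$, and let $p$ be such that $|P(\xi)|$ belongs to the Muckenhoupt class $A_p$. Let $\Omega\subset\Omega'\subset\subset T^n$ be open sets. Let $\eta$ be a smooth cut-off function such that $\eta\equiv1$ on $\overline{\Omega}$ and supported in $\Omega'$. Then for $f$ compactly supported, there is a solution $u$ to $P(D)u=f$ in $T^n$ such that $$\|\eta u\|_\rho\le C(\Omega',n,\rho)\,\|f\|_{\rho+np},\qquad \rho\in\mathbb{R}.$$
   Context: $D=\big(\tfrac1i\partial_{x_1},\dots,\tfrac1i\partial_{x_n}\big)$, $i=\sqrt{-1}$; $P(D)$ is obtained from the polynomial $P(\xi)$ by substituting $D$ for $\xi$. $C(\Omega',n,\rho)$ denotes a constant depending on $\Omega'$, $n$ and $\rho$. $T^n$ is the $n$-torus and $\hat f(m)$, $m\in\mathbb{Z}^n$, are the Fourier coefficients of $f$ on $T^n$ (with respect to the characters $e^{i(m,x)}$). For $s\in\mathbb{R}$, $H^s(T^n)$ is the Sobolev space with norm $\|f\|_s=\big(\sum_{m\in\mathbb{Z}^n}|\hat f(m)|^2(1+|m|^2)^s\big)^{1/2}$. A weight is a function $w>0$, $w\in L^1_{loc}(\mathbb{R}^n)$. For $1<p<\infty$, $w\in A_p$ if and only if $$\sup_B\Big(\frac1{|B|}\int_B w\,dx\Big)\Big(\frac1{|B|}\int_B w^{-\frac1{p-1}}\,dx\Big)^{p-1}<\infty,$$ the supremum being over all balls $B\subset\mathbb{R}^n$;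 $w\in A_1$ if and only if there is a constant $C$ with $\frac1{|B|}\int_B w\,dx\le C\,\mathrm{ess\,inf}_B\,w$ for all balls $B$.
   Formalization: T^n is read as the open cell (-π,π)^n: f is compactly supported there, Ω' is compactly contained in it, and P(D)u=f holds there as distributions (a periodic u need not exist); the constant may also depend on P, p, Ω and η. *)

(* Defs.v *)
From HB Require Import structures.
From mathcomp Require Import all_boot all_order all_algebra.
From mathcomp Require Import all_classical all_reals all_analysis.
From mathcomp Require Import complex.
(* mpoly is not imported: its notations clash with those of MathComp-Analysis. *)
From mathcomp Require mpoly.

Set Implicit Arguments.
Unset Strict Implicit.
Unset Printing Implicit Defensive.

Import Order.TTheory GRing.Theory Num.Theory.
Import numFieldNormedType.Exports.

Local Open Scope classical_set_scope.
Local Open Scope ring_scope.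

Notation multinom := mpoly.multinom.
Notation mdeg := mpoly.mdeg.
Notation mpolynomial := mpoly.mpoly.

Section LebesgueStep.
Variables (R : realType) (n : nat).
Local Notation Rn k := (k.-tuple (measurableTypeR R)).

Definition cons_pair (x : measurableTypeR R * Rn n) : Rn n.+1 :=
  [the n.+1.-tuple (measurableTypeR R) of x.1 :: x.2].

Lemma measurable_cons_pair : measurable_fun [set: _] cons_pair.
Proof. exact: (measurable_cons measurable_fst measurable_snd). Qed.

HB.instance Definition _ :=
  isMeasurableFun.Build _ _ _ _ cons_pair measurable_cons_pair.

Definition uncons_pair (t : Rn n.+1) : measurableTypeR R * Rn n :=
  (thead t, [tuple of behead t]).

Lemma measurable_uncons_pair : measurable_fun [set: _] uncons_pair.
Proof.
apply/measurable_fun_pairP; split; first exact: measurable_tnth.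
exact: measurable_behead.
Qed.

Lemma cons_pairK : cancel cons_pair uncons_pair.
Proof.
case=> x t; rewrite /uncons_pair /cons_pair /=; congr pair.
exact: val_inj.
Qed.

Variable mu : {sigma_finite_measure set (Rn n) -> \bar R}.

Definition leb_step : set (Rn n.+1) -> \bar R :=
  pushforward (@lebesgue_measure R \x mu)%E cons_pair.

Let leb_step0 : leb_step set0 = 0%E.
Proof. exact: measure0. Qed.

Let leb_step_ge0 A : (0 <= leb_step A)%E.
Proof. exact: measure_ge0. Qed.

Let leb_step_sigma_additive : semi_sigma_additive leb_step.
Proof. exact: measure_semi_sigma_additive. Qed.

HB.instance Definition _ :=
  isMeasure.Build _ _ _ leb_step leb_step0 leb_step_ge0 leb_step_sigma_additive.

Lemma leb_step_sigma_finite : sigma_finite [set: Rn n.+1] leb_step.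
Proof.
have /sigma_finiteP[F [TF ndF Foo]] := sigma_finiteT (@lebesgue_measure R).
have /sigma_finiteP[G [TG ndG Goo]] := sigma_finiteT mu.
exists (fun k => uncons_pair @^-1` (F k `*` G k)).
  rewrite -preimage_bigcup; apply/esym/seteqP; split=> // t _ /=.
  have [i _ Fi] : (\bigcup_i F i) (uncons_pair t).1 by rewrite -TF.
  have [j _ Gj] : (\bigcup_i G i) (uncons_pair t).2 by rewrite -TG.
  exists (maxn i j) => //; split.
  - by move: Fi; exact/subsetPset/ndF/leq_maxl.
  - by move: Gj; exact/subsetPset/ndG/leq_maxr.
move=> k; have [mF Fk] := Foo k; have [mG Gk] := Goo k.
have mFG : measurable (F k `*` G k) by exact: measurableX.
split.
  by rewrite -[X in measurable X]setTI; exact: measurable_uncons_pair.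
rewrite /leb_step /pushforward -comp_preimage.
rewrite (_ : uncons_pair \o cons_pair = id) ?preimage_id; last first.
  by apply/funext => x /=; rewrite cons_pairK.
by rewrite product_measure1E// lte_mul_pinfty// ge0_fin_numE.
Qed.

HB.instance Definition _ :=
  Measure_isSigmaFinite.Build _ _ _ leb_step leb_step_sigma_finite.

End LebesgueStep.

(* A product measure under the bijection R x R^k -> R^(k+1). *)
Fixpoint lebesgue_Rn (R : realType) (n : nat) :
    {sigma_finite_measure set (n.-tuple (measurableTypeR R)) -> \bar R} :=
  match n with
  | 0 => dirac [tuple]
  | k.+1 => leb_step (lebesgue_Rn R k)
  end.

Section Muckenhoupt.
Variables (R : realType) (n : nat).
Local Notation Rn := (n.-tuple (measurableTypeR R)).
Local Notation lam := (lebesgue_Rn R n).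

Definition eball (c : Rn) (r : R) : set Rn :=
  [set x | \sum_(j < n) (tnth x j - tnth c j) ^+ 2 < r ^+ 2].

(* Positivity of a weight is meant almost everywhere; for a Borel function on
   R^n local integrability amounts to integrability on every ball. *)
Definition weight (w : Rn -> R) : Prop :=
  [/\ measurable_fun [set: Rn] w,
      {ae lam, forall x, 0 < w x} &
      forall (c : Rn) (r : R), 0 < r ->
        lam.-integrable (eball c r) (EFin \o w)].

Definition average (B : set Rn) (w : Rn -> R) : \bar R :=
  (((fine (lam B))^-1)%:E * \int[lam]_(x in B) (w x)%:E)%E.

(* The library's ess_inf is over the whole space; here it is relative to B. *)
Definition ess_inf_on (B : set Rn) (w : Rn -> R) : \bar R :=
  ereal_sup [set y | {ae lam, forall x, B x -> (y <= (w x)%:E)%E}].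

(* powR sends 0 to 0 for a negative exponent; a weight vanishes only on a null
   set, so this value does not affect the averages. *)
Definition Ap_product (p : R) (w : Rn -> R) (B : set Rn) : \bar R :=
  (average B w * (average B (fun x => (w x `^ (- (p - 1)^-1))%R)) `^ (p - 1))%E.

Definition muckenhoupt (p : R) (w : Rn -> R) : Prop :=
  weight w /\
  (p = 1 /\ (exists C : R, forall (c : Rn) (r : R), 0 < r ->
       (average (eball c r) w <= C%:E * ess_inf_on (eball c r) w)%E)
   \/
   1 < p /\ (ereal_sup [set A | exists (c : Rn) (r : R),
                (0 < r)%R /\ A = Ap_product p w (eball c r)] < +oo)%E).

End Muckenhoupt.

Section Distributions.
Variables (R : realType) (n : nat).
Local Notation V := 'rV[R]_n.

Definition partial (j : 'I_n) (f : V -> R) : V -> R :=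
  fun x => 'D_(delta_mx 0 j) f x.

Definition mpartial (a : multinom n) (f : V -> R) : V -> R :=
  foldr (fun j g => iter (mpoly.fun_of_multinom a j) (partial j) g) f (enum 'I_n).

Definition smooth (f : V -> R) : Prop :=
  forall (s : seq 'I_n) (x : V), differentiable (foldr partial f s) x.

Definition supp (f : V -> R) : set V := closure [set x | f x != 0].

Definition test_function (U : set V) (phi : V -> R) : Prop :=
  [/\ smooth phi, compact (supp phi) & supp phi `<=` U].

(* A complex distribution is determined by its values on real test functions,
   on which it is an R-linear form with values in R[i]. Only the values on the
   relevant class of smooth functions are meaningful. *)
Definition functional := (V -> R) -> R[i].

Definition linear_on (D : (V -> R) -> Prop) (u : functional) : Prop :=
  forall (a : R) (phi psi : V -> R), D phi -> D psi ->
    u (fun x => a * phi x + psi x) = (a%:C)%C * u phi + u psi.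

Definition derivatives_bounded (N : nat) (K : set V) (phi : V -> R) (M : R) :=
  forall (a : multinom n) (x : V), (mdeg a <= N)%N -> K x ->
    `|mpartial a phi x| <= M.

(* D'(U) *)
Definition distribution_on (U : set V) (u : functional) : Prop :=
  linear_on (test_function U) u /\
  forall K : set V, compact K -> K `<=` U ->
    exists (C : R) (N : nat), forall (phi : V -> R) (M : R),
      smooth phi -> supp phi `<=` K -> 0 <= M ->
      derivatives_bounded N K phi M -> Normc.normc (u phi) <= C * M.

(* E'(U), the distributions with compact support in U, as the forms on all
   smooth functions continuous for a C^N seminorm on some compact subset of U *)
Definition compact_distribution_on (U : set V) (f : functional) : Prop :=
  linear_on smooth f /\
  exists (K : set V) (C : R) (N : nat), [/\ compact K, K `<=` U &
    forall (phi : V -> R) (M : R), smooth phi -> 0 <= M ->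
      derivatives_bounded N K phi M -> Normc.normc (f phi) <= C * M].

Definition distr_eq (U : set V) (u v : functional) : Prop :=
  forall phi, test_function U phi -> u phi = v phi.

Definition distr_mul (eta : V -> R) (u : functional) : functional :=
  fun phi => u (fun x => eta x * phi x).

Definition distr_deriv (a : multinom n) (u : functional) : functional :=
  fun phi => (-1) ^+ mdeg a * u (mpartial a phi).

(* P(D), where D^a = (1/i)^|a| \partial^a *)
Definition diffop (P : mpolynomial n R[i]) (u : functional) : functional :=
  fun phi => \sum_(a <- mpoly.msupp P)
    mpoly.mcoeff a P * ('i%C)^-1 ^+ mdeg a * distr_deriv a u phi.

Definition symbol (P : mpolynomial n R[i])
    (xi : n.-tuple (measurableTypeR R)) : R[i] :=
  mpoly.meval (fun j => (real_complex R (tnth xi j))) P.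

(* The torus R^n / 2 pi Z^n is seen through its open fundamental cell, so that
   "compactly supported in T^n" and "compactly contained in T^n" have a content.
   A distribution with compact support in the cell is a distribution on the
   torus, and its Fourier coefficients are its values on characters. *)
Definition torus_cell : set V := [set x | forall j, - pi < x 0 j < pi].

Definition compactly_contained (A U : set V) : Prop :=
  compact (closure A) /\ closure A `<=` U.

Definition dotZ (m : 'rV[int]_n) (x : V) : R :=
  \sum_(j < n) (m 0 j)%:~R * x 0 j.

Definition fourier_coef (f : functional) (m : 'rV[int]_n) : R[i] :=
  real_complex R (((2 * pi) ^+ n)^-1) *
  (f (fun x => cos (dotZ m x)) - 'i%C * f (fun x => sin (dotZ m x))).

Definition normZ2 (m : 'rV[int]_n) : R := \sum_(j < n) ((m 0 j)%:~R) ^+ 2.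

(* +oo exactly when f is not in H^s *)
Definition sobolev_norm (s : R) (f : functional) : \bar R :=
  ((\esum_(m in [set: 'rV[int]_n])
     (Normc.normc (fourier_coef f m) ^+ 2 * (1 + normZ2 m) `^ s)%:E)
   `^ (2^-1))%E.

End Distributions.

(* Main.v *)
(* Let B_zeta(phi) be the integral of e^(i zeta.x) phi(x) over the cell, for
   complex frequencies zeta.  In a real direction w on which the top degree part
   of P does not vanish, z |-> P(m + z w) has a leading coefficient and a degree
   d independent of m, so that among the circles |z| = 1, ..., d + 1 there is one,
   |z| = r_m, at distance at least 1/2 of its d roots: |P(m + z w)| is bounded
   below there, uniformly in m.  If f has Fourier coefficients a_m, then
     u = sum_m a_m Mean_{|z| = r_m} [ B_{m + z w} / P(m + z w) ]
   satisfies P(D) u = sum_m a_m Mean_{|z| = r_m} B_{m + z w} = sum_m a_m B_m = f,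
   by the mean value property of the entire function z |-> B_{m + z w}(phi) and
   by Fourier inversion.  The coefficients of eta u are obtained from a_m through
   a kernel that decays rapidly in m - l, which preserves every H^rho; and
   H^(rho + n p) embeds in H^rho since p >= 1. *)
Require Import Defs.
From mathcomp Require Import all_boot all_order all_algebra.
From mathcomp Require Import all_classical all_reals all_analysis.
From mathcomp Require Import complex.
From mathcomp Require mpoly.
From mathcomp Require Import ring lra zify.
Import Order.TTheory GRing.Theory Num.Theory.
Import numFieldNormedType.Exports.
Local Open Scope classical_set_scope.
Local Open Scope ring_scope.

Set Implicit Arguments.
Unset Strict Implicit.
Unset Printing Implicit Defensive.

Local Notation normc := Normc.normc.
Local Notation "x %:C" := (real_complex _ x) (format "x %:C") : ring_scope.
Local Notation Re := complex.Re.
Local Notation Im := complex.Im.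

Section ComplexNorm.
Variable R : realType.
Implicit Types (z w : R[i]) (x y : R).

Lemma normc_ge0 z : 0 <= normc z.
Proof. by case: z => a b /=; exact: sqrtr_ge0. Qed.

Lemma normcR x : normc x%:C = `|x|.
Proof. by rewrite /= expr0n /= addr0 sqrtr_sqr. Qed.

Lemma complex_natr k : (k%:R : R[i]) = (k%:R : R)%:C.
Proof. by rewrite rmorph_nat. Qed.

Lemma normcX z k : normc (z ^+ k) = normc z ^+ k.
Proof.
by elim: k => [|k IH]; rewrite ?expr0 ?Normc.normc1// !exprS Normc.normcM IH.
Qed.

Lemma normc_sum (I : Type) (r : seq I) (P : pred I) (F : I -> R[i]) :
  normc (\sum_(i <- r | P i) F i) <= \sum_(i <- r | P i) normc (F i).
Proof. exact: (@ler_norm_sum _ (Rcomplex R)). Qed.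

Lemma normc_prod (I : Type) (r : seq I) (P : pred I) (F : I -> R[i]) :
  normc (\prod_(i <- r | P i) F i) = \prod_(i <- r | P i) normc (F i).
Proof. elim/big_rec2: _ => [|i x y _ <-]; first exact: Normc.normc1.
exact: Normc.normcM. Qed.

Lemma Re_le_normc z : `|Re z| <= normc z.
Proof. by case: z => a b /=; rewrite -sqrtr_sqr ler_wsqrtr// lerDl sqr_ge0. Qed.

Lemma Im_le_normc z : `|Im z| <= normc z.
Proof. by case: z => a b /=; rewrite -sqrtr_sqr ler_wsqrtr// lerDr sqr_ge0. Qed.

Lemma normc_le z : normc z <= `|Re z| + `|Im z|.
Proof.
rewrite {1}[z]complexE; apply: le_trans (le_normcD _ _) _.
rewrite Normc.normcM !normcR lerD2l.
by rewrite (_ : normc 'i%C = 1) ?mul1r//= expr0n /= expr1n add0r sqrtr1.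
Qed.

Lemma normc_i : normc ('i%C : R[i]) = 1.
Proof. by rewrite /= expr0n /= expr1n add0r sqrtr1. Qed.

Lemma ReD z w : Re (z + w) = Re z + Re w. Proof. by case: z w => a b []. Qed.
Lemma ImD z w : Im (z + w) = Im z + Im w. Proof. by case: z w => a b []. Qed.
Lemma ReM z w : Re (z * w) = Re z * Re w - Im z * Im w.
Proof. by case: z w => a b []. Qed.
Lemma ImM z w : Im (z * w) = Re z * Im w + Im z * Re w.
Proof. by case: z w => a b []. Qed.
Lemma complex_ext z w : Re z = Re w -> Im z = Im w -> z = w.
Proof. by case: z w => a b [c d] /= -> ->. Qed.

End ComplexNorm.

(* A single ultrafilter limit serves for Riemann sums, circle averages and
   Fourier partial sums: it is defined and linear on all bounded sequences, so
   that none of these limits has to be shown to exist. *)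
Section UltraLimit.
Variable R : realType.

Lemma exists_ultrafilter_nat :
  exists U : set_system nat, UltraFilter U /\ eventually `<=` U.
Proof. exact: ultraFilterLemma. Qed.

Definition ultranat : set_system nat := projT1 (cid exists_ultrafilter_nat).

Lemma ultranat_ultra : UltraFilter ultranat.
Proof. by rewrite /ultranat; case: cid => U []. Qed.

#[local] Instance ultranat_proper : ProperFilter ultranat.
Proof. exact: (@ultra_proper _ _ ultranat_ultra). Qed.

Lemma ultranat_sub : eventually `<=` ultranat.
Proof. by rewrite /ultranat; case: cid => U []. Qed.

Definition bounded_seq (x : nat -> R[i]) := exists M : R, forall k, normc (x k) <= M.

Definition ulim (x : nat -> R) : R := lim (x @ ultranat).

Lemma ultranat_image (x : nat -> R) : UltraFilter (x @ ultranat).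
Proof.
split=> [|G PG sG]; first exact: fmap_proper_filter.
apply/seteqP; split=> // A GA.
have [//|UA] := in_ultra_setVsetC (x @^-1` A) ultranat_ultra.
have GAC : G (~` A) by exact: sG.
by have [y []] := filter_ex (filterI GA GAC).
Qed.

Lemma ulim_is_cvg (x : nat -> R) M :
  (forall k, `|x k| <= M) -> x @ ultranat --> ulim x.
Proof.
move=> xM.
have := @segment_compact R (- M) M; rewrite compact_ultra.
move=> /(_ (x @ ultranat) (ultranat_image x)) [].
  rewrite /= /fmap; apply: filterS (filterT : ultranat setT) => k _ /=.
  by rewrite in_itv/= -ler_norml.
by move=> l [_ xl]; apply/cvg_ex; exists l.
Qed.

Lemma ulim_cst (a : R) : ulim (fun=> a) = a.
Proof. by apply: cvg_lim => //; exact: cvg_cst. Qed.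

Definition clim (x : nat -> R[i]) : R[i] :=
  Complex (ulim (fun k => Re (x k))) (ulim (fun k => Im (x k))).

Lemma Re_bounded x : bounded_seq x -> exists M, forall k, `|Re (x k)| <= M.
Proof. by move=> [M xM]; exists M => k; exact: le_trans (Re_le_normc _) _. Qed.

Lemma Im_bounded x : bounded_seq x -> exists M, forall k, `|Im (x k)| <= M.
Proof. by move=> [M xM]; exists M => k; exact: le_trans (Im_le_normc _) _. Qed.

Lemma clim_unique (x : nat -> R[i]) (a b : R) :
  (fun k => Re (x k)) @ ultranat --> a -> (fun k => Im (x k)) @ ultranat --> b ->
  clim x = Complex a b.
Proof. by move=> xa xb; congr Complex; exact: cvg_lim. Qed.

Lemma bounded_seqD x y : bounded_seq x -> bounded_seq y ->
  bounded_seq (fun k => x k + y k).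
Proof.
move=> [M xM] [N yN]; exists (M + N) => k.
by apply: le_trans (le_normcD _ _) _; exact: lerD.
Qed.

Lemma bounded_seqM x y : bounded_seq x -> bounded_seq y ->
  bounded_seq (fun k => x k * y k).
Proof.
move=> [M xM] [N yN]; exists (M * N) => k; rewrite Normc.normcM.
by apply: ler_pM => //; exact: normc_ge0.
Qed.

Lemma bounded_seq_cst a : bounded_seq (fun=> a).
Proof. by exists (normc a). Qed.

Lemma climD x y : bounded_seq x -> bounded_seq y ->
  clim (fun k => x k + y k) = clim x + clim y.
Proof.
move=> bx byy; rewrite /clim; apply: clim_unique.
- under eq_fun do rewrite ReD.
  have [M /ulim_is_cvg cx] := Re_bounded bx.
  have [N /ulim_is_cvg cy] := Re_bounded byy.
  exact: cvgD.
- under eq_fun do rewrite ImD.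
  have [M /ulim_is_cvg cx] := Im_bounded bx.
  have [N /ulim_is_cvg cy] := Im_bounded byy.
  exact: cvgD.
Qed.

Lemma climM x y : bounded_seq x -> bounded_seq y ->
  clim (fun k => x k * y k) = clim x * clim y.
Proof.
move=> bx byy.
have [M /ulim_is_cvg cx] := Re_bounded bx.
have [N /ulim_is_cvg cy] := Re_bounded byy.
have [M' /ulim_is_cvg dx] := Im_bounded bx.
have [N' /ulim_is_cvg dy] := Im_bounded byy.
rewrite /clim; apply: clim_unique.
- under eq_fun do rewrite ReM.
  by apply: cvgB; exact: cvgM.
- under eq_fun do rewrite ImM.
  by apply: cvgD; exact: cvgM.
Qed.

Lemma clim_cst a : clim (fun=> a) = a.
Proof. by rewrite /clim !ulim_cst; case: a. Qed.

Lemma climZ a x : bounded_seq x -> clim (fun k => a * x k) = a * clim x.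
Proof. by move=> bx; rewrite climM ?clim_cst//; exact: bounded_seq_cst. Qed.

Lemma bounded_seq_sum (I : Type) (r : seq I) (F : I -> nat -> R[i]) :
  (forall i, bounded_seq (F i)) -> bounded_seq (fun k => \sum_(i <- r) F i k).
Proof.
move=> bF; elim: r => [|i r IH].
  by under eq_fun do rewrite big_nil; exact: bounded_seq_cst.
by under eq_fun do rewrite big_cons; exact: bounded_seqD.
Qed.

Lemma clim_sum (I : Type) (r : seq I) (F : I -> nat -> R[i]) :
  (forall i, bounded_seq (F i)) ->
  clim (fun k => \sum_(i <- r) F i k) = \sum_(i <- r) clim (F i).
Proof.
move=> bF; elim: r => [|i r IH].
  by under eq_fun do rewrite big_nil; rewrite big_nil clim_cst.
under eq_fun do rewrite big_cons; rewrite big_cons climD ?IH//.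
exact: bounded_seq_sum.
Qed.

(* The factor 2 comes from estimating real and imaginary parts separately. *)
Lemma normc_clim_le x (M : R) :
  bounded_seq x -> (\forall k \near \oo, normc (x k) <= M) ->
  normc (clim x) <= 2 * M.
Proof.
move=> bx xM; apply: le_trans (normc_le _) _ => /=.
have xMU : ultranat [set k | normc (x k) <= M] by exact: ultranat_sub.
have key (f : R[i] -> R) : (forall z, `|f z| <= normc z) ->
    `|ulim (fun k => f (x k))| <= M.
  move=> fn; have [L xL] := bx.
  have cx : (fun k => f (x k)) @ ultranat --> ulim (fun k => f (x k)).
    by apply: (@ulim_is_cvg _ L) => k; exact: le_trans (fn _) _.
  rewrite ler_norml; apply/andP; split.
    apply: (closed_cvg (fun y => - M <= y) (@closed_ge _ (- M)) _ _ cx).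
    apply: filterS xMU => k /= /(le_trans (fn _)).
    by rewrite ler_norml => /andP[].
  apply: (closed_cvg (fun y => y <= M) (@closed_le _ M) _ _ cx).
  apply: filterS xMU => k /= /(le_trans (fn _)).
  by rewrite ler_norml => /andP[].
by rewrite mulr_natl mulr2n lerD// key// => z; [exact: Re_le_normc|exact: Im_le_normc].
Qed.

Lemma cvg_clim x a : (fun k => normc (x k - a)) @ \oo --> 0 -> clim x = a.
Proof.
move=> xa.
have {}xa : (fun k => normc (x k - a)) @ ultranat --> 0.
  by apply: cvg_trans xa; apply: cvg_app; exact: ultranat_sub.
have key (f : R[i] -> R) : (forall z w, `|f z - f w| <= normc (z - w)) ->
    (fun k => f (x k)) @ ultranat --> f a.
  move=> fn; apply/cvgrPdist_lt => e e0.
  have /cvgrPdist_lt/(_ e e0) := xa.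
  apply: filterS => k /=; rewrite sub0r normrN ger0_norm ?normc_ge0//.
  by apply: le_lt_trans; rewrite distrC.
rewrite (@clim_unique _ (Re a) (Im a)); first by case: a {xa key}.
- apply: key => z w; apply: le_trans (Re_le_normc _).
  by rewrite ReD; case: w.
- apply: key => z w; apply: le_trans (Im_le_normc _).
  by rewrite ImD; case: w.
Qed.

Lemma cvg0_le (x : nat -> R) (e : nat -> R) :
  e @ \oo --> 0 -> (\forall k \near \oo, `|x k| <= e k) -> x @ \oo --> 0.
Proof.
move=> e0 xe; apply: norm_cvg0; apply: (squeeze_cvgr _ (cvg_cst 0) e0).
by apply: filterS xe => k xk; rewrite normr_ge0.
Qed.

End UltraLimit.

Section ComplexExponential.
Variable R : realType.
Implicit Types (z w a : R[i]) (x y t : R).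

Definition cexp z : R[i] :=
  Complex (expR (Re z) * cos (Im z)) (expR (Re z) * sin (Im z)).

Lemma cexp0 : cexp 0 = 1.
Proof. by rewrite /cexp /= expR0 cos0 sin0 mulr1 mulr0. Qed.

Lemma cexpD z w : cexp (z + w) = cexp z * cexp w.
Proof.
apply: complex_ext; rewrite ?ReM ?ImM /= ReD ImD expRD ?cosD ?sinD; ring.
Qed.

Lemma normc_cexp z : normc (cexp z) = expR (Re z).
Proof.
rewrite /= !exprMn -mulrDr cos2Dsin2 mulr1 sqrtr_sqr ger0_norm// expR_ge0.
Qed.

Lemma cexp_sum (I : Type) (r : seq I) (P : pred I) (F : I -> R[i]) :
  cexp (\sum_(i <- r | P i) F i) = \prod_(i <- r | P i) cexp (F i).
Proof.
by elim/big_rec2: _ => [|i x y _ <-]; [exact: cexp0|rewrite cexpD].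
Qed.

Lemma cexp_natl z k : cexp (k%:R * z) = cexp z ^+ k.
Proof.
elim: k => [|k IH]; first by rewrite mul0r cexp0.
by rewrite mulrS mulrDl mul1r cexpD IH exprS.
Qed.

Lemma cexpN_mul z : cexp (- z) * cexp z = 1.
Proof. by rewrite -cexpD addNr cexp0. Qed.

Lemma cexp_ix x : cexp ('i%C * x%:C) = Complex (cos x) (sin x).
Proof.
rewrite /cexp /= !mul0r !mul1r ?mulr0 ?subr0 ?addr0 ?oppr0 ?add0r.
by rewrite expR0 !mul1r.
Qed.

Lemma cexp_2pi_int (k : int) : cexp ('i%C * (k%:~R * (2 * pi))%:C) = 1.
Proof.
have E (n : nat) : cexp ('i%C * (n%:R * (2 * pi))%:C) = 1.
  rewrite rmorphM rmorph_nat mulrCA cexp_natl cexp_ix.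
  by rewrite [2 * pi]mulr_natl cos2pi sin2pi expr1n.
case: k => n; first exact: E.
rewrite NegzE mulrNz mulNr rmorphN mulrN -[LHS]mulr1 -[X in _ * X](E n.+1).
by rewrite pmulrn cexpN_mul.
Qed.

Definition cexp_rem (K : nat) z t : R[i] :=
  cexp (t%:C * z) - \sum_(k < K) (t ^+ k / k`!%:R)%:C * z ^+ k.

Lemma cexp_remS K z t :
  cexp_rem K.+1 z t = cexp_rem K z t - (t ^+ K / K`!%:R)%:C * z ^+ K.
Proof. by rewrite /cexp_rem big_ord_recr /= opprD addrA. Qed.

Lemma is_derive_cexp z t :
  is_derive t 1 (fun s => Re (cexp (s%:C * z))) (Re (z * cexp (t%:C * z))) /\
  is_derive t 1 (fun s => Im (cexp (s%:C * z))) (Im (z * cexp (t%:C * z))).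
Proof.
have E s : s%:C * z = Complex (s * Re z) (s * Im z).
  by case: z => a b; apply: complex_ext; rewrite ?ReM ?ImM /=; ring.
split.
- rewrite (_ : (fun s => _) =
      (fun s => expR (s * Re z)) * (fun s => cos (s * Im z))); last first.
    by apply/funext => s; rewrite E.
  apply: is_derive_eq.
  by rewrite E ReM /= /GRing.scale /= !mulr1; ring.
- rewrite (_ : (fun s => _) =
      (fun s => expR (s * Re z)) * (fun s => sin (s * Im z))); last first.
    by apply/funext => s; rewrite E.
  apply: is_derive_eq.
  by rewrite E ImM /= /GRing.scale /= !mulr1; ring.
Qed.

End ComplexExponential.

Section ComplexTaylor.
Variable R : realType.
Implicit Types (z w a : R[i]) (x y t : R).

Lemma is_derive_monomial (c : R) (K : nat) t :
  is_derive t 1 (fun s => c * s ^+ K.+1 / K.+1`!%:R) (c * t ^+ K / K`!%:R).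
Proof.
have f0 : (0 : R) < K`!%:R by rewrite ltr0n fact_gt0.
have k0 : (0 : R) < K.+1%:R by [].
rewrite (_ : (fun s => _) = (c / K.+1`!%:R) *: ((@id R) ^+ K.+1)); last first.
  by apply/funext => u; rewrite !fctE /GRing.scale /= mulrAC.
apply: is_derive_eq; rewrite /GRing.scale /= mulr1 factS natrM.
by field; rewrite !gt_eqF.
Qed.

Lemma is_derive_cexp_rem (K : nat) z t :
  is_derive t 1 (fun s => Re (cexp_rem K.+1 z s)) (Re (z * cexp_rem K z t)) /\
  is_derive t 1 (fun s => Im (cexp_rem K.+1 z s)) (Im (z * cexp_rem K z t)).
Proof.
have ReR x w : Re (x%:C * w) = x * Re w by rewrite ReM /=; ring.
have ImR x w : Im (x%:C * w) = x * Im w by rewrite ImM /=; ring.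
have ReB w w' : Re (w - w') = Re w - Re w' by case: w w' => ? ? [].
have ImB w w' : Im (w - w') = Im w - Im w' by case: w w' => ? ? [].
elim: K => [|K [IHr IHi]].
  have [dr di] := is_derive_cexp z t.
  have E s : cexp_rem 1 z s = cexp (s%:C * z) - 1.
    by rewrite /cexp_rem big_ord1 expr0 fact0 divr1 expr0 mulr1 rmorph1.
  rewrite {2 4}/cexp_rem big_ord0 subr0; split.
  - rewrite (_ : (fun s => _) = (fun s => Re (cexp (s%:C * z))) - cst 1); last first.
      by apply/funext => s; rewrite E ReB.
    by apply: is_derive_eq; rewrite subr0.
  - rewrite (_ : (fun s => _) = (fun s => Im (cexp (s%:C * z))) - cst 0); last first.
      by apply/funext => s; rewrite E ImB.
    by apply: is_derive_eq; rewrite subr0.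
have E : z * cexp_rem K.+1 z t =
    z * cexp_rem K z t - (t ^+ K / K`!%:R)%:C * z ^+ K.+1.
  by rewrite cexp_remS exprS; ring.
have pw c := is_derive_monomial c K t.
split.
- rewrite (_ : (fun s => _) = (fun s => Re (cexp_rem K.+1 z s)) -
     (fun s => Re (z ^+ K.+1) * s ^+ K.+1 / K.+1`!%:R)); last first.
    by apply/funext => s; rewrite cexp_remS ReB ReR [_ * Re _]mulrC mulrA.
  have := pw (Re (z ^+ K.+1)) => dp.
  apply: is_derive_eq.
  by rewrite E ReB ReR [_ * Re _]mulrC mulrA.
- rewrite (_ : (fun s => _) = (fun s => Im (cexp_rem K.+1 z s)) -
     (fun s => Im (z ^+ K.+1) * s ^+ K.+1 / K.+1`!%:R)); last first.
    by apply/funext => s; rewrite cexp_remS ImB ImR [_ * Im _]mulrC mulrA.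
  have := pw (Im (z ^+ K.+1)) => dp.
  apply: is_derive_eq.
  by rewrite E ImB ImR [_ * Im _]mulrC mulrA.
Qed.

Lemma primitive_bound (g dg : R -> R) (c : R) (K : nat) :
  g 0 = 0 -> (forall t, is_derive t 1 g (dg t)) ->
  (forall t, 0 <= t <= 1 -> `|dg t| <= c * t ^+ K / K`!%:R) ->
  forall t, 0 <= t <= 1 -> `|g t| <= c * t ^+ K.+1 / K.+1`!%:R.
Proof.
move=> g0 dgP dgb t /andP[t0 t1].
have dh s := is_derive_monomial c K s.
have key (h dh' : R -> R) : h 0 = 0 -> (forall s : R, is_derive s 1 h (dh' s)) ->
    (forall s, 0 <= s <= 1 -> 0 <= dh' s) -> 0 <= h t.
  move=> h0 hd hp.
  have hd' x : x \in `]0, t[%R -> is_derive x 1 h (dh' x) by move=> _; exact: hd.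
  have hc : {within `[0, t], continuous h}.
    apply: derivable_within_continuous => x _.
    by have := hd x => ?; exact: ex_derive.
  have [u] := MVT_segment t0 hd' hc.
  rewrite in_itv /= h0 !subr0 => /andP[u0 ut] ->.
  by rewrite mulr_ge0// hp// u0 (le_trans ut).
rewrite ler_norml; apply/andP; split.
- rewrite -subr_ge0 opprK.
  apply: (key (g + (fun s => c * s ^+ K.+1 / K.+1`!%:R))
              (fun s => dg s + c * s ^+ K / K`!%:R)).
  + by rewrite /= !fctE g0 expr0n /= mulr0 mul0r addr0.
  + by move=> s s01; have := dgb s s01; rewrite ler_norml; lra.
- rewrite -subr_ge0.
  apply: (key ((fun s => c * s ^+ K.+1 / K.+1`!%:R) - g)
              (fun s => c * s ^+ K / K`!%:R - dg s)).
  + by rewrite /= !fctE g0 expr0n /= mulr0 mul0r subr0.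
  + by move=> s s01; have := dgb s s01; rewrite ler_norml; lra.
Qed.

Lemma cexp_rem_bound (K : nat) z t : 0 <= t <= 1 ->
  `|Re (cexp_rem K z t)| <= expR (normc z) * (2 * normc z) ^+ K * t ^+ K / K`!%:R /\
  `|Im (cexp_rem K z t)| <= expR (normc z) * (2 * normc z) ^+ K * t ^+ K / K`!%:R.
Proof.
elim: K t => [t t01|K IH].
  rewrite !expr0 fact0 divr1 !mulr1 /cexp_rem big_ord0 subr0.
  have E : normc (cexp (t%:C * z)) <= expR (normc z).
    rewrite normc_cexp ler_expR ReM /= mul0r subr0.
    have /andP[t0 t1] := t01.
    apply: le_trans (ler_norm _) _; rewrite normrM (ger0_norm t0).
    have := Re_le_normc z; have := normr_ge0 (Re z); nra.
  by split; [apply: le_trans (Re_le_normc _) E|apply: le_trans (Im_le_normc _) E].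
have R0 : cexp_rem K.+1 z 0 = 0.
  rewrite /cexp_rem mul0r cexp0 big_ord_recl /= expr0 fact0 divr1 mul1r.
  rewrite big1 ?addr0 ?subrr// => i _.
  by rewrite /bump /= add1n expr0n /= mul0r rmorph0 mul0r.
have B t : 0 <= t <= 1 -> normc (z * cexp_rem K z t) <=
     expR (normc z) * (2 * normc z) ^+ K.+1 * t ^+ K / K`!%:R.
  move=> t01; have [hr hi] := IH t t01.
  rewrite Normc.normcM.
  have n0 := normc_ge0 z.
  have := ler_wpM2l n0 (le_trans (normc_le (cexp_rem K z t)) (lerD hr hi)).
  by move=> /le_trans; apply; rewrite exprS le_eqVlt; apply/orP; left; apply/eqP; ring.
move=> t t01; split.
- apply: (@primitive_bound (fun s => Re (cexp_rem K.+1 z s))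
     (fun s => Re (z * cexp_rem K z s))) => //.
  + by rewrite R0.
  + by move=> s; have [] := is_derive_cexp_rem K z s.
  + by move=> s s01; apply: le_trans (Re_le_normc _) (B s s01).
- apply: (@primitive_bound (fun s => Im (cexp_rem K.+1 z s))
     (fun s => Im (z * cexp_rem K z s))) => //.
  + by rewrite R0.
  + by move=> s; have [] := is_derive_cexp_rem K z s.
  + by move=> s s01; apply: le_trans (Im_le_normc _) (B s s01).
Qed.

Lemma cexp_taylor (K : nat) z :
  normc (cexp z - \sum_(k < K) (k`!%:R^-1)%:C * z ^+ k) <=
  2 * (expR (normc z) * (2 * normc z) ^+ K / K`!%:R).
Proof.
have [] := @cexp_rem_bound K z 1; rewrite ?lexx ?ler01//.
rewrite /cexp_rem rmorph1 mul1r expr1n mulr1.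
under eq_bigr do rewrite expr1n mul1r.
move=> hr hi; apply: le_trans (normc_le _) _.
by rewrite mulr_natl mulr2n lerD.
Qed.

Lemma cexp_taylor2 z : normc (cexp z - 1 - z) <= 4 * expR (normc z) * normc z ^+ 2.
Proof.
have := cexp_taylor 2 z.
rewrite !big_ord_recr big_ord0 /= add0r expr0 expr1 !fact0 factS fact0 muln1.
rewrite invr1 !rmorph1 !mul1r opprD addrA => /le_trans; apply.
rewrite le_eqVlt; apply/orP; left; apply/eqP.
by rewrite (_ : 2`!%:R = 2 :> R)//; field.
Qed.

Lemma geometric_sum_unity (w : R[i]) (M : nat) :
  w ^+ M = 1 -> w != 1 -> \sum_(j < M) w ^+ j = 0.
Proof.
move=> wM w1; have := subrX1 w M; rewrite wM subrr => /esym/eqP.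
by rewrite mulf_eq0 subr_eq0 (negbTE w1) => /eqP.
Qed.

Lemma cexp_ix_neq1 x : 0 < x < 2 * pi -> cexp ('i%C * x%:C) != 1.
Proof.
move=> /andP[x0 x2]; apply/eqP; rewrite cexp_ix => -[+ _].
rewrite (_ : x = (x / 2) *+ 2); last by rewrite mulr2n -splitr.
rewrite cos_mulr2n cos2sin2 => /eqP.
have /lt0r_neq0 s0 : 0 < sin (x / 2).
  by apply: sin_gt0_pi; apply/andP; split; lra.
move=> /eqP E; have : sin (x / 2) ^+ 2 = 0 by move: E; rewrite mulr2n; lra.
by move/eqP; rewrite expf_eq0 (negbTE s0).
Qed.

Definition unity_root (M j : nat) : R[i] :=
  cexp ('i%C * (j%:R * (2 * pi / M%:R))%:C).

Lemma unity_rootX M j k : unity_root M j ^+ k = unity_root M k ^+ j.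
Proof.
by rewrite /unity_root -!cexp_natl; congr cexp; rewrite !rmorphM !rmorph_nat; ring.
Qed.

Lemma unity_root_period M k : (0 < M)%N -> unity_root M k ^+ M = 1.
Proof.
move=> M0; rewrite /unity_root -cexp_natl -[RHS](cexp_2pi_int R (Posz k)).
congr cexp; rewrite mulrCA; congr (_ * _).
rewrite complex_natr -rmorphM; congr (_%:C).
have M0' : (0 : R) < M%:R by rewrite ltr0n.
by rewrite -pmulrn; field; rewrite gt_eqF.
Qed.

Lemma normc_unity_root M j : normc (unity_root M j) = 1.
Proof. by rewrite /unity_root cexp_ix /= cos2Dsin2 sqrtr1. Qed.

Lemma sum_unity_root (M k : nat) : (0 < k < M)%N ->
  \sum_(j < M) unity_root M j ^+ k = 0.
Proof.
move=> /andP[k0 kM].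
have M0 : (0 < M)%N by exact: leq_ltn_trans kM.
under eq_bigr do rewrite unity_rootX.
apply: geometric_sum_unity; first exact: unity_root_period.
apply: cexp_ix_neq1.
have M0' : (0 : R) < M%:R by rewrite ltr0n.
have := pi_gt0 R => pi0.
have k0' : (0 : R) < k%:R by rewrite ltr0n.
have kM' : (k%:R : R) < M%:R by rewrite ltr_nat.
rewrite mulr_gt0 ?divr_gt0 ?mulr_gt0//= mulrCA.
by rewrite gtr_pMr ?mulr_gt0// ltr_pdivrMr// mul1r.
Qed.

Lemma circle_mean_cexp (M : nat) z : (0 < M)%N ->
  normc (M%:R^-1 * \sum_(j < M) cexp (unity_root M j * z) - 1) <=
  2 * (expR (normc z) * (2 * normc z) ^+ M / M`!%:R).
Proof.
move=> M0.
have M0' : (M%:R : R[i]) != 0 by rewrite pnatr_eq0 -lt0n.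
rewrite (_ : _ - 1 = M%:R^-1 * \sum_(j < M) (cexp (unity_root M j * z) -
   \sum_(k < M) (k`!%:R^-1)%:C * (unity_root M j * z) ^+ k)); last first.
  rewrite sumrB mulrBr; congr (_ - _).
  rewrite exchange_big /= (bigD1 (Ordinal M0)) //= [X in _ + X]big1 => [|i i0].
    rewrite addr0; under eq_bigr do rewrite expr0 fact0 invr1 rmorph1 mulr1.
    by rewrite sumr_const card_ord mulVf.
  under eq_bigr do rewrite exprMn mulrCA mulrC.
  rewrite -mulr_sumr sum_unity_root ?mulr0// ltn_ord andbT lt0n.
  by apply: contra i0 => /eqP i0; apply/eqP/val_inj.
rewrite Normc.normcM Normc.normcV complex_natr normcR ger0_norm//.
rewrite mulrC ler_pdivrMr ?ltr0n//.
apply: le_trans (normc_sum _ _ _) _.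
apply: (@le_trans _ _ (\sum_(j < M) 2 * (expR (normc z) * (2 * normc z) ^+ M / M`!%:R))).
  apply: ler_sum => j _; apply: le_trans (cexp_taylor _ _) _.
  by rewrite Normc.normcM normc_unity_root mul1r.
by rewrite sumr_const card_ord -[leLHS]mulr_natr.
Qed.

End ComplexTaylor.

Section SmoothFunctions.
Variables (R : realType) (n : nat).
Local Notation V := 'rV[R]_n.
Implicit Types (f g phi : V -> R) (x : V) (i j : 'I_n).
Local Notation e_ j := (delta_mx 0 j : V).
Local Notation partial := (@partial R n).

Lemma is_derive_line f x (v : V) (s df : R) :
  is_derive s (1 : R) (fun s : R => f (x + s *: v)) df <->
  is_derive (x + s *: v) v f df.
Proof.
have E : (fun h : R => h^-1 *: (((fun s : R => f (x + s *: v)) \o shift s) (h *: (1 : R)) -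
            f (x + s *: v))) =
         (fun h : R => h^-1 *: ((f \o shift (x + s *: v)) (h *: v) - f (x + s *: v))).
  apply/funext => h; rewrite /shift /=; congr (_ *: (f _ - _)).
by rewrite scalerDl [h%:A]mulr1 addrCA.
split=> -[d1 d2]; split.
- by rewrite /derivable -E.
- by rewrite -d2 /derive -E.
- by rewrite /derivable E.
- by rewrite -d2 /derive E.
Qed.

Lemma is_derive_partial f x j : differentiable f x ->
  is_derive x (e_ j) f (partial j f x).
Proof. by move=> df; apply: DeriveDef => //; exact: diff_derivable. Qed.

Lemma mvt_partial f j (t : R) x : (forall y, differentiable f y) -> 0 <= t ->
  exists2 c : R, 0 <= c <= t &
    f (x + t *: e_ j) - f x = t * partial j f (x + c *: e_ j).
Proof.
move=> df t0.
have D (s : R) : is_derive s (1 : R) (fun s : R => f (x + s *: e_ j))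
    (partial j f (x + s *: e_ j)).
  by apply/is_derive_line; exact: is_derive_partial.
have D' s : s \in `]0, t[%R -> is_derive s (1 : R)
    (fun s : R => f (x + s *: e_ j)) (partial j f (x + s *: e_ j)) by move=> _.
have hc : {within `[0, t], continuous (fun s : R => f (x + s *: e_ j))}.
  apply: derivable_within_continuous => s _.
  by have := D s => ?; exact: ex_derive.
have [c ct] := MVT_segment t0 D' hc.
by rewrite scale0r addr0 subr0 mulrC; exists c => //; move: ct; rewrite in_itv.
Qed.

Lemma mvt_partial_le f j (M t : R) x : (forall y, differentiable f y) ->
  (forall y, `|partial j f y| <= M) -> 0 <= t ->
  `|f (x + t *: e_ j) - f x| <= t * M.
Proof.
move=> df fM t0; have [c _ ->] := mvt_partial j x df t0.
by rewrite normrM (ger0_norm t0) ler_wpM2l.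
Qed.

Lemma mvt_partial2 f j (M t : R) x : (forall y, differentiable f y) ->
  (forall y, differentiable (partial j f) y) ->
  (forall y, `|partial j (partial j f) y| <= M) -> 0 <= t ->
  `|f (x + t *: e_ j) - f x - t * partial j f x| <= t ^+ 2 * M.
Proof.
move=> df ddf fM t0; have [c /andP[c0 ct] ->] := mvt_partial j x df t0.
have M0 : 0 <= M by exact: le_trans (normr_ge0 _) (fM x).
rewrite -mulrBr normrM (ger0_norm t0) expr2 -mulrA ler_wpM2l//.
apply: le_trans (mvt_partial_le x ddf fM c0) _.
by rewrite ler_wpM2r.
Qed.

Definition fdiff j (t : R) f : V -> R := fun x => f (x + t *: e_ j) - f x.

Lemma differentiable_fdiff j t f : (forall x, differentiable f x) ->
  forall x, differentiable (fdiff j t f) x.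
Proof.
move=> df x; apply: differentiableB => //.
by apply: differentiable_comp => //; exact: differentiableD.
Qed.

Lemma partial_fdiff i j t f : (forall x, differentiable f x) ->
  partial i (fdiff j t f) = fdiff j t (partial i f).
Proof.
move=> df; apply/funext => x.
have d1 : is_derive x (e_ i) (fun y => f (y + t *: e_ j)) (partial i f (x + t *: e_ j)).
  rewrite -[x in is_derive x]addr0 -(scale0r (e_ i)).
  apply/is_derive_line.
  rewrite (_ : (fun s : R => _) =
      (fun s : R => f (x + t *: e_ j + s *: e_ i))); last first.
    by apply/funext => s; rewrite addrAC.
  apply/is_derive_line; rewrite scale0r addr0.
  exact: is_derive_partial.
have d2 := is_derive_partial i (df x).
by rewrite /partial; apply: derive_val.
Qed.

Lemma foldr_partial_fdiff j t f s : smooth f ->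
  foldr partial (fdiff j t f) s = fdiff j t (foldr partial f s).
Proof.
move=> sf; elim: s => //= i s ->; apply: partial_fdiff => x.
exact: (sf s).
Qed.

Lemma smooth_fdiff j t f : smooth f -> smooth (fdiff j t f).
Proof.
move=> sf s x; rewrite foldr_partial_fdiff//; apply: differentiable_fdiff => y.
exact: (sf s).
Qed.

Lemma iter_fdiff_le j t (k : nat) f (M : R) x : 0 <= t -> smooth f ->
  (forall y, `|iter k (partial j) f y| <= M) ->
  `|iter k (fdiff j t) f x| <= t ^+ k * M.
Proof.
move=> t0; elim: k f M x => [|k IH] f M x sf fM; first by rewrite expr0 mul1r; exact: fM.
have itE (g : V -> R) m : iter m (partial j) g = foldr partial g (nseq m j).
  by elim: m => //= m ->.
rewrite iterSr exprSr -mulrA; apply: IH; first exact: smooth_fdiff.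
move=> y; rewrite itE foldr_partial_fdiff// -itE.
apply: mvt_partial_le => // z.
by rewrite itE; exact: sf.
Qed.

Lemma smooth_differentiable f x : smooth f -> differentiable f x.
Proof. by move=> sf; exact: (sf [::]). Qed.

Lemma smooth_partial j f : smooth f -> smooth (partial j f).
Proof. by move=> sf s x; have := sf (rcons s j) x; rewrite foldr_rcons. Qed.

Lemma smooth_continuous f : smooth f -> continuous f.
Proof. by move=> sf x; exact/differentiable_continuous/smooth_differentiable. Qed.

Lemma supp_partial j f : supp (partial j f) `<=` supp f.
Proof.
rewrite [X in X `<=` _]closureE; apply: smallest_sub; first exact: closed_closure.
move=> x /= fx; apply: contrapT => xf.
case/eqP: fx; have : \forall y \near x, f y = 0.
  have oS : open (~` supp f) by exact/closed_openC/closed_closure.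
  have : nbhs x (~` supp f) by apply: open_nbhs_nbhs; split.
  apply: filterS => y fy.
  by apply: contrapT => /eqP fy0; apply: fy; exact: subset_closure.
move=> f0; rewrite /partial (@near_eq_derive _ _ _ _ (cst 0)).
  by rewrite derive_cst.
by apply: filterS f0 => y ->.
Qed.

Lemma supp_iter_partial j k f : supp (iter k (partial j) f) `<=` supp f.
Proof. by elim: k => //= k IH x /supp_partial/IH. Qed.

Lemma test_function_partial U j f :
  test_function U f -> test_function U (partial j f).
Proof.
move=> [sf cf fU]; split; first exact: smooth_partial.
- apply: (subclosed_compact _ cf); last exact: supp_partial.
  exact: closed_closure.
- by move=> x /supp_partial/fU.
Qed.

Lemma test_function_iter U j k f :
  test_function U f -> test_function U (iter k (partial j) f).
Proof. by elim: k => //= k IH /IH; exact: test_function_partial. Qed.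

Lemma eq0_notin_supp f x : ~ supp f x -> f x = 0.
Proof. by move=> fx; apply: contrapT => /eqP f0; apply: fx; exact: subset_closure. Qed.

Lemma test_function_bounded U f : test_function U f ->
  exists2 M : R, 0 <= M & forall x, `|f x| <= M.
Proof.
move=> [sf cf fU].
have /ex_strict_bound_gt0[k k0 /= kf] : bounded_set (f @` supp f).
  apply/compact_bounded/continuous_compact => //.
  exact/continuous_subspaceT/smooth_continuous.
exists k; first exact: ltW.
move=> x; have [xf|xf] := pselect (supp f x); last by rewrite eq0_notin_supp// normr0 ltW.
by apply: ltW; apply: kf; exists x.
Qed.

(* Leaves room for the finitely many grid shifts used in summation by parts. *)
Definition cell_supported (a : R) f := forall x, f x != 0 -> forall j, `|x 0 j| <= a.

Lemma coord_le_norm x j : `|x 0 j| <= `|x|.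
Proof.
rewrite [leRHS]mx_normrE.
exact: (le_bigmax _ (fun i : 'I_1 * 'I_n => `|x i.1 i.2|) (0, j)).
Qed.

Lemma test_function_cell f : test_function (@torus_cell R n) f ->
  exists2 a : R, 0 < a < pi & cell_supported a f.
Proof.
move=> [sf cf fU].
have pi0 := pi_gt0 R.
have [f0|/set0P f0] := eqVneq (supp f) set0.
  exists (pi / 2) => [|x]; first by apply/andP; split; lra.
  by move=> fx; have : supp f x by [exact: subset_closure]; rewrite f0.
have cn : {within supp f, continuous (fun x : V => `|x|)}.
  by apply: continuous_subspaceT => x; exact: norm_continuous.
have [c cf' cM] := compact_EVT_max f0 cf cn.
move: cf'; rewrite inE => /fU cpi.
have npi : `|c| < pi.
  have [c0|] := eqVneq (mx_norm c) 0; first by rewrite [ltLHS]c0.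
  move=> /mx_norm_neq0[[i j] E]; rewrite [ltLHS]E /= ltr_norml.
  by rewrite ord1 cpi.
exists (Num.max `|c| (pi / 2)).
  apply/andP; split; rewrite ?lt_max ?gt_max ?npi/=; first by apply/orP; right; lra.
  lra.
move=> x fx j; rewrite le_max (le_trans (coord_le_norm _ _))// cM// inE.
exact: subset_closure.
Qed.

End SmoothFunctions.

Section RiemannSums.
Variables (R : realType) (n : nat).
Local Notation V := 'rV[R]_n.
Implicit Types (psi : V -> R[i]) (x : V) (i j : 'I_n) (q : nat) (zeta : 'I_n -> R[i]).
Local Notation e_ j := (delta_mx 0 j : V).

Definition mesh q : R := 2 * pi / (q.*2.+1)%:R.

Lemma mesh_gt0 q : 0 < mesh q.
Proof. by rewrite /mesh divr_gt0// mulr_gt0// pi_gt0. Qed.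

Lemma mesh_ge0 q : 0 <= mesh q. Proof. exact/ltW/mesh_gt0. Qed.

Lemma mesh_natl q : (q.*2.+1)%:R * mesh q = 2 * pi.
Proof. by rewrite mulrC divfK// pnatr_eq0. Qed.

Lemma cvg_mesh : mesh @ \oo --> (0 : R).
Proof.
rewrite -(mulr0 (2 * pi)); apply: cvgMr => /=.
apply: (@cvg0_le _ _ (fun q => q.+1%:R^-1)); first exact: cvg_harmonic.
apply: nearW => q; rewrite ger0_norm// lef_pV2 ?posrE ?ltr0n// ler_nat.
by rewrite ltnS -addnn leq_addr.
Qed.

Definition gridpt q (k : {ffun 'I_n -> 'I_(q.*2.+1)}) : V :=
  \row_j (- pi + (k j)%:R * mesh q).

Lemma gridpt_bound q (k : {ffun 'I_n -> 'I_(q.*2.+1)}) j : `|gridpt k 0 j| <= pi.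
Proof.
rewrite mxE ler_norml; have h0 := mesh_gt0 q; have p0 := pi_gt0 R.
have k0 : (0 : R) <= (k j)%:R by [].
have kL : ((k j)%:R : R) <= (q.*2.+1)%:R by rewrite ler_nat ltnW.
have := mesh_natl q; nra.
Qed.

Definition rsum q psi : R[i] :=
  (mesh q ^+ n)%:C * \sum_(k : {ffun 'I_n -> 'I_(q.*2.+1)}) psi (gridpt k).

Lemma mesh_card q :
  mesh q ^+ n * #|{: {ffun 'I_n -> 'I_(q.*2.+1)}}|%:R = (2 * pi) ^+ n.
Proof. by rewrite card_ffun !card_ord natrX -exprMn mulrC mesh_natl. Qed.

Lemma rsum_le q psi (M : R) :
  (forall x, (forall j, `|x 0 j| <= pi) -> normc (psi x) <= M) ->
  normc (rsum q psi) <= (2 * pi) ^+ n * M.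
Proof.
move=> pM; rewrite /rsum Normc.normcM normcR ger0_norm ?exprn_ge0 ?mesh_ge0//.
rewrite -(mesh_card q) -[leRHS]mulrA ler_wpM2l ?exprn_ge0 ?mesh_ge0//.
apply: le_trans (normc_sum _ _ _) _.
apply: (@le_trans _ _ (\sum_(k : {ffun 'I_n -> 'I_(q.*2.+1)}) M)).
  by apply: ler_sum => k _; apply: pM => j; exact: gridpt_bound.
by rewrite sumr_const [leRHS]mulr_natl.
Qed.

Lemma rsumD q psi psi' :
  rsum q (fun x => psi x + psi' x) = rsum q psi + rsum q psi'.
Proof. by rewrite /rsum big_split mulrDr. Qed.

Lemma rsumZ q a psi : rsum q (fun x => a * psi x) = a * rsum q psi.
Proof. by rewrite /rsum -mulr_sumr mulrCA. Qed.

Lemma rsumB q psi psi' :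
  rsum q (fun x => psi x - psi' x) = rsum q psi - rsum q psi'.
Proof. by rewrite /rsum sumrB mulrBr. Qed.

Definition cyclic_shift q j (k : {ffun 'I_n -> 'I_(q.*2.+1)}) :
    {ffun 'I_n -> 'I_(q.*2.+1)} :=
  [ffun i => if i == j then ordS (k i) else k i].

Lemma cyclic_shift_inj q j : injective (@cyclic_shift q j).
Proof.
move=> k k' /ffunP E; apply/ffunP => i; have := E i; rewrite !ffunE.
by case: ifP => // _; exact: (can_inj (@ordSK _)).
Qed.

Lemma rsum_shift q j psi :
  (forall x, pi <= `|x 0 j| -> psi x = 0) ->
  rsum q (fun x => psi (x + mesh q *: e_ j)) = rsum q psi.
Proof.
move=> p0; congr (_ * _).
rewrite [RHS](reindex_inj (@cyclic_shift_inj q j)); apply: eq_bigr => k _.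
have pi0 := pi_gt0 R.
have S (a : nat) : a%:R * mesh q + mesh q = a.+1%:R * mesh q.
  by rewrite -natr1 mulrDl mul1r.
have [kL|kL] := eqVneq (k j).+1 q.*2.+1.
  rewrite !p0// !mxE /= ?ffunE eqxx /=.
    by rewrite kL modnn mul0r addr0 normrN ger0_norm// ltW.
  rewrite mulr1 -addrA S kL mesh_natl ger0_norm; lra.
congr psi; apply/rowP => i; rewrite !mxE ffunE eq_sym.
have [->|ij] := eqVneq i j; last by rewrite /= mulr0 addr0.
rewrite /= mulr1 modn_small; last by rewrite ltn_neqAle kL ltn_ord.
by rewrite -addrA S.
Qed.

Definition echar zeta x : R[i] := cexp ('i%C * \sum_j zeta j * (x 0 j)%:C).

Lemma echarD zeta zeta' x :
  echar (fun j => zeta j + zeta' j) x = echar zeta x * echar zeta' x.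
Proof.
rewrite /echar -cexpD -mulrDr -big_split; congr (cexp (_ * _)).
by apply: eq_bigr => j _; rewrite mulrDl.
Qed.

Lemma echar_shift zeta x j t :
  echar zeta (x + t *: e_ j) = echar zeta x * cexp ('i%C * (zeta j * t%:C)).
Proof.
rewrite /echar -cexpD -mulrDr; congr (cexp (_ * _)).
rewrite (bigD1 j) //= [in RHS](bigD1 j) //= [RHS]addrAC.
congr (_ + _); first by rewrite !mxE !eqxx mulr1 rmorphD mulrDr.
apply: eq_bigr => i ij; rewrite !mxE eqxx (negbTE ij) /=.
by rewrite mulr0 addr0.
Qed.

Definition imnorm zeta : R := pi * \sum_j `|Im (zeta j)|.

Lemma echar_le zeta x : (forall j, `|x 0 j| <= pi) ->
  normc (echar zeta x) <= expR (imnorm zeta).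
Proof.
move=> xpi; rewrite normc_cexp ler_expR.
have -> z : Re ('i%C * z) = - Im z by case: z => a b /=; ring.
apply: le_trans (ler_norm _) _; rewrite normrN.
have -> (I : Type) (r : seq I) (F : I -> R[i]) : Im (\sum_(i <- r) F i) = \sum_(i <- r) Im (F i).
  by elim/big_rec2: _ => [|i a b _ <-]; rewrite ?ImD.
apply: le_trans (ler_norm_sum _ _ _) _; rewrite /imnorm mulr_sumr.
apply: ler_sum => j _; rewrite ImM /= mulr0 add0r normrM mulrC.
by rewrite ler_wpM2r.
Qed.

End RiemannSums.

Section FourierTransform.
Variables (R : realType) (n : nat).
Local Notation V := 'rV[R]_n.
Local Notation e_ j := (delta_mx 0 j : V).
Local Notation partial := (@partial R n).
Implicit Types (psi : V -> R[i]) (f phi : V -> R) (x : V) (i j : 'I_n) (q : nat).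
Implicit Types (zeta : 'I_n -> R[i]).

Definition box_bounded (M : R) psi :=
  forall x, (forall j, `|x 0 j| <= pi) -> normc (psi x) <= M.

Definition ftrans zeta psi : R[i] :=
  clim (fun q => rsum q (fun x => echar zeta x * psi x)).

Definition ftconst zeta : R := 2 * ((2 * pi) ^+ n * expR (imnorm zeta)).

Lemma rsum_echar_le zeta psi M q : box_bounded M psi ->
  normc (rsum q (fun x => echar zeta x * psi x)) <=
  (2 * pi) ^+ n * (expR (imnorm zeta) * M).
Proof.
move=> pM; apply: rsum_le => x xpi; rewrite Normc.normcM.
by apply: ler_pM (echar_le _ xpi) (pM x xpi); exact: normc_ge0.
Qed.

Lemma bounded_rsum zeta psi M : box_bounded M psi ->
  bounded_seq (fun q => rsum q (fun x => echar zeta x * psi x)).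
Proof. by move=> pM; eexists => q; exact: rsum_echar_le pM. Qed.

Lemma ftrans_le zeta psi M : box_bounded M psi ->
  normc (ftrans zeta psi) <= ftconst zeta * M.
Proof.
move=> pM; rewrite /ftconst -!mulrA; apply: normc_clim_le.
  exact: bounded_rsum pM.
by apply: nearW => q; exact: rsum_echar_le.
Qed.

Lemma ftransD zeta psi psi' M M' : box_bounded M psi -> box_bounded M' psi' ->
  ftrans zeta (fun x => psi x + psi' x) = ftrans zeta psi + ftrans zeta psi'.
Proof.
move=> pM pM'; rewrite /ftrans -climD; [|exact: bounded_rsum pM|exact: bounded_rsum pM'].
by congr clim; apply/funext => q; rewrite -rsumD; congr rsum; apply/funext => x; rewrite mulrDr.
Qed.

Lemma ftransZ zeta a psi M : box_bounded M psi ->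
  ftrans zeta (fun x => a * psi x) = a * ftrans zeta psi.
Proof.
move=> pM; rewrite /ftrans -climZ; last exact: bounded_rsum pM.
by congr clim; apply/funext => q; rewrite -rsumZ; congr rsum; apply/funext => x; rewrite mulrCA.
Qed.

Lemma ftrans_echar zeta zeta' psi :
  ftrans zeta (fun x => echar zeta' x * psi x) =
  ftrans (fun j => zeta j + zeta' j) psi.
Proof.
congr clim; apply/funext => q; congr rsum; apply/funext => x.
by rewrite echarD mulrA.
Qed.

Definition toC f : V -> R[i] := fun x => (f x)%:C.

Lemma box_bounded_toC f (M : R) : (forall x, `|f x| <= M) -> box_bounded M (toC f).
Proof. by move=> fM x _; rewrite normcR. Qed.

Lemma cell_supported_fdiff a j t f : 0 <= t -> cell_supported a f ->
  cell_supported (a + t) (fdiff j t f).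
Proof.
move=> t0 fa x fx i; have [fx0|fx0] := eqVneq (f x) 0; last first.
  by rewrite (le_trans (fa x fx0 i))// lerDl.
have : f (x + t *: e_ j) != 0 by move: fx; rewrite /fdiff fx0 subr0.
move=> /fa/(_ i); rewrite !mxE => xa.
set d := t * _ in xa *.
rewrite -[x 0 i](addrK d) (le_trans (ler_normB _ _))// lerD// /d.
by case: (_ && _); rewrite /= ?mulr1 ?mulr0 ?normr0// ger0_norm.
Qed.

Lemma rsum_fdiff zeta a j q f : a < pi -> cell_supported a f ->
  rsum q (fun x => echar zeta x * toC (fdiff j (mesh R q) f) x) =
  (cexp (- ('i%C * (zeta j * (mesh R q)%:C))) - 1) *
    rsum q (fun x => echar zeta x * toC f x).
Proof.
move=> api fa.
have sh := @rsum_shift R n q j (fun x => echar zeta x * toC f x).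
rewrite mulrBl mul1r -[in X in _ = _ * X - _]sh => [|x xpi]; last first.
  apply/eqP; rewrite mulf_eq0; apply/orP; right; apply/eqP.
  rewrite /toC; have [->//|/fa/(_ j)] := eqVneq (f x) 0.
  by move=> /le_lt_trans/(_ api); rewrite ltNge xpi.
rewrite -rsumZ -rsumB; congr rsum; apply/funext => x.
rewrite echar_shift /toC /fdiff rmorphB mulrBr; congr (_ - _).
move: (cexpN_mul ('i%C * (zeta j * (mesh R q)%:C))).
move: (cexp _) (cexp _) (echar _ _) => c2 c1 c3 c12.
by rewrite [c3 * c2]mulrC 2!mulrA c12 mul1r.
Qed.

Lemma rsum_iter_fdiff zeta a j q k f : a + k%:R * mesh R q < pi ->
  cell_supported a f ->
  rsum q (fun x => echar zeta x * toC (iter k (fdiff j (mesh R q)) f) x) =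
  (cexp (- ('i%C * (zeta j * (mesh R q)%:C))) - 1) ^+ k *
    rsum q (fun x => echar zeta x * toC f x).
Proof.
have h0 := mesh_ge0 R q.
elim: k a f => [|k IH] a f; first by rewrite expr0 mul1r.
rewrite -natr1 mulrDl mul1r => api fa.
rewrite iterSr (IH (a + mesh R q)); last exact: cell_supported_fdiff.
- rewrite (@rsum_fdiff _ a) ?exprSr ?mulrA//.
  have : 0 <= k%:R * mesh R q by rewrite mulr_ge0.
  lra.
- by lra.
Qed.

Lemma ftrans_partial zeta j phi : test_function (@torus_cell R n) phi ->
  ftrans zeta (toC (partial j phi)) = - ('i%C * zeta j) * ftrans zeta (toC phi).
Proof.
move=> tphi.
have [a /andP[a0 api] phia] := test_function_cell tphi.
have [M0 M00 phiM0] := test_function_bounded tphi.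
have [M1 M10 phiM1] := test_function_bounded (test_function_partial j tphi).
have [M2 M20 phiM2] :=
  test_function_bounded (test_function_partial j (test_function_partial j tphi)).
have [sphi _ _] := tphi.
set c := fun q => (mesh R q)^-1%:C * (cexp (- ('i%C * (zeta j * (mesh R q)%:C))) - 1).
set err := fun q => rsum q (fun x => echar zeta x *
  toC (fun x => partial j phi x - (mesh R q)^-1 * fdiff j (mesh R q) phi x) x).
have E q : rsum q (fun x => echar zeta x * toC (partial j phi) x) =
    c q * rsum q (fun x => echar zeta x * toC phi x) + err q.
  rewrite /c -mulrA -(rsum_fdiff _ _ _ api phia) -rsumZ /err -rsumD.
  congr rsum; apply/funext => x; rewrite /toC mulrCA -mulrDr; congr (_ * _).
  by rewrite -rmorphM -rmorphD addrC subrK.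
have errb q x : `|partial j phi x - (mesh R q)^-1 * fdiff j (mesh R q) phi x| <=
    mesh R q * M2.
  have h0 := mesh_gt0 R q.
  rewrite -(ler_pM2l h0) -[X in X * `|_|]gtr0_norm// -normrM mulrBr mulVKf ?gt_eqF//.
  rewrite distrC mulrA -expr2; apply: mvt_partial2 => //; last exact: ltW.
  - by move=> y; exact: smooth_differentiable.
  - by move=> y; apply: smooth_differentiable; exact: smooth_partial.
have cerr : (fun q => normc (err q - 0)) @ \oo --> 0.
  apply: (@cvg0_le _ _ (fun q => mesh R q *
     ((2 * pi) ^+ n * (expR (imnorm zeta) * M2)))).
    rewrite -[X in _ --> X](mul0r ((2 * pi) ^+ n * (expR (imnorm zeta) * M2))).
    by apply: cvgMl; exact: cvg_mesh.
  apply: nearW => q; rewrite subr0 ger0_norm ?normc_ge0//.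
  rewrite mulrCA [mesh R q * _]mulrCA.
  by apply: rsum_echar_le; apply: box_bounded_toC => x; exact: errb.
pose D := 4 * expR (normc (zeta j) * (2 * pi)) * normc (zeta j) ^+ 2.
have D0 : 0 <= D by rewrite !mulr_ge0 ?expR_ge0 ?exprn_ge0 ?normc_ge0.
have h2pi q : mesh R q <= 2 * pi.
  by rewrite ler_pdivrMr ?ltr0n// ler_peMr ?mulr_ge0 ?pi_ge0// ler1n.
have cD q : normc (c q - - ('i%C * zeta j)) <= mesh R q * D.
  have h0 := mesh_gt0 R q.
  have hC : (mesh R q)%:C != 0 :> R[i] by rewrite fmorph_eq0 gt_eqF.
  set w := - ('i%C * (zeta j * (mesh R q)%:C)).
  have -> : c q - - ('i%C * zeta j) = (mesh R q)^-1%:C * (cexp w - 1 - w).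
    by rewrite /c /w [RHS]mulrBr fmorphV; congr (_ - _); field.
  have nw : normc w = normc (zeta j) * mesh R q.
    by rewrite /w normcN !Normc.normcM normc_i mul1r normcR gtr0_norm.
  rewrite Normc.normcM normcR gtr0_norm ?invr_gt0// ler_pdivrMl//.
  apply: le_trans (cexp_taylor2 _) _; rewrite nw exprMn.
  have -> : mesh R q * (mesh R q * D) = 4 * expR (normc (zeta j) * (2 * pi)) *
      (normc (zeta j) ^+ 2 * mesh R q ^+ 2) by rewrite /D; ring.
  apply: ler_wpM2r; first by rewrite mulr_ge0// sqr_ge0.
  apply: ler_wpM2l => //.
  by rewrite ler_expR ler_wpM2l ?normc_ge0.
have cc : (fun q => normc (c q - (- ('i%C * zeta j)))) @ \oo --> 0.
  apply: (@cvg0_le _ _ (fun q => mesh R q * D)).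
    by rewrite -[X in _ --> X](mul0r D); apply: cvgMl; exact: cvg_mesh.
  by apply: nearW => q; rewrite ger0_norm ?normc_ge0.
have bc : bounded_seq c.
  exists (2 * pi * D + normc (- ('i%C * zeta j))) => q.
  rewrite -[c q](subrK (- ('i%C * zeta j))).
  apply: le_trans (le_normcD _ _) _; rewrite lerD2r.
  by apply: le_trans (cD q) _; rewrite ler_wpM2r.
rewrite /ftrans.
under eq_fun do rewrite E.
have bphi : bounded_seq (fun q => rsum q (fun x => echar zeta x * toC phi x)).
  by apply: bounded_rsum; exact: box_bounded_toC phiM0.
have berr : bounded_seq err.
  exists ((2 * pi) ^+ n * (expR (imnorm zeta) * (2 * pi * M2))) => q.
  apply: rsum_echar_le; apply: box_bounded_toC => x.
  by apply: le_trans (errb q x) _; rewrite ler_wpM2r.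
rewrite (climD (bounded_seqM bc bphi) berr) (climM bc bphi).
by rewrite (cvg_clim cc) (cvg_clim cerr) addr0.
Qed.

End FourierTransform.

Section Decay.
Variables (R : realType) (n : nat).
Local Notation V := 'rV[R]_n.
Local Notation partial := (@partial R n).
Implicit Types (psi : V -> R[i]) (f phi : V -> R) (x : V) (i j : 'I_n) (q : nat).
Implicit Types (zeta : 'I_n -> R[i]) (m : 'rV[int]_n).

Lemma ftrans_iter_partial zeta j k phi : test_function (@torus_cell R n) phi ->
  ftrans zeta (toC (iter k (partial j) phi)) =
  (- ('i%C * zeta j)) ^+ k * ftrans zeta (toC phi).
Proof.
move=> tphi; elim: k => [|k IH]; first by rewrite mul1r.
rewrite iterS ftrans_partial; last exact: test_function_iter.
by rewrite IH exprS mulrA.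
Qed.

Lemma ftrans_mpartial zeta (a : multinom n) phi :
  test_function (@torus_cell R n) phi ->
  test_function (@torus_cell R n) (mpartial a phi) /\
  ftrans zeta (toC (mpartial a phi)) =
  (\prod_j (- ('i%C * zeta j)) ^+ (mpoly.fun_of_multinom a j)) *
    ftrans zeta (toC phi).
Proof.
move=> tphi; rewrite /mpartial -(big_enum _ _ _ (fun j => _ ^+ mpoly.fun_of_multinom a j)) /=.
elim: (enum 'I_n) => [|j s [tIH IH]]; first by rewrite big_nil mul1r.
rewrite big_cons /=; split; first exact: test_function_iter.
by rewrite ftrans_iter_partial// IH mulrA.
Qed.

Lemma mpartial_pure (k : nat) j phi :
  exists2 a : multinom n, mdeg a = k & mpartial a phi = iter k (partial j) phi.
Proof.
pose a := mpoly.mnm_muln (mpoly.mnm1 j) k.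
exists a; first by rewrite mpoly.mdegMn mpoly.mdeg1 mul1n.
have aE i : mpoly.fun_of_multinom a i = if j == i then k else 0%N.
  by rewrite mpoly.mulmnE mpoly.mnm1E; case: (j == i); rewrite ?mul1n ?mul0n.
rewrite /mpartial.
have : uniq (enum 'I_n) by exact: enum_uniq.
have : j \in enum 'I_n by rewrite mem_enum.
elim: (enum 'I_n) => [//|i s IH].
rewrite inE /= aE => /orP[/eqP ji|js] /andP[is_ us].
  rewrite -ji eqxx in is_ *; congr iter.
  elim: s is_ {IH us} => [|l s IH]; first by [].
  rewrite inE negb_or => /andP[jl /IH /= ->].
  by rewrite aE (negbTE jl).
have /negbTE -> : j != i by apply: contraNneq is_ => <-.
by rewrite /= IH.
Qed.

Lemma mpartial0 phi : mpartial mpoly.mnm0 phi = phi.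
Proof.
by rewrite /mpartial; elim: (enum 'I_n) => //= j s ->; rewrite mpoly.mnm0E.
Qed.

Lemma exprD_le (a b : R) k : 0 <= a -> 0 <= b ->
  (a + b) ^+ k <= 2 ^+ k * (a ^+ k + b ^+ k).
Proof.
move=> a0 b0; wlog ab : a b a0 b0 / a <= b.
  by move=> H; case: (leP a b) => [|/ltW] /H; [exact|rewrite addrC [_ ^+ _ + _]addrC; exact].
apply: (@le_trans _ _ ((2 * b) ^+ k)).
  by apply: lerXn2r; rewrite ?nnegrE ?addr_ge0 ?mulr_ge0//; lra.
by rewrite exprMn ler_wpM2l ?exprn_ge0// lerDr exprn_ge0.
Qed.

Lemma sum_sqr_le (t : 'I_n -> R) (K : nat) (X C : R) : 0 <= X -> X <= C ->
  (forall j, `|t j| ^+ (2 * K) * X <= C) ->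
  (1 + \sum_j t j ^+ 2) ^+ K * X <= n.+1%:R ^+ K * C.
Proof.
move=> X0 XC tC.
have key (u : R) : 1 <= u -> (forall j, t j ^+ 2 <= u) -> u ^+ K * X <= C ->
    (1 + \sum_j t j ^+ 2) ^+ K * X <= n.+1%:R ^+ K * C.
  move=> u1 tu uC.
  have S0 : 0 <= \sum_j t j ^+ 2 by apply: sumr_ge0 => j _; exact: sqr_ge0.
  have Su : 1 + \sum_j t j ^+ 2 <= n.+1%:R * u.
    rewrite -natr1 mulrDl mul1r addrC lerD//.
    apply: le_trans (ler_sum _ (fun j _ => tu j)) _.
    by rewrite sumr_const card_ord -[leLHS]mulr_natl.
  apply: (@le_trans _ _ ((n.+1%:R * u) ^+ K * X)).
    rewrite ler_wpM2r//; apply: lerXn2r => //; rewrite nnegrE; lra.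
  by rewrite exprMn -mulrA ler_wpM2l// exprn_ge0.
have [/existsP[j0 tj0]|/existsPn H] := boolP [exists j, 1 <= t j ^+ 2]; last first.
  apply: (key 1) => //; last by rewrite expr1n mul1r.
  by move=> j; have := H j; rewrite -ltNge => /ltW.
have [j _ jM] := Order.TotalTheory.arg_maxP (fun j => t j ^+ 2) (erefl true : predT j0).
apply: (key (t j ^+ 2)).
- exact: (le_trans tj0 (jM j0 isT)).
- by move=> i; exact: jM.
- by have := tC j; rewrite exprM real_normK ?num_real.
Qed.

Definition jap m : R := 1 + normZ2 R m.

Lemma jap_ge1 m : 1 <= jap m.
Proof. by rewrite /jap lerDl sumr_ge0// => j _; exact: sqr_ge0. Qed.

Lemma jap_gt0 m : 0 < jap m.
Proof. exact: lt_le_trans ltr01 (jap_ge1 m). Qed.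

Definition zfreq m : 'I_n -> R[i] := fun j => ((m 0 j)%:~R : R)%:C.

Definition shift_freq m (w : 'I_n -> R) (z : R[i]) : 'I_n -> R[i] :=
  fun j => zfreq m j + z * (w j)%:C.

Definition derivs_le (K : nat) phi (M : R) :=
  (forall x, `|phi x| <= M) /\
  (forall j x, `|iter (2 * K) (partial j) phi x| <= M).

Lemma ftrans_decay (w : 'I_n -> R) (r0 : R) (K : nat) : 0 <= r0 ->
  exists2 C : R, 0 <= C & forall phi M m z, test_function (@torus_cell R n) phi ->
    derivs_le K phi M -> normc z <= r0 ->
    jap m ^+ K * normc (ftrans (shift_freq m w z) (toC phi)) <= C * M.
Proof.
move=> r00.
pose A := 2 * ((2 * pi) ^+ n * expR (pi * \sum_j (r0 * `|w j|))).
pose W := \sum_j (r0 * `|w j|).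
have W0 : 0 <= W by apply: sumr_ge0 => j _; rewrite mulr_ge0.
have A0 : 0 <= A by rewrite !mulr_ge0 ?exprn_ge0 ?mulr_ge0 ?pi_ge0 ?expR_ge0.
pose B := 2 ^+ (2 * K) * (1 + W ^+ (2 * K)) * A + A.
exists (n.+1%:R ^+ K * B).
  rewrite mulr_ge0 ?exprn_ge0// /B addr_ge0// mulr_ge0// mulr_ge0 ?exprn_ge0//.
  by rewrite addr_ge0// exprn_ge0.
move=> phi M m z tphi [phiM dphiM] zr.
set zeta := shift_freq m w z.
have Wj j : r0 * `|w j| <= W.
  by rewrite /W (bigD1 j)//= lerDl sumr_ge0// => i _; rewrite mulr_ge0.
have M0 : 0 <= M by exact: le_trans (normr_ge0 _) (phiM 0).
have zw j : normc (z * (w j)%:C) <= r0 * `|w j|.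
  by rewrite Normc.normcM normcR ler_wpM2r.
have fA : ftconst zeta <= A.
  rewrite /ftconst /A ler_wpM2l// ler_wpM2l ?exprn_ge0 ?mulr_ge0 ?pi_ge0//.
  rewrite ler_expR ler_wpM2l ?pi_ge0//; apply: ler_sum => j _.
  by rewrite ImD /= add0r; exact: le_trans (Im_le_normc _) (zw j).
have fle f : (forall x, `|f x| <= M) -> normc (ftrans zeta (toC f)) <= A * M.
  move=> fM; apply: le_trans (ftrans_le _ (box_bounded_toC fM)) _.
  by rewrite ler_wpM2r.
rewrite /jap /normZ2 -mulrA; apply: sum_sqr_le; first exact: normc_ge0.
  apply: le_trans (fle _ phiM) _; rewrite ler_wpM2r// /B lerDr.
  by rewrite mulr_ge0// mulr_ge0 ?exprn_ge0// addr_ge0// exprn_ge0.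
move=> j.
have mj : `|(m 0 j)%:~R : R| <= normc (zeta j) + W.
  rewrite -normcR -[X in normc X](addrK (z * (w j)%:C)).
  apply: le_trans (le_normcD _ _) _; rewrite normcN lerD2l.
  exact: le_trans (zw j) (Wj j).
have := exprD_le (2 * K) (normc_ge0 (zeta j)) W0.
move=> H; have {H} := le_trans (lerXn2r (2 * K) _ _ mj) H.
rewrite !nnegrE addr_ge0 ?normc_ge0// => /(_ (normr_ge0 _) isT) H.
apply: le_trans (ler_wpM2r (normc_ge0 _) H) _.
rewrite -mulrA mulrDl.
have -> : normc (zeta j) ^+ (2 * K) * normc (ftrans zeta (toC phi)) =
    normc (ftrans zeta (toC (iter (2 * K) (partial j) phi))).
  rewrite ftrans_iter_partial// Normc.normcM normcX normcN Normc.normcM.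
  by rewrite normc_i mul1r.
apply: (@le_trans _ _ (2 ^+ (2 * K) * (A * M + W ^+ (2 * K) * (A * M)))).
  by rewrite ler_wpM2l ?exprn_ge0// lerD ?fle// ler_wpM2l ?exprn_ge0 ?fle.
have -> : B * M = 2 ^+ (2 * K) * (A * M + W ^+ (2 * K) * (A * M)) + A * M.
  by rewrite /B; ring.
by rewrite lerDl mulr_ge0.
Qed.

Lemma cexp_ix_lower : exists2 c : R, 0 < c & forall x : R, `|x| <= pi ->
  c * `|x| <= normc (cexp ('i%C * x%:C) - 1).
Proof.
have pi0 := pi_gt0 R.
have c0 : 0 < cos (pi / 4) :> R.
  by apply: cos_gt0_pihalf; apply/andP; split; lra.
exists (cos (pi / 4) / 4) => [|x xpi]; first by rewrite divr_gt0.
have half (y : R) : `|y| <= pi / 2 ->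
    normc (cexp ('i%C * y%:C) - 1) <= normc (cexp ('i%C * (2 * y)%:C) - 1).
  move=> ypi.
  have -> : cexp ('i%C * (2 * y)%:C) - 1 =
      (cexp ('i%C * y%:C) - 1) * (cexp ('i%C * y%:C) + 1).
    by rewrite rmorphM rmorph_nat mulrCA cexp_natl; ring.
  rewrite Normc.normcM ler_peMr ?normc_ge0//.
  apply: le_trans (Re_le_normc _); rewrite cexp_ix /=.
  apply: le_trans (ler_norm _); rewrite lerDr.
  by apply: cos_ge0_pihalf; rewrite -ler_norml.
have -> : x = 2 * (2 * (x / 4)) by field.
apply: le_trans (half _ _); last first.
  by move: xpi; rewrite !ler_norml => /andP[? ?]; apply/andP; split; lra.
apply: le_trans (half _ _); last first.
  by move: xpi; rewrite !ler_norml => /andP[? ?]; apply/andP; split; lra.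
apply: (@le_trans _ _ `|sin (x / 4)|); last first.
  apply: le_trans (Im_le_normc _); rewrite cexp_ix /=.
  by rewrite subr0.
have key (y : R) : 0 <= y <= pi / 4 -> cos (pi / 4) * y <= sin y.
  move=> /andP[y0 y4].
  have D (s : R) : s \in `]0, y[%R -> is_derive s 1 sin (cos s).
    by move=> _; exact: is_derive_sin.
  have hc : {within `[0, y], continuous (@sin R)}.
    by apply: continuous_subspaceT => s; exact: continuous_sin.
  have [s] := MVT_segment y0 D hc.
  rewrite in_itv /= sin0 !subr0 => /andP[s0 sy] ->.
  rewrite ler_wpM2r// leNgt; apply/negP.
  by rewrite ltr_cos ?in_itv /=; [lra|apply/andP; split; lra|apply/andP; split; lra].
have -> : cos (pi / 4) / 4 * `|2 * (2 * (x / 4))| = cos (pi / 4) * `|x / 4|.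
  by rewrite !normrM (ger0_norm (ler0n R 2)); field.
have x4 : `|x / 4| <= pi / 4.
  by move: xpi; rewrite !ler_norml => /andP[? ?]; apply/andP; split; lra.
have [x0|x0] := leP 0 (x / 4).
  rewrite ger0_norm// in x4 *.
  by apply: le_trans (ler_norm _); apply: key; rewrite x0.
rewrite ltr0_norm// in x4 *.
rewrite -[leRHS]normrN -sinN; apply: le_trans (ler_norm _); apply: key.
by rewrite x4 oppr_ge0 ltW.
Qed.

End Decay.

Section LatticeBox.
Variables (R : realType) (n : nat).
Implicit Types (m l : 'rV[int]_n) (q N : nat).

Definition boxpt q (k : {ffun 'I_n -> 'I_(q.*2.+1)}) : 'rV[int]_n :=
  \row_j ((k j)%:Z - q%:Z).

Definition box q : seq 'rV[int]_n := codom (@boxpt q).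

Lemma boxpt_inj q : injective (@boxpt q).
Proof.
move=> k k' /rowP E; apply/ffunP => j; have := E j; rewrite !mxE => /addIr [].
exact: val_inj.
Qed.

Lemma box_uniq q : uniq (box q).
Proof. by rewrite /box /codom /image_mem map_inj_uniq ?enum_uniq//; exact: boxpt_inj. Qed.

Lemma mem_box q m : (m \in box q) = [forall j, `|m 0%R j|%N <= q]%N.
Proof.
apply/codomP/forallP => [[k ->] j|H].
  by rewrite mxE; case: (k j) => b /=; rewrite -addnn; lia.
have kH j : (`|(m 0 j + q%:Z)%R|%N < q.*2.+1)%N by have := H j; rewrite -addnn; lia.
exists [ffun j => Ordinal (kH j)]; apply/rowP => j; rewrite mxE ffunE /=.
by have := H j; lia.
Qed.

Lemma sub_box N q m : (N <= q)%N -> m \in box N -> m \in box q.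
Proof.
move=> Nq; rewrite !mem_box => /forallP H; apply/forallP => j.
exact: leq_trans (H j) Nq.
Qed.

Lemma sum_box (T : nmodType) q (F : 'rV[int]_n -> T) :
  \sum_(m <- box q) F m = \sum_(k : {ffun 'I_n -> 'I_(q.*2.+1)}) F (boxpt k).
Proof. by rewrite /box /codom /image_mem big_map big_enum. Qed.

Lemma sum_box_sub (T : nmodType) N q (F : 'rV[int]_n -> T) : (N <= q)%N ->
  \sum_(m <- box q | m \in box N) F m = \sum_(m <- box N) F m.
Proof.
move=> Nq; rewrite -big_filter; apply: perm_big; apply: uniq_perm.
- by rewrite filter_uniq// box_uniq.
- exact: box_uniq.
- move=> m; rewrite mem_filter; case mN: (m \in box N) => //=.
  exact: sub_box mN.
Qed.

Lemma sub_box_seq (s : seq 'rV[int]_n) : exists q, {subset s <= box q}.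
Proof.
exists (\sum_(m <- s) \sum_j `|m 0%R j|%N)%N => m ms; rewrite mem_box.
apply/forallP => j; rewrite (big_rem m)//= (bigD1 j)//= -addnA.
exact: leq_addr.
Qed.

Lemma sum_line_le q :
  \sum_(l < q.*2.+1) (1 + ((l%:R : R) - q%:R) ^+ 2)^-1 <= 5 - 4 / q.+1%:R.
Proof.
elim: q => [|q IH].
  by rewrite big_ord1 subrr expr0n /= addr0 invr1; lra.
rewrite doubleS big_ord_recl big_ord_recr /=.
under eq_bigr => l _.
  rewrite (_ : (bump 0 l)%:R - q.+1%:R = (l%:R : R) - q%:R); last first.
    by rewrite /bump /= add1n -!natr1; ring.
  over.
set S := \sum_(l < _) _ in IH *.
have q0 : (0 : R) <= q%:R by [].
have -> : (0%:R : R) - q.+1%:R = - (q%:R + 1) by rewrite mulr0n sub0r natr1.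
have -> : ((bump 0 q.*2.+1)%:R : R) - q.+1%:R = q%:R + 1.
  by rewrite /bump /= add1n -addnn -!natr1 natrD; ring.
rewrite sqrrN -!natr1 in IH *.
set x : R := q%:R in q0 IH *.
have E : (1 + (x + 1) ^+ 2)^-1 + (1 + (x + 1) ^+ 2)^-1 <= 4 / (x + 1) - 4 / (x + 1 + 1).
  rewrite -subr_ge0.
  have x1 : 0 < x + 1 by lra.
  have x2 : 0 < x + 1 + 1 by lra.
  have x3 : 0 < 1 + (x + 1) ^+ 2 by nra.
  rewrite (_ : _ - _ = (2 * x ^+ 2 + 2 * x + 4) /
     ((x + 1) * (x + 1 + 1) * (1 + (x + 1) ^+ 2))); last first.
    by field; rewrite !gt_eqF.
  by apply: divr_ge0; [nra|rewrite !mulr_ge0// ltW].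
lra.
Qed.

Lemma prod_le_jap m : \prod_j (1 + ((m 0 j)%:~R : R) ^+ 2) <= jap R m ^+ n.
Proof.
rewrite -[X in _ <= _ ^+ X]card_ord -prodr_const.
apply: ler_prod => j _; rewrite addr_ge0 ?sqr_ge0//= lerD2l.
by rewrite /normZ2 (bigD1 j)//= lerDl sumr_ge0// => i _; exact: sqr_ge0.
Qed.

Lemma sum_jap_box q : \sum_(m <- box q) (jap R m ^+ n)^-1 <= 5 ^+ n.
Proof.
apply: (@le_trans _ _ (\sum_(m <- box q) \prod_j (1 + ((m 0 j)%:~R : R) ^+ 2)^-1)).
  apply: ler_sum => m _; rewrite prodfV lef_pV2 ?posrE ?exprn_gt0 ?jap_gt0//.
    exact: prod_le_jap.
  by apply: prodr_gt0 => j _; rewrite ltr_pwDl ?sqr_ge0.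
rewrite sum_box.
under eq_bigr => k _ do under eq_bigr => j _ do rewrite mxE intrB.
rewrite -(bigA_distr_bigA (fun (j : 'I_n) (l : 'I_q.*2.+1) =>
  (1 + ((l%:R : R) - q%:R) ^+ 2)^-1)) /=.
rewrite prodr_const card_ord; apply: lerXn2r; rewrite ?nnegrE//.
  by apply: sumr_ge0 => l _; rewrite invr_ge0 addr_ge0// sqr_ge0.
apply: le_trans (sum_line_le q) _; rewrite lerBlDr lerDl.
by rewrite divr_ge0.
Qed.

Lemma sum_jap_uniq (s : seq 'rV[int]_n) : uniq s ->
  \sum_(m <- s) (jap R m ^+ n)^-1 <= 5 ^+ n.
Proof.
move=> us; have [q sq] := sub_box_seq s.
apply: le_trans (sum_jap_box q).
have -> : \sum_(m <- s) (jap R m ^+ n)^-1 = \sum_(m <- box q | m \in s) (jap R m ^+ n)^-1.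
  rewrite -[RHS]big_filter; apply: perm_big; apply: uniq_perm => //.
    by rewrite filter_uniq// box_uniq.
  by move=> m; rewrite mem_filter; case ms: (m \in s) => //=; rewrite sq.
rewrite [leRHS](bigID (mem s)) /= lerDl sumr_ge0// => m _.
by rewrite invr_ge0 exprn_ge0// ltW ?jap_gt0.
Qed.

Lemma sum_jap_shift l (s : seq 'rV[int]_n) : uniq s ->
  \sum_(m <- s) (jap R (m - l) ^+ n)^-1 <= 5 ^+ n.
Proof.
move=> us; rewrite -(big_map (fun m => m - l) xpredT (fun m => (jap R m ^+ n)^-1)).
by apply: sum_jap_uniq; rewrite map_inj_uniq// => m m' /addIr.
Qed.

Lemma jap_notin_box N m : m \notin box N -> N.+1%:R <= jap R m.
Proof.
rewrite mem_box => /forallPn[j]; rewrite -ltnNge => mj.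
rewrite /jap /normZ2 (bigD1 j)//= addrA.
apply: (@le_trans _ _ (1 + ((m 0 j)%:~R : R) ^+ 2)); last first.
  by rewrite lerDl sumr_ge0// => i _; exact: sqr_ge0.
have : (N.+1%:R : R) <= `|(m 0 j)%:~R|.
  by rewrite -intr_norm -abszE -pmulrn ler_nat.
rewrite -[X in 1 + X]real_normK ?num_real//.
have : (1 : R) <= N.+1%:R by rewrite ler1n.
nra.
Qed.

End LatticeBox.

Section Trigonometric.
Variables (R : realType) (n : nat).
Local Notation V := 'rV[R]_n.
Local Notation e_ j := (delta_mx 0 j : V).
Local Notation partial := (@partial R n).
Implicit Types (m : 'rV[int]_n) (x : V) (j : 'I_n).

Definition trigf m (a b : R) : V -> R :=
  fun x => a * cos (dotZ m x) + b * sin (dotZ m x).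

Lemma differentiable_dotZ m x : differentiable (@dotZ R n m) x.
Proof.
rewrite (_ : dotZ m = \sum_(j < n) (fun x : V => (m 0 j)%:~R * x 0 j)); last first.
  by apply/funext => y; rewrite fct_sumE.
apply: differentiable_sum => j; apply: differentiableM => //.
exact: differentiable_coord.
Qed.

Lemma differentiable_trigf m a b x : differentiable (trigf m a b) x.
Proof.
apply: differentiableD; apply: differentiableM => //.
- apply: (@differentiable_comp _ _ _ _ (@dotZ R n m) (@cos R)).
    exact: differentiable_dotZ.
  by apply/derivable1_diffP; exact: derivable_cos.
- apply: (@differentiable_comp _ _ _ _ (@dotZ R n m) (@sin R)).
    exact: differentiable_dotZ.
  by apply/derivable1_diffP; exact: derivable_sin.
Qed.

Lemma dotZ_line m x j (s : R) :
  dotZ m (x + s *: e_ j) = dotZ m x + s * (m 0 j)%:~R.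
Proof.
rewrite /dotZ (bigD1 j)//= [in RHS](bigD1 j)//= [RHS]addrAC; congr (_ + _).
  by rewrite !mxE !eqxx mulr1 mulrDr [_ * s]mulrC.
by apply: eq_bigr => i ij; rewrite !mxE eqxx (negbTE ij) mulr0 addr0.
Qed.

Lemma partial_trigf m a b j :
  partial j (trigf m a b) = trigf m ((m 0 j)%:~R * b) (- ((m 0 j)%:~R * a)).
Proof.
apply/funext => x.
suff D : is_derive x (e_ j) (trigf m a b)
    (trigf m ((m 0 j)%:~R * b) (- ((m 0 j)%:~R * a)) x) by exact: derive_val.
rewrite -[X in is_derive X]addr0 -(scale0r (e_ j)); apply/is_derive_line.
set c : R := (m 0 j)%:~R; set d := dotZ m x.
have dl : is_derive (0 : R) (1 : R) (fun s : R => d + s * c) c.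
  rewrite (_ : (fun s : R => _) = cst d + (c \*: (@id R))); last first.
    by apply/funext => s; rewrite fctE /GRing.scale_fun /GRing.scale /= mulrC.
  have := is_deriveD (is_derive_cst d (0 : R) (1 : R))
    (is_deriveZ c (is_derive_id (0 : R) (1 : R))).
  by rewrite add0r [c *: 1]mulr1.
have dc : is_derive (0 : R) (1 : R) (fun s : R => cos (d + s * c)) (- sin (d + 0 * c) * c).
  exact: (@is_derive1_comp _ (@cos R) (fun s : R => d + s * c)).
have ds : is_derive (0 : R) (1 : R) (fun s : R => sin (d + s * c)) (cos (d + 0 * c) * c).
  exact: (@is_derive1_comp _ (@sin R) (fun s : R => d + s * c)).
rewrite (_ : (fun s : R => _) =
   (a \*: (fun s : R => cos (d + s * c))) + (b \*: (fun s : R => sin (d + s * c)))); last first.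
  by apply/funext => s; rewrite /trigf dotZ_line.
have := is_deriveD (is_deriveZ a dc) (is_deriveZ b ds).
rewrite (_ : _ *: _ + _ *: _ = trigf m (c * b) (- (c * a)) x)//.
by rewrite /GRing.scale /= /trigf mul0r addr0 -/d; ring.
Qed.

Lemma smooth_trigf m a b : smooth (trigf m a b).
Proof.
have H s : exists a' b', foldr partial (trigf m a b) s = trigf m a' b'.
  elim: s => [|j s [a' [b' IH]]]; first by exists a, b.
  by rewrite /= IH partial_trigf; do 2 eexists.
move=> s x; have [a' [b' ->]] := H s; exact: differentiable_trigf.
Qed.

Lemma echarN m x : echar (fun j => - zfreq R m j) x =
  toC (trigf m 1 0) x - 'i%C * toC (trigf m 0 1) x.
Proof.
have -> : echar (fun j => - zfreq R m j) x = cexp ('i%C * (- dotZ m x)%:C).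
  rewrite /echar rmorphN /dotZ rmorph_sum /= -sumrN; congr (cexp (_ * _)).
  by apply: eq_bigr => j _; rewrite /zfreq mulNr rmorphM.
rewrite cexp_ix cosN sinN /toC /trigf mul1r mul0r mul0r mul1r addr0 add0r.
by apply: complex_ext; rewrite /=; ring.
Qed.

Lemma echarP m x : echar (zfreq R m) x =
  toC (trigf m 1 0) x + 'i%C * toC (trigf m 0 1) x.
Proof.
have -> : echar (zfreq R m) x = cexp ('i%C * (dotZ m x)%:C).
  rewrite /echar /dotZ rmorph_sum /=; congr (cexp (_ * _)).
  by apply: eq_bigr => j _; rewrite /zfreq rmorphM.
rewrite cexp_ix /toC /trigf mul1r mul0r mul0r mul1r addr0 add0r.
by apply: complex_ext; rewrite /=; ring.
Qed.

Lemma imnorm_real (t : 'I_n -> R) : imnorm (fun j => (t j)%:C) = 0.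
Proof. by rewrite /imnorm big1 ?mulr0// => j _; rewrite normr0. Qed.

End Trigonometric.

Section Inversion.
Variables (R : realType) (n : nat).
Local Notation V := 'rV[R]_n.
Local Notation partial := (@partial R n).
Implicit Types (phi : V -> R) (m : 'rV[int]_n) (x : V) (j : 'I_n) (q N : nat).

Lemma near_mesh_lt (a : R) k : a < pi ->
  \forall q \near \oo, a + k%:R * mesh R q < pi.
Proof.
move=> api.
have : (fun q => k%:R * mesh R q) @ \oo --> (0 : R).
  by rewrite -(mulr0 k%:R); apply: cvgMr; exact: cvg_mesh.
move=> /cvgrPdist_lt/(_ (pi - a)); rewrite subr_gt0 => /(_ api).
apply: filterS => q; rewrite sub0r normrN => /(le_lt_trans (ler_norm _)).
by rewrite ltrBrDl.
Qed.

Lemma rsum_decay (K : nat) : exists2 C : R, 0 <= C &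
  forall phi M, test_function (@torus_cell R n) phi -> derivs_le K phi M ->
  \forall q \near \oo, forall m, m \in box n q ->
    jap R m ^+ K * normc (rsum q (fun x => echar (zfreq R m) x * toC phi x)) <= C * M.
Proof.
have [c c0 cP] := cexp_ix_lower R.
pose A : R := (2 * pi) ^+ n.
have A0 : 0 <= A by rewrite exprn_ge0// mulr_ge0 ?pi_ge0.
pose B := A / c ^+ (2 * K) + A.
have B0 : 0 <= B by rewrite addr_ge0// divr_ge0// exprn_ge0// ltW.
exists (n.+1%:R ^+ K * B); first by rewrite mulr_ge0// exprn_ge0.
move=> phi M tphi [phiM dphiM].
have [sphi _ _] := tphi.
have [a /andP[a0 api] phia] := test_function_cell tphi.
have M0 : 0 <= M by exact: le_trans (normr_ge0 _) (phiM 0).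
apply: filterS (near_mesh_lt (2 * K) api) => q aq m; rewrite mem_box => /forallP mq.
set h := mesh R q in aq *.
have h0 : 0 < h by exact: mesh_gt0.
have rle f L : (forall x, `|f x| <= L) ->
    normc (rsum q (fun x => echar (zfreq R m) x * toC f x)) <= A * L.
  move=> fL; apply: le_trans (rsum_echar_le _ _ (box_bounded_toC fL)) _.
  by rewrite imnorm_real expR0 mul1r.
rewrite -mulrA; apply: sum_sqr_le; first exact: normc_ge0.
  apply: le_trans (rle _ _ phiM) _; rewrite ler_wpM2r// lerDr.
  by rewrite divr_ge0// exprn_ge0// ltW.
move=> j; set X := normc _.
have X0 : 0 <= X by exact: normc_ge0.
have E := @rsum_iter_fdiff R n (zfreq R m) a j q (2 * K) phi aq phia.
have := rle _ _ (fun x => @iter_fdiff_le R n j h (2 * K) phi M x (ltW h0) sphi (dphiM j)).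
rewrite E Normc.normcM normcX -/X => H.
set y : R := - ((m 0 j)%:~R * h).
have ypi : `|y| <= pi.
  rewrite normrN normrM (gtr0_norm h0).
  have : `|(m 0 j)%:~R : R| <= q%:R by rewrite -intr_norm -abszE -pmulrn ler_nat mq.
  move=> /(ler_wpM2r (ltW h0))/le_trans; apply.
  by have := mesh_natl R q; rewrite -/h -natr1 -addnn natrD; nra.
have := cP y ypi.
have -> : 'i%C * y%:C = - ('i%C * (zfreq R m j * h%:C)).
  by rewrite /y rmorphN mulrN rmorphM.
set Y := normc _ in H * => cY.
have {cY} : (c * (`|(m 0 j)%:~R| * h)) ^+ (2 * K) <= Y ^+ (2 * K).
  apply: lerXn2r; rewrite ?nnegrE ?normc_ge0//.
    by rewrite mulr_ge0 ?(ltW c0)// mulr_ge0// ltW.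
  by apply: le_trans cY; rewrite normrN normrM (gtr0_norm h0).
move=> /(ler_wpM2r X0)/le_trans/(_ H).
rewrite [(c * _) ^+ _]exprMn [(_ * h) ^+ _]exprMn => {}H.
have ck : 0 < c ^+ (2 * K) by rewrite exprn_gt0.
have hk : 0 < h ^+ (2 * K) by rewrite exprn_gt0.
apply: (@le_trans _ _ (A / c ^+ (2 * K) * M)).
  rewrite mulrAC ler_pdivlMr// -(ler_pM2r hk).
  have L (c' h' T X' A' : R) : c' * (T * h') * X' <= A' * (h' * M) ->
      X' * T * c' * h' <= A' * M * h' by move=> ?; lra.
  by rewrite [_ * X]mulrC; exact: L H.
by rewrite ler_wpM2r// lerDl.
Qed.

Lemma sum_line_orth q (a b : 'I_q.*2.+1) :
  \sum_(l < q.*2.+1) cexp ('i%C * (((l%:R - q%:R) * (a%:R - b%:R) * mesh R q)%:C)) =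
  if a == b then (q.*2.+1)%:R else 0.
Proof.
have [->|ab] := eqVneq a b.
  under eq_bigr do rewrite subrr mulr0 mul0r rmorph0 mulr0 cexp0.
  by rewrite sumr_const card_ord.
set t : R := (a%:R - b%:R) * mesh R q.
rewrite (eq_bigr (fun l : 'I_q.*2.+1 => cexp (- ('i%C * (q%:R * t)%:C)) *
    cexp ('i%C * t%:C) ^+ l)); last first.
  move=> l _; rewrite -cexp_natl -cexpD; congr cexp.
  by rewrite -mulrA -/t !rmorphM rmorphB !rmorph_nat; ring.
rewrite -mulr_sumr geometric_sum_unity ?mulr0//.
  rewrite -cexp_natl -[RHS](cexp_2pi_int R (a%:Z - b%:Z)); congr cexp.
  rewrite mulrCA; congr (_ * _); rewrite complex_natr -rmorphM; congr (_%:C).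
  by rewrite /t mulrCA mesh_natl intrB -!pmulrn.
have key (u v : 'I_q.*2.+1) : (v < u)%N ->
    cexp ('i%C * ((u%:R - v%:R) * mesh R q)%:C) != 1.
  move=> vu; apply: cexp_ix_neq1; apply/andP; split.
    by rewrite mulr_gt0 ?mesh_gt0// subr_gt0 ltr_nat.
  rewrite -(mesh_natl R q) ltr_pM2r ?mesh_gt0// ltrBlDr.
  by rewrite -natrD ltr_nat ltn_addr.
have [ba|ba] := ltnP b a; first exact: key.
have {}ab : (a < b)%N by rewrite ltn_neqAle ba andbT.
apply: contraTneq (key b a ab) => E; rewrite negbK.
have := cexpN_mul ('i%C * t%:C); rewrite E mulr1 => <-; apply/eqP; congr cexp.
by rewrite -mulrN -rmorphN; congr (_ * _%:C); rewrite /t; ring.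
Qed.

Lemma dft_inversion q (k0 : {ffun 'I_n -> 'I_(q.*2.+1)}) (psi : V -> R[i]) :
  \sum_(m <- box n q) rsum q (fun x => echar (zfreq R m) x * psi x) *
    echar (fun j => - zfreq R m j) (gridpt R k0) =
  ((2 * pi) ^+ n)%:C * psi (gridpt R k0).
Proof.
rewrite sum_box /rsum.
under eq_bigr => k _ do rewrite -mulrA mulr_suml.
rewrite -mulr_sumr exchange_big /=.
have E (k1 : {ffun 'I_n -> 'I_(q.*2.+1)}) :
    \sum_(k : {ffun 'I_n -> 'I_(q.*2.+1)})
      echar (zfreq R (boxpt k)) (gridpt R k1) * psi (gridpt R k1) *
      echar (fun j => - zfreq R (boxpt k) j) (gridpt R k0) =
    (if k1 == k0 then (q.*2.+1)%:R ^+ n else 0) * psi (gridpt R k1).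
  under eq_bigr => k _ do rewrite mulrAC.
  rewrite -mulr_suml; congr (_ * _).
  transitivity (\sum_(k : {ffun 'I_n -> 'I_(q.*2.+1)}) \prod_j
     cexp ('i%C * ((((k j)%:R - q%:R) * ((k1 j)%:R - (k0 j)%:R) * mesh R q)%:C))).
    apply: eq_bigr => k _; rewrite -cexp_sum /echar -cexpD; congr cexp.
    rewrite -mulrDr -mulr_sumr; congr (_ * _); rewrite -big_split.
    apply: eq_bigr => j _; rewrite /zfreq !mxE intrB mulNr /= -mulrBr.
    rewrite -(rmorphB (real_complex R)) -(rmorphM (real_complex R)).
    by congr (_%:C); rewrite -!pmulrn; ring.
  rewrite -(bigA_distr_bigA (fun (j : 'I_n) (l : 'I_q.*2.+1) =>
    cexp ('i%C * (((l%:R - q%:R) * ((k1 j)%:R - (k0 j)%:R) * mesh R q)%:C)))) /=.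
  under eq_bigr => j _ do rewrite sum_line_orth.
  have [->|k10] := eqVneq k1 k0.
    by under eq_bigr do rewrite eqxx; rewrite prodr_const card_ord.
  have [j k1j] : exists j, k1 j != k0 j.
    by apply/existsP; apply: contraNT k10; rewrite negb_exists => /forallP H;
      apply/eqP/ffunP => j; have := H j; rewrite negbK => /eqP.
  by rewrite (bigD1 j)//= (negbTE k1j) mul0r.
under eq_bigr => k1 _ do rewrite E.
rewrite (bigD1 k0)//= eqxx big1 ?addr0 => [|k1 /negbTE ->]; last by rewrite mul0r.
rewrite mulrA; congr (_ * _).
by rewrite complex_natr -rmorphXn -rmorphM -exprMn mulrC mesh_natl.
Qed.

End Inversion.

Section FourierInversion.
Variables (R : realType) (n : nat).
Local Notation V := 'rV[R]_n.
Local Notation partial := (@partial R n).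
Implicit Types (phi g : V -> R) (m : 'rV[int]_n) (x : V) (j : 'I_n) (q N : nat).

Lemma derivs_le_ex K phi : test_function (@torus_cell R n) phi ->
  exists2 M : R, 0 <= M & derivs_le K phi M.
Proof.
move=> tphi; have [M0 M00 phiM0] := test_function_bounded tphi.
have /choice[M MP] : forall j, exists M : R,
    0 <= M /\ forall x, `|iter (2 * K) (partial j) phi x| <= M.
  move=> j; have [M ? ?] := test_function_bounded (test_function_iter j (2 * K) tphi).
  by exists M.
have S0 : 0 <= \sum_j M j by apply: sumr_ge0 => j _; have [] := MP j.
exists (M0 + \sum_j M j); first exact: addr_ge0.
split=> [x|j x]; first by apply: le_trans (phiM0 x) _; rewrite lerDl.
have [_ /(_ x) xM] := MP j; apply: le_trans xM _.
rewrite (bigD1 j)//= addrCA lerDl addr_ge0// sumr_ge0// => i _.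
by have [] := MP i.
Qed.

Lemma nearest_gridpt q x : torus_cell x ->
  exists k : {ffun 'I_n -> 'I_(q.*2.+1)}, forall j, `|x 0 j - gridpt R k 0 j| <= mesh R q.
Proof.
move=> xc; have h0 := mesh_gt0 R q.
have t0 j : 0 <= (x 0 j + pi) / mesh R q.
  by apply: divr_ge0; [have := xc j; lra|exact: ltW].
have kL j : (Num.truncn ((x 0 j + pi) / mesh R q)%R < q.*2.+1)%N.
  rewrite truncn_lt_nat// ltr_pdivrMr// mesh_natl.
  by have := xc j; lra.
exists [ffun j => Ordinal (kL j)] => j; rewrite mxE ffunE /=.
have /andP[] := truncn_itv (t0 j); set t := Num.truncn _.
rewrite ler_pdivlMr// ltr_pdivrMr// -natr1 mulrDl mul1r => H1 H2.
by rewrite ler_norml; apply/andP; split; lra.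
Qed.

Lemma cvg_gridpt x (y : nat -> V) :
  (forall q j, `|x 0 j - y q 0 j| <= mesh R q) -> y @ \oo --> x.
Proof.
move=> H; apply/cvgrPdist_le => e e0.
have /cvgrPdist_le/(_ e e0) := @cvg_mesh R.
apply: filterS => q; rewrite sub0r normrN (ger0_norm (mesh_ge0 R q)) => he.
rewrite [leLHS]mx_normrE; apply/bigmax_leP; split; first exact: ltW.
move=> [i j] _ /=; rewrite !mxE ord1.
exact: le_trans (H q j) he.
Qed.

Lemma cvg_toC g x (y : nat -> V) : {for x, continuous g} -> y @ \oo --> x ->
  (fun q => normc (toC g (y q) - toC g x)) @ \oo --> 0.
Proof.
move=> cg yx.
under eq_fun do rewrite /toC -rmorphB normcR.
apply/norm_cvg0P.
rewrite -(subrr (g x)); apply: cvgB; last exact: cvg_cst.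
exact: (cvg_comp _ _ yx cg).
Qed.

Definition fpartial N phi x : R[i] :=
  (((2 * pi) ^+ n)^-1)%:C * \sum_(m <- box n N)
    ftrans (zfreq R m) (toC phi) * echar (fun j => - zfreq R m j) x.

Lemma fourier_inversion phi : test_function (@torus_cell R n) phi ->
  exists2 C : R, 0 <= C & forall N x, torus_cell x ->
    normc (toC phi x - fpartial N phi x) <= C / N.+1%:R.
Proof.
move=> tphi.
have [sphi _ _] := tphi.
have [M0 M00 phiM0] := test_function_bounded tphi.
have [C C0 CP] := rsum_decay R n n.+1.
have [M MM0 dM] := derivs_le_ex n.+1 tphi.
have {}CP := CP phi M tphi dM.
have p0 : 0 < (2 * pi : R) ^+ n by rewrite exprn_gt0// mulr_gt0// pi_gt0.
set P : R := (2 * pi) ^+ n in p0.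
exists (2 * (P^-1 * (C * M * 5 ^+ n))).
  by rewrite mulr_ge0// mulr_ge0 ?invr_ge0 ?(ltW p0)// mulr_ge0 ?exprn_ge0// mulr_ge0.
move=> N x xc.
pose k q := projT1 (cid (nearest_gridpt q xc)).
have kP q := projT2 (cid (nearest_gridpt q xc)).
pose y q : V := gridpt R (k q).
have yx : y @ \oo --> x by exact: cvg_gridpt.
pose r m q := rsum q (fun x => echar (zfreq R m) x * toC phi x).
pose D q := toC phi (y q) +
  - (P^-1)%:C * \sum_(m <- box n N) r m q * echar (fun j => - zfreq R m j) (y q).
have br m : bounded_seq (r m) by exact: bounded_rsum (box_bounded_toC phiM0).
have echarE m q : echar (fun j => - zfreq R m j) (y q) =
    toC (trigf m 1 0) (y q) + - 'i%C * toC (trigf m 0 1) (y q).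
  by rewrite echarN mulNr.
have be m : bounded_seq (fun q => echar (fun j => - zfreq R m j) (y q)).
  exists (expR 0) => q.
  apply: le_trans (@echar_le _ _ _ (y q) (fun j => @gridpt_bound _ _ _ (k q) j)) _.
  rewrite (_ : (fun j => _) = (fun j => (- (m 0 j)%:~R)%:C)) ?imnorm_real//.
  by apply/funext => j; rewrite rmorphN.
have bt m a b : bounded_seq (fun q => toC (trigf m a b) (y q)).
  exists (`|a| + `|b|) => q; rewrite normcR /trigf.
  apply: le_trans (ler_normD _ _) _; rewrite !normrM.
  by apply: lerD; rewrite ler_piMr// ?cos_max ?sin_max.
have ce m : clim (fun q => echar (fun j => - zfreq R m j) (y q)) =
    echar (fun j => - zfreq R m j) x.
  under eq_fun do rewrite echarE.
  rewrite climD ?climZ ?echarN ?mulNr//; last first.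
    by apply: bounded_seqM => //; exact: bounded_seq_cst.
  by congr (_ - _ * _); apply/cvg_clim/cvg_toC => //; apply: smooth_continuous; exact: smooth_trigf.
have bphi : bounded_seq (fun q => toC phi (y q)).
  by exists M0 => q; rewrite normcR.
have bS : bounded_seq (fun q => \sum_(m <- box n N) r m q * echar (fun j => - zfreq R m j) (y q)).
  by apply: bounded_seq_sum => m; exact: bounded_seqM.
have cD : clim D = toC phi x - fpartial N phi x.
  rewrite /D climD//; last by apply: bounded_seqM => //; exact: bounded_seq_cst.
  congr (_ + _); first by apply/cvg_clim/cvg_toC => //; exact: smooth_continuous.
  rewrite climZ// mulNr /fpartial; congr (- (_ * _)).
  rewrite clim_sum => [|m]; last exact: bounded_seqM.
  by apply: eq_bigr => m _; rewrite climM// ce.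
rewrite -cD -[leRHS]mulrA; apply: normc_clim_le.
  by apply: bounded_seqD => //; apply: bounded_seqM => //; exact: bounded_seq_cst.
have [Q _ QP] := CP.
exists (maxn Q N) => // q /=; rewrite geq_max => /andP[Qq Nq].
have {QP}rle := QP q Qq.
have -> : D q = (P^-1)%:C * \sum_(m <- box n q | m \notin box n N)
    r m q * echar (fun j => - zfreq R m j) (y q).
  have := @dft_inversion R n q (k q) (toC phi).
  rewrite (bigID (mem (box n N))) /= sum_box_sub// -/P -/(y q).
  move=> E; rewrite /D.
  have -> : toC phi (y q) = (P^-1)%:C * (P%:C * toC phi (y q)).
    by rewrite mulrA -rmorphM mulVf ?gt_eqF// rmorph1 mul1r.
  by rewrite -E mulrDr mulNr addrAC subrr add0r.
rewrite Normc.normcM normcR gtr0_norm ?invr_gt0// -[leRHS]mulrA ler_wpM2l ?invr_ge0 ?(ltW p0)//.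
apply: le_trans (normc_sum _ _ _) _.
apply: (@le_trans _ _ (\sum_(m <- box n q | m \notin box n N)
    (C * M / N.+1%:R) * (jap R m ^+ n)^-1)).
  rewrite big_seq_cond [leRHS]big_seq_cond; apply: ler_sum => m /andP[mq mN].
  rewrite Normc.normcM.
  have -> : normc (echar (fun j => - zfreq R m j) (y q)) = 1.
    rewrite normc_cexp (_ : Re _ = 0) ?expR0//.
    rewrite (_ : \sum_j _ = (- dotZ m (y q))%:C); last first.
      rewrite rmorphN /dotZ rmorph_sum /= -sumrN.
      by apply: eq_bigr => j _; rewrite /zfreq mulNr rmorphM.
    by rewrite ReM /=; ring.
  rewrite mulr1; have := rle m mq; have jm := jap_gt0 R m.
  have jn := jap_notin_box R mN.
  rewrite exprS -mulrA.
  have NN : (0 : R) < N.+1%:R by [].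
  have jmn : 0 < jap R m ^+ n by rewrite exprn_gt0.
  move=> H.
  rewrite ler_pdivlMr// ler_pdivlMr//.
  apply: le_trans H; rewrite mulrC; apply: ler_pM => //.
  - by rewrite mulr_ge0 ?normc_ge0// ltW.
  - by rewrite mulrC.
rewrite -mulr_sumr -[leRHS]mulrA.
apply: (@le_trans _ _ ((C * M / N.+1%:R) * 5 ^+ n)).
  rewrite ler_wpM2l ?divr_ge0 ?mulr_ge0//.
  apply: le_trans (sum_jap_box R n q).
  rewrite [leRHS](bigID (mem (box n N)))/= lerDr sumr_ge0// => m _.
  by rewrite invr_ge0 exprn_ge0// ltW ?jap_gt0.
by rewrite le_eqVlt; apply/orP; left; apply/eqP; ring.
Qed.

End FourierInversion.

Section SymbolBound.
Import (canonicals) mpoly.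
Variables (R : realType) (n : nat).
Local Notation C := R[i].
Implicit Types (P : mpolynomial n C) (a b : multinom n).
Local Notation mco a j := (mpoly.fun_of_multinom a j).

Lemma digits_inj (N D : nat) (f g : 'I_N -> nat) :
  (forall j, f j < D)%N -> (forall j, g j < D)%N ->
  (\sum_j f j * D ^ j = \sum_j g j * D ^ j)%N -> f =1 g.
Proof.
elim: N f g => [|N IH] f g fD gD; first by move=> _ [].
rewrite !big_ord_recl /= !expn0 !muln1.
have E (h : 'I_N.+1 -> nat) : (\sum_(i < N) h (lift ord0 i) * D ^ bump 0 i =
    D * \sum_(i < N) h (lift ord0 i) * D ^ i)%N.
  by rewrite big_distrr /=; apply: eq_bigr => i _; rewrite /bump add1n expnS mulnCA.
rewrite !E => H.
have D0 : (0 < D)%N by exact: leq_ltn_trans (fD ord0).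
have H0 : f ord0 = g ord0.
  have := congr1 (modn^~ D) H.
  by rewrite ![(D * _)%N]mulnC ![(_ + _ * D)%N]addnC !modnMDl !modn_small.
move: H; rewrite H0 => /addnI/eqP; rewrite eqn_pmul2l// => /eqP H j.
case: (unliftP ord0 j) => [i ->|->//].
exact: (IH (fun i => f (lift ord0 i)) (fun i => g (lift ord0 i))).
Qed.

Definition mtop P : nat := \max_(a <- mpoly.msupp P) mdeg a.

Definition top_form P (w : 'I_n -> C) : C :=
  \sum_(a <- mpoly.msupp P | mdeg a == mtop P)
    mpoly.mcoeff a P * \prod_j w j ^+ mco a j.

(* Kronecker's substitution [w_j = k ^ (D ^ j)] separates the monomials of
   degree less than [D] in each variable. *)
Lemma top_form_neq0 P : mpoly.msupp P != [::] -> exists w : 'I_n -> R,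
  top_form P (fun j => (w j)%:C) != 0.
Proof.
move=> P0; set D := (mtop P).+1.
have aD a j : a \in mpoly.msupp P -> (mco a j < D)%N.
  move=> aP; rewrite ltnS; apply: (@leq_trans (mdeg a)).
    by rewrite mpoly.mdegE (bigD1 j)//= leq_addr.
  by rewrite /mtop (big_rem a)//= leq_maxl.
pose e a := (\sum_j mco a j * D ^ j)%N.
have e_inj a b : a \in mpoly.msupp P -> b \in mpoly.msupp P -> e a = e b -> a = b.
  move=> aP bP E; apply/mpoly.mnmP; apply: (digits_inj _ _ E) => j; exact: aD.
pose T : {poly C} := \sum_(a <- mpoly.msupp P | mdeg a == mtop P)
   mpoly.mcoeff a P *: 'X^(e a).
have [a0 a0P a0d] : exists2 a0, a0 \in mpoly.msupp P & mdeg a0 == mtop P.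
  move: P0; case S : (mpoly.msupp P) => [//|a s] _.
  rewrite /mtop S.
  elim: s a {S} => [|b s IH] a; first by exists a; rewrite ?inE// big_seq1.
  rewrite big_cons; have [c cs /eqP cE] := IH b.
  rewrite -cE; case: (leqP (mdeg a) (mdeg c)) => H.
    by exists c; rewrite // inE cs orbT.
  by exists a; rewrite // inE eqxx.
have T0 : T != 0.
  apply/eqP => /(congr1 (fun p : {poly C} => p`_(e a0))).
  rewrite /T coef_sum coef0 big_mkcond /= (bigD1_seq a0) ?mpoly.msupp_uniq//= a0d.
  rewrite coefZ coefXn eqxx mulr1 big_seq_cond big1 => [|b /andP[bP ba]].
    by rewrite addr0 => /eqP; apply/negP; rewrite -mpoly.mcoeff_msupp.
  case: ifP => // _; rewrite coefZ coefXn; case: eqP => [E|]; last by rewrite mulr0.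
  by case/eqP: ba; apply: e_inj.
have [k Tk] : exists k : nat, T.[k%:R] != 0.
  apply: contrapT => /forallNP H.
  have := @max_poly_roots _ T [seq k%:R | k <- iota 0 (size T)] T0.
  rewrite size_map size_iota ltnn => H'; apply: notF; apply: H'.
    by apply/allP => _ /mapP[k _ ->]; rewrite /root; have /negP := H k; rewrite negbK.
  rewrite map_inj_uniq ?iota_uniq// => k l /eqP.
  by rewrite eqr_nat => /eqP.
exists (fun j => k%:R ^+ (D ^ j)); apply: contraNneq Tk => E; apply/eqP.
rewrite -[RHS]E /T horner_sum /top_form; apply: eq_bigr => a _.
rewrite hornerZ hornerXn; congr (_ * _); rewrite /e -prodrXr; apply: eq_bigr => j _.
by rewrite rmorphXn rmorph_nat -exprM mulnC.
Qed.

Definition line_poly P (zeta w : 'I_n -> C) : {poly C} :=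
  \sum_(a <- mpoly.msupp P) mpoly.mcoeff a P *:
    \prod_j ((zeta j)%:P + w j *: 'X) ^+ mco a j.

Lemma horner_line_poly P zeta w z :
  (line_poly P zeta w).[z] = mpoly.meval (fun j => zeta j + z * w j) P.
Proof.
rewrite mpoly.mevalE /line_poly horner_sum; apply: eq_bigr => a _.
rewrite hornerZ horner_prod; congr (_ * _); apply: eq_bigr => j _.
by rewrite horner_exp !hornerE mulrC.
Qed.

Lemma size_lin_expr (u v : C) k : (size ((u%:P + v *: 'X) ^+ k)%R <= k.+1)%N /\
  ((u%:P + v *: 'X) ^+ k)`_k = v ^+ k.
Proof.
elim: k => [|k [IH1 IH2]]; first by rewrite !expr0 size_poly1 coef1.
have E : (u%:P + v *: 'X) ^+ k.+1 =
    u *: (u%:P + v *: 'X) ^+ k + v *: ((u%:P + v *: 'X) ^+ k * 'X).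
  by rewrite exprS mulrDl mul_polyC -scalerAl mulrC.
rewrite E; split.
  apply: leq_trans (size_polyD _ _) _; rewrite geq_max; apply/andP; split.
    exact: leq_trans (size_scale_leq _ _) (leq_trans IH1 _).
  apply: leq_trans (size_scale_leq _ _) _.
  by apply: leq_trans (size_polyMleq _ _) _; rewrite size_polyX addn2.
rewrite coefD !coefZ coefMX /= IH2 -exprS nth_default ?mulr0 ?add0r//.
Qed.

Lemma size_prod_lin (zeta w : 'I_n -> C) (f : 'I_n -> nat) (s : seq 'I_n) :
  let p := \prod_(j <- s) ((zeta j)%:P + w j *: 'X) ^+ f j in
  (size p <= (\sum_(j <- s) f j).+1)%N /\
  p`_(\sum_(j <- s) f j) = \prod_(j <- s) w j ^+ f j.
Proof.
have key (p q : {poly C}) (k l : nat) : (size p <= k.+1)%N -> (size q <= l.+1)%N ->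
    (size (p * q)%R <= (k + l).+1)%N /\ (p * q)`_(k + l) = p`_k * q`_l.
  move=> pk ql; split.
    by apply: leq_trans (size_polyMleq _ _) _; rewrite -ltnS; apply: leq_trans (leqSpred _) _; lia.
  rewrite coefM (bigD1 (inord k)) //= inordK ?ltnS ?leq_addr// addKn big1 ?addr0// => i ik.
  have [ki|ki] := ltnP k i.
    by rewrite (nth_default 0 (leq_trans pk ki)) mul0r.
  have {}ki : (i < k)%N.
    rewrite ltn_neqAle ki andbT; apply: contraNneq ik => ik; apply/eqP/val_inj.
    by rewrite /= inordK// ltnS leq_addr.
  rewrite [q`_ _]nth_default ?mulr0//; apply: leq_trans ql _.
  by rewrite ltn_subRL ltn_add2r.
elim: s => [|j s [IH1 IH2]] /=; first by rewrite !big_nil size_poly1 coef1.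
rewrite !big_cons; have [h1 h2] := size_lin_expr (zeta j) (w j) (f j).
by have [k1 k2] := key _ _ _ _ h1 IH1; split; rewrite // k2 h2 IH2.
Qed.

Lemma coef_line_poly P zeta w :
  (size (line_poly P zeta w) <= (mtop P).+1)%N /\
  (line_poly P zeta w)`_(mtop P) = top_form P w.
Proof.
have aT a : a \in mpoly.msupp P -> (mdeg a <= mtop P)%N.
  by move=> aP; rewrite /mtop (big_rem a)//= leq_maxl.
have H a := size_prod_lin zeta w (fun j => mco a j) (index_enum _).
split.
  apply: leq_trans (size_sum _ _ _) _; apply/bigmax_leqP_seq => a aP _.
  apply: leq_trans (size_scale_leq _ _) _; have [+ _] := H a => /leq_trans; apply.
  by rewrite ltnS -mpoly.mdegE aT.
rewrite coef_sum /top_form [RHS]big_mkcond /= big_seq [RHS]big_seq.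
apply: eq_bigr => a aP; rewrite coefZ; have := H a; rewrite -mpoly.mdegE => -[h1 h2].
case: eqP => [<-|/eqP ad]; first by rewrite h2.
by rewrite nth_default ?mulr0//; apply: leq_trans h1 _; rewrite ltn_neqAle ad aT.
Qed.

Lemma avoiding_radius (s : seq R) : exists2 r : nat, (0 < r <= (size s).+1)%N &
  forall x, x \in s -> 2^-1 <= `|r%:R - x|.
Proof.
apply: contrapT => H.
have {}H (r : 'I_(size s).+1) : exists x, x \in s /\ `|r.+1%:R - x| < 2^-1.
  apply: contrapT => H'; apply: H; exists r.+1; first by rewrite /= ltnS -ltnS ltn_ord.
  by move=> x xs; rewrite leNgt; apply/negP => xr; apply: H'; exists x.
have /choice[f fP] := H.
have finj : injective f.
  move=> r r' E; have [_] := fP r; have [_] := fP r'; rewrite E => h h'.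
  have : `|r.+1%:R - r'.+1%:R : R| < 1.
    rewrite (_ : _ - _ = (r.+1%:R - f r') - (r'.+1%:R - f r')); last by ring.
    apply: le_lt_trans (ler_normB _ _) _.
    by rewrite [ltRHS](_ : 1 = 2^-1 + 2^-1) ?ltrD//; field.
  have -> : r.+1%:R - r'.+1%:R = r%:R - r'%:R :> R by rewrite -!natr1; ring.
  move=> h1.
  apply/val_inj/eqP; rewrite eqn_leq; apply/andP; split; rewrite leqNgt; apply/negP => h2.
    move: h1; rewrite ger0_norm ?subr_ge0 ?ler_nat ?(ltnW h2)//.
    by rewrite ltrBlDr addrC natr1 ltr_nat ltnS leqNgt h2.
  move: h1; rewrite distrC ger0_norm ?subr_ge0 ?ler_nat ?(ltnW h2)//.
  by rewrite ltrBlDr addrC natr1 ltr_nat ltnS leqNgt h2.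
have : uniq (codom f) by rewrite map_inj_uniq ?enum_uniq.
move=> /uniq_leq_size/(_ (_ : {subset codom f <= s})).
rewrite size_codom card_ord ltnn => /(_ _)/negP; apply => //.
by move=> _ /codomP[r ->]; have [] := fP r.
Qed.

Lemma symbol_lower_bound P : mpoly.msupp P <> [::] ->
  exists (w : 'I_n -> R) (c r0 : R), [/\ 0 < c, 0 <= r0 &
    forall m : 'rV[int]_n, exists2 r : R, 0 <= r <= r0 &
      forall z, normc z = r -> c <= normc (mpoly.meval (shift_freq m w z) P)].
Proof.
move=> /eqP P0; have [w wP] := top_form_neq0 P0.
set d := mtop P; set wC := fun j => (w j)%:C in wP.
set t := normc (top_form P wC).
have t0 : 0 < t.
  by rewrite lt_neqAle normc_ge0 andbT eq_sym; apply: contraNneq wP => /Normc.eq0_normc ->.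
exists w, (t * 2^-1 ^+ d), d.+1%:R; split => //.
  by rewrite mulr_gt0// exprn_gt0.
move=> m; pose Q := line_poly P (zfreq R m) wC.
have [Qs Qd] := coef_line_poly P (zfreq R m) wC.
have sQ : size Q = d.+1.
  apply/eqP; rewrite eqn_leq Qs /=; rewrite ltnNge; apply/negP => h.
  by move: wP; rewrite -Qd nth_default ?eqxx.
have lQ : lead_coef Q = top_form P wC by rewrite lead_coefE sQ.
have [s sE] := closed_field_poly_normal Q.
have ss : size s = d.
  have := congr1 (fun p : {poly C} => size p) sE.
  by rewrite size_scale ?lQ// size_prod_XsubC sQ => -[].
have [r /andP[r0 rs] rP] := avoiding_radius [seq normc z | z <- s].
exists r%:R; first by rewrite ler0n ler_nat -ss -(size_map (@Normc.normc R)).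
move=> z zr; rewrite (_ : mpoly.meval _ P = Q.[z]); last by rewrite horner_line_poly.
rewrite sE hornerZ lQ Normc.normcM ler_wpM2l ?normc_ge0//.
rewrite horner_prod normc_prod -ss.
elim: s rP {sE ss rs} => [|x s IH] rP; first by rewrite big_nil.
rewrite big_cons /= exprS; apply: ler_pM => //.
- rewrite hornerXsubC; have := rP (normc x); rewrite inE eqxx => /(_ isT)/le_trans; apply.
  rewrite -zr; exact: (@ler_dist_dist _ (Rcomplex R)).
- by apply: IH => y ys; apply: rP; rewrite inE ys orbT.
Qed.

End SymbolBound.

Section WeightNonzero.
Variables (R : realType).

Lemma lebesgue_Rn_setT_gt0 (n : nat) : (0 < lebesgue_Rn R n setT)%E.
Proof.
elim: n => [|n IH]; first by rewrite /= diracT lte01.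
rewrite /= /leb_step /pushforward preimage_setT -setXTT product_measure1E//.
rewrite mule_gt0//.
have : (@lebesgue_measure R `[0%R, 1%R]%classic <= @lebesgue_measure R setT)%E.
  by apply: le_measure; rewrite ?inE//.
apply: lt_le_trans.
by rewrite lebesgue_measure_itv /= lte_fin ltr01 sube0 lte01.
Qed.

Lemma muckenhoupt_ge1 n (p : R) w : @muckenhoupt R n p w -> 1 <= p.
Proof. by move=> [_ [[->//]|[/ltW]]]. Qed.

Lemma muckenhoupt_symbol_neq0 n (p : R) (P : mpolynomial n R[i]) :
  muckenhoupt p (fun xi => normc (symbol P xi)) -> mpoly.msupp P <> [::].
Proof.
move=> [[_ aew _] _] P0.
have P00 xi : symbol P xi = 0 by rewrite /symbol mpoly.mevalE P0 big_nil.
move: aew => [A [mA A0 sA]].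
have := lebesgue_Rn_setT_gt0 n.
rewrite (_ : setT = A) ?A0 ?ltxx//; apply/seteqP; split => // x _.
by apply: sA => /= H; move: (H); rewrite P00 Normc.normc0 ltxx.
Qed.

End WeightNonzero.

Section FourierCoefficients.
Variables (R : realType) (n : nat).
Local Notation V := 'rV[R]_n.
Local Notation partial := (@partial R n).
Implicit Types (f : functional R n) (phi : V -> R) (m : 'rV[int]_n).

Lemma freq_le_jap m j : `|(m 0 j)%:~R : R| <= jap R m.
Proof.
have : ((m 0 j)%:~R : R) ^+ 2 <= normZ2 R m.
  by rewrite /normZ2 (bigD1 j)//= lerDl sumr_ge0// => i _; exact: sqr_ge0.
rewrite /jap -[X in X <= _]real_normK ?num_real//.
have := normr_ge0 ((m 0 j)%:~R : R); nra.
Qed.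

Lemma mpartial_trigf (b : multinom n) m (al be : R) :
  exists al' be' : R, mpartial b (trigf m al be) = trigf m al' be' /\
    `|al'| + `|be'| <= jap R m ^+ mdeg b * (`|al| + `|be|).
Proof.
have it k j al0 be0 : exists al' be' : R,
    iter k (partial j) (trigf m al0 be0) = trigf m al' be' /\
    `|al'| + `|be'| <= jap R m ^+ k * (`|al0| + `|be0|).
  elim: k => [|k [a1 [b1 [E H]]]]; first by exists al0, be0; rewrite expr0 mul1r.
  rewrite iterS E partial_trigf; do 2 eexists; split; first by [].
  rewrite normrN !normrM -mulrDr addrC exprS -mulrA.
  by apply: ler_pM => //; exact: freq_le_jap.
rewrite /mpartial mpoly.mdegE -big_enum /=.
elim: (enum 'I_n) => [|j s [a1 [b1 [E H]]]].
  by exists al, be; rewrite big_nil expr0 mul1r.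
rewrite big_cons /= E; have [a2 [b2 [-> H2]]] := it (mpoly.fun_of_multinom b j) j a1 b1.
exists a2, b2; split => //; apply: le_trans H2 _; rewrite exprD -mulrA.
by rewrite ler_wpM2l ?exprn_ge0// ltW ?jap_gt0.
Qed.

Lemma derivs_bounded_trigf N (K : set V) m (al be : R) :
  derivatives_bounded N K (trigf m al be) (jap R m ^+ N * (`|al| + `|be|)).
Proof.
move=> b x bN _; have [al' [be' [-> H]]] := mpartial_trigf b m al be.
rewrite /trigf; apply: le_trans (ler_normD _ _) _.
apply: (@le_trans _ _ (`|al'| + `|be'|)).
  by rewrite !normrM lerD// ler_piMr// ?cos_max ?sin_max.
apply: le_trans H _; rewrite ler_wpM2r ?addr_ge0//.
by apply: ler_weXn2l => //; exact: jap_ge1.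
Qed.

Definition growth (N : nat) (A : R) (a : 'rV[int]_n -> R[i]) :=
  forall m, normc (a m) <= A * jap R m ^+ N.

Lemma cosE m : (fun x : V => cos (dotZ m x)) = trigf m 1 0.
Proof. by apply/funext => x; rewrite /trigf mul1r mul0r addr0. Qed.

Lemma sinE m : (fun x : V => sin (dotZ m x)) = trigf m 0 1.
Proof. by apply/funext => x; rewrite /trigf mul1r mul0r add0r. Qed.

Lemma fourier_coef_growth f : compact_distribution_on (@torus_cell R n) f ->
  exists (N : nat) (A : R), 0 <= A /\ growth N A (fourier_coef f).
Proof.
move=> [_ [K [C [N [_ _ fC]]]]].
have p0 : 0 < (2 * pi : R) ^+ n by rewrite exprn_gt0// mulr_gt0// pi_gt0.
exists N, (((2 * pi) ^+ n)^-1 * (2 * `|C|)); split.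
  by rewrite mulr_ge0 ?invr_ge0 ?(ltW p0)// mulr_ge0.
move=> m; rewrite /fourier_coef Normc.normcM normcR gtr0_norm ?invr_gt0//.
rewrite -[leRHS]mulrA ler_wpM2l ?invr_ge0 ?(ltW p0)//.
apply: le_trans (le_normcD _ _) _; rewrite normcN Normc.normcM normc_i mul1r.
have j0 : 0 <= jap R m ^+ N by rewrite exprn_ge0// ltW ?jap_gt0.
have key al be : `|al| + `|be| = 1 -> normc (f (trigf m al be)) <= `|C| * jap R m ^+ N.
  move=> ab; apply: le_trans (fC _ (jap R m ^+ N) _ _ _) _ => //.
  - exact: smooth_trigf.
  - by have := @derivs_bounded_trigf N K m al be; rewrite ab mulr1.
  - by rewrite ler_wpM2r// ler_norm.
rewrite cosE sinE -mulrA mulr_natl mulr2n.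
by apply: lerD; apply: key; rewrite normr0 normr1 ?addr0 ?add0r.
Qed.

End FourierCoefficients.

Section SolutionOperator.
Variables (R : realType) (n : nat) (P : mpolynomial n R[i]).
Variables (w : 'I_n -> R) (c r0 : R) (rad : 'rV[int]_n -> R).
Hypothesis c0 : 0 < c.
Hypothesis rad_bound : forall m, 0 <= rad m <= r0.
Hypothesis P_lower : forall m z, normc z = rad m ->
  c <= normc (mpoly.meval (shift_freq m w z) P).
Local Notation V := 'rV[R]_n.
Local Notation C := R[i].
Implicit Types (psi : V -> C) (phi : V -> R) (m : 'rV[int]_n) (z : C).
Implicit Types (a : 'rV[int]_n -> C).

Let r00 : 0 <= r0.
Proof. by have /andP[h1 h2] := rad_bound 0; exact: le_trans h1 h2. Qed.

Definition circle_pt m (M j : nat) : C := (rad m)%:C * unity_root R M j.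

Lemma normc_circle_pt m M j : normc (circle_pt m M j) = rad m.
Proof.
rewrite Normc.normcM normc_unity_root mulr1 normcR ger0_norm//.
by have /andP[] := rad_bound m.
Qed.

Definition circle_mean m (F : C -> C) (M : nat) : C :=
  M.+1%:R^-1 * \sum_(j < M.+1) F (circle_pt m M.+1 j).

Lemma circle_mean_le m F M b : (forall z, normc z = rad m -> normc (F z) <= b) ->
  normc (circle_mean m F M) <= b.
Proof.
move=> Fb; rewrite Normc.normcM Normc.normcV complex_natr normcR ger0_norm//.
rewrite ler_pdivrMl//; apply: le_trans (normc_sum _ _ _) _.
apply: (@le_trans _ _ (\sum_(j < M.+1) b)).
  by apply: ler_sum => j _; rewrite Fb// normc_circle_pt.
by rewrite sumr_const card_ord [leRHS]mulr_natl.
Qed.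

(* The mean over a circle of the solutions [e^(i zeta x) / P(zeta)] of
   [P(D) u = e^(i zeta x)], paired with [psi]; by the mean value property of
   entire functions it solves [P(D) u = e^(i m x)]. *)
Definition mode m psi : C :=
  clim (circle_mean m (fun z => ftrans (shift_freq m w z) psi /
    mpoly.meval (shift_freq m w z) P)).

Definition solution a psi : C :=
  clim (fun N => \sum_(k <- box n N) a k * mode k psi).

Lemma mode_bound m psi b :
  (forall z, normc z <= r0 -> normc (ftrans (shift_freq m w z) psi) <= b) ->
  bounded_seq (circle_mean m (fun z => ftrans (shift_freq m w z) psi /
    mpoly.meval (shift_freq m w z) P)) /\
  normc (mode m psi) <= 2 * (b / c).
Proof.
move=> psib.
have H M : normc (circle_mean m (fun z => ftrans (shift_freq m w z) psi /
    mpoly.meval (shift_freq m w z) P) M) <= b / c.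
  apply: circle_mean_le => z zr; rewrite Normc.normcM Normc.normcV.
  have Pc := P_lower zr; have P0 := lt_le_trans c0 Pc.
  apply: ler_pM; rewrite ?normc_ge0 ?invr_ge0 ?normc_ge0//.
    by apply: psib; rewrite zr; have /andP[] := rad_bound m.
  by rewrite lef_pV2.
split; first by exists (b / c).
by apply: normc_clim_le; [exists (b / c)|apply: nearW].
Qed.

Definition rapid psi := (exists M, box_bounded M psi) /\
  forall K : nat, exists2 B : R, 0 <= B & forall m z, normc z <= r0 ->
    jap R m ^+ K * normc (ftrans (shift_freq m w z) psi) <= B.

Lemma rapid_mode m psi : rapid psi -> bounded_seq (circle_mean m
  (fun z => ftrans (shift_freq m w z) psi / mpoly.meval (shift_freq m w z) P)).
Proof.
move=> [_ /(_ 0%N)[B B0 psiB]]; have [] // := @mode_bound m psi B.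
by move=> z /(psiB m); rewrite mul1r.
Qed.

Lemma mode_le m psi (K : nat) B :
  (forall z, normc z <= r0 ->
    jap R m ^+ K * normc (ftrans (shift_freq m w z) psi) <= B) ->
  normc (mode m psi) <= 2 * (B / c) * (jap R m ^+ K)^-1.
Proof.
move=> H; have jK : 0 < jap R m ^+ K by rewrite exprn_gt0 ?jap_gt0.
have [|_ /le_trans] := @mode_bound m psi (B / jap R m ^+ K).
  by move=> z /H; rewrite ler_pdivlMr// mulrC.
by apply; rewrite le_eqVlt; apply/orP; left; apply/eqP; ring.
Qed.

Lemma rapidZD s psi psi' : rapid psi -> rapid psi' ->
  rapid (fun x => s * psi x + psi' x).
Proof.
move=> [[M psiM] psiK] [[M' psiM'] psiK'].
have sM : box_bounded (normc s * M) (fun x => s * psi x).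
  by move=> x /psiM xM; rewrite Normc.normcM ler_wpM2l ?normc_ge0.
split.
  exists (normc s * M + M') => x xpi; apply: le_trans (le_normcD _ _) _.
  by apply: lerD; [exact: sM|exact: psiM'].
move=> K; have [B B0 HB] := psiK K; have [B' B0' HB'] := psiK' K.
exists (normc s * B + B'); first by rewrite addr_ge0 ?mulr_ge0 ?normc_ge0.
move=> m z zr; rewrite (ftransD _ sM psiM') (ftransZ _ _ psiM).
apply: (@le_trans _ _ (jap R m ^+ K * (normc s * normc (ftrans (shift_freq m w z) psi) +
   normc (ftrans (shift_freq m w z) psi')))).
  rewrite ler_wpM2l ?exprn_ge0 ?(ltW (jap_gt0 _ _))//.
  by apply: le_trans (le_normcD _ _) _; rewrite Normc.normcM.
rewrite mulrDr mulrCA; apply: lerD (HB' m z zr).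
by rewrite ler_wpM2l ?normc_ge0// HB.
Qed.

Lemma modeZD m s psi psi' : rapid psi -> rapid psi' ->
  mode m (fun x => s * psi x + psi' x) = s * mode m psi + mode m psi'.
Proof.
move=> rp rp'; have [[M psiM] _] := rp; have [[M' psiM'] _] := rp'.
have b1 := rapid_mode m rp; have b2 := rapid_mode m rp'.
rewrite /mode -climZ// -climD//; last first.
  by apply: bounded_seqM => //; exact: bounded_seq_cst.
congr clim; apply/funext => N; rewrite /circle_mean mulrCA -mulrDr; congr (_ * _).
rewrite mulr_sumr -big_split; apply: eq_bigr => j _ /=.
have sM : box_bounded (normc s * M) (fun x => s * psi x).
  by move=> x /psiM xM; rewrite Normc.normcM ler_wpM2l ?normc_ge0.
by rewrite (ftransD _ sM psiM') (ftransZ _ _ psiM) mulrDl mulrA.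
Qed.

Lemma solution_bound a psi (N : nat) A B : 0 <= A -> growth N A a ->
  (forall m z, normc z <= r0 ->
    jap R m ^+ (N + n) * normc (ftrans (shift_freq m w z) psi) <= B) ->
  bounded_seq (fun N => \sum_(k <- box n N) a k * mode k psi) /\
  normc (solution a psi) <= 2 * (A * (2 * (B / c)) * 5 ^+ n).
Proof.
move=> A0 aA H.
have B0 : 0 <= B.
  apply: le_trans (H 0 0 _); last by rewrite Normc.normc0.
  by rewrite mulr_ge0 ?normc_ge0// exprn_ge0// ltW ?jap_gt0.
have D0 : 0 <= A * (2 * (B / c)).
  by rewrite mulr_ge0// mulr_ge0// divr_ge0// ltW.
have Hs M : normc (\sum_(k <- box n M) a k * mode k psi) <= A * (2 * (B / c)) * 5 ^+ n.
  apply: le_trans (normc_sum _ _ _) _.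
  apply: (@le_trans _ _ (\sum_(k <- box n M) A * (2 * (B / c)) * (jap R k ^+ n)^-1)).
    apply: ler_sum => k _; rewrite Normc.normcM.
    apply: (@le_trans _ _ ((A * jap R k ^+ N) * (2 * (B / c) * (jap R k ^+ (N + n))^-1))).
      apply: ler_pM; [exact: normc_ge0|exact: normc_ge0|exact: aA|].
      by apply: mode_le => z zr; exact: H.
    have j0 := jap_gt0 R k.
    rewrite exprD invfM le_eqVlt; apply/orP; left; apply/eqP.
    by field; rewrite !expf_neq0 ?gt_eqF.
  by rewrite -mulr_sumr ler_wpM2l// sum_jap_box.
split; first by eexists => M; exact: Hs.
by apply: normc_clim_le; [eexists => M; exact: Hs|apply: nearW].
Qed.

Lemma rapid_solution a psi (N : nat) A : 0 <= A -> growth N A a -> rapid psi ->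
  bounded_seq (fun N => \sum_(k <- box n N) a k * mode k psi).
Proof.
move=> A0 aA [_ /(_ (N + n)%N)[B B0 HB]].
by have [] := solution_bound A0 aA HB.
Qed.

Lemma solutionZD a (N : nat) A s psi psi' : 0 <= A -> growth N A a ->
  rapid psi -> rapid psi' ->
  solution a (fun x => s * psi x + psi' x) = s * solution a psi + solution a psi'.
Proof.
move=> A0 aA rp rp'.
have b1 := rapid_solution A0 aA rp; have b2 := rapid_solution A0 aA rp'.
rewrite /solution -climZ// -climD//; last first.
  by apply: bounded_seqM => //; exact: bounded_seq_cst.
congr clim; apply/funext => M; rewrite mulr_sumr -big_split.
by apply: eq_bigr => k _; rewrite modeZD// mulrDr mulrCA.
Qed.

Lemma rapid0 : rapid (fun=> 0).
Proof.
have b0 : box_bounded 0 (fun _ : V => 0 : C) by move=> x _; rewrite Normc.normc0.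
split; first by exists 0.
move=> K; exists 0 => // m z _.
have := ftrans_le (shift_freq m w z) b0; rewrite mulr0 => h.
by rewrite mulr_ge0_le0// exprn_ge0// ltW ?jap_gt0.
Qed.

Lemma solution0 a : solution a (fun=> 0) = 0.
Proof.
have f0 zeta : ftrans zeta (fun _ : V => 0 : C) = 0.
  have b0 : box_bounded 0 (fun _ : V => 0 : C) by move=> x _; rewrite Normc.normc0.
  have := ftrans_le zeta b0; rewrite mulr0 => h.
  by apply: Normc.eq0_normc; apply/eqP; rewrite eq_le h normc_ge0.
rewrite /solution (_ : (fun N => _) = (fun=> 0)) ?clim_cst//.
apply/funext => N; rewrite big1// => k _.
rewrite /mode (_ : circle_mean _ _ = (fun=> 0)) ?clim_cst ?mulr0//.
by apply/funext => M; rewrite /circle_mean big1 ?mulr0// => j _; rewrite f0 mul0r.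
Qed.

Lemma rapid_solution_sum a (N : nat) A (I : Type) (r : seq I) (s : I -> C)
    (Psi : I -> V -> C) : 0 <= A -> growth N A a -> (forall i, rapid (Psi i)) ->
  rapid (fun x => \sum_(i <- r) s i * Psi i x) /\
  solution a (fun x => \sum_(i <- r) s i * Psi i x) =
  \sum_(i <- r) s i * solution a (Psi i).
Proof.
move=> A0 aA rP; elim: r => [|i r [IH1 IH2]].
  under eq_fun do rewrite big_nil; rewrite big_nil.
  by split; [exact: rapid0|exact: solution0].
under eq_fun do rewrite big_cons; rewrite big_cons; split.
  exact: rapidZD.
by rewrite (solutionZD _ A0 aA)// IH2.
Qed.

Lemma rapid_test phi : test_function (@torus_cell R n) phi -> rapid (toC phi).
Proof.
move=> tphi; have [M M0 phiM] := test_function_bounded tphi.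
split; first by exists M; exact: box_bounded_toC.
move=> K; have [B B0 HB] := ftrans_decay w K r00.
have [M' M0' dM] := derivs_le_ex K tphi.
exists (B * M'); first exact: mulr_ge0.
by move=> m z zr; apply: HB.
Qed.

Lemma sub_compact_test (K : set V) phi : compact K -> K `<=` @torus_cell R n ->
  smooth phi -> supp phi `<=` K -> test_function (@torus_cell R n) phi.
Proof.
move=> cK Kc sp pK; split => //; last by move=> x /pK/Kc.
by apply: (subclosed_compact _ cK) => //; exact: closed_closure.
Qed.

Lemma solution_distribution a (N : nat) A : 0 <= A -> growth N A a ->
  distribution_on (@torus_cell R n) (fun phi => solution a (toC phi)).
Proof.
move=> A0 aA; split.
  move=> s phi psi tphi tpsi.
  have := solutionZD s%:C A0 aA (rapid_test tphi) (rapid_test tpsi).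
  move=> <-; congr solution; apply/funext => x.
  by rewrite /toC rmorphD rmorphM.
move=> K cK Kc; have [B B0 HB] := ftrans_decay w (N + n) r00.
exists (2 * (A * (2 * (B / c)) * 5 ^+ n)), (2 * (N + n))%N => phi M sp pK M0 dM.
have tphi := sub_compact_test cK Kc sp pK.
have dle : derivs_le (N + n) phi M.
  have out (g : V -> R) : supp g `<=` K -> (forall x, K x -> `|g x| <= M) ->
      forall x, `|g x| <= M.
    move=> gK gM x; have [/gM//|xK] := pselect (K x).
    by rewrite eq0_notin_supp ?normr0// => /gK.
  split.
    apply: out => // x xK.
    by have := dM mpoly.mnm0 x; rewrite mpoly.mdeg0 mpartial0; exact.
  move=> j; apply: out; first by move=> x /supp_iter_partial/pK.
  move=> x xK; have [b bd <-] := mpartial_pure (2 * (N + n)) j phi.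
  by apply: dM => //; rewrite bd.
have [_ /le_trans] := @solution_bound a (toC phi) N A (B * M) A0 aA
  (fun m z zr => HB phi M m z tphi dle zr).
apply; rewrite le_eqVlt; apply/orP; left; apply/eqP; ring.
Qed.

End SolutionOperator.

Section Equation.
Variables (R : realType) (n : nat) (P : mpolynomial n R[i]).
Variables (w : 'I_n -> R) (c r0 : R) (rad : 'rV[int]_n -> R).
Hypothesis c0 : 0 < c.
Hypothesis rad_bound : forall m, 0 <= rad m <= r0.
Hypothesis P_lower : forall m z, normc z = rad m ->
  c <= normc (mpoly.meval (shift_freq m w z) P).
Local Notation V := 'rV[R]_n.
Local Notation C := R[i].
Implicit Types (psi : V -> C) (phi : V -> R) (m : 'rV[int]_n) (z : C).
Implicit Types (a : 'rV[int]_n -> C) (zeta : 'I_n -> C).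

Lemma ftrans_sum (I : Type) (r : seq I) (s : I -> C) (Psi : I -> V -> C) zeta :
  (forall i, exists M, box_bounded M (Psi i)) ->
  (exists M, box_bounded M (fun x => \sum_(i <- r) s i * Psi i x)) /\
  ftrans zeta (fun x => \sum_(i <- r) s i * Psi i x) =
  \sum_(i <- r) s i * ftrans zeta (Psi i).
Proof.
move=> bP; elim: r => [|i r [[M' psiM'] IH]].
  rewrite (_ : (fun x => _) = fun=> 0); last by apply/funext => x; rewrite big_nil.
  rewrite big_nil.
  have b0 : box_bounded 0 (fun _ : V => 0 : C) by move=> x _; rewrite Normc.normc0.
  split; first by exists 0.
  have := ftrans_le zeta b0; rewrite mulr0 => h.
  by apply: Normc.eq0_normc; apply/eqP; rewrite eq_le h normc_ge0.
rewrite (_ : (fun x => _) =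
    (fun x => s i * Psi i x + \sum_(i <- r) s i * Psi i x)); last first.
  by apply/funext => x; rewrite big_cons.
rewrite big_cons.
have [M psiM] := bP i.
have sM : box_bounded (normc (s i) * M) (fun x => s i * Psi i x).
  by move=> x /psiM xM; rewrite Normc.normcM ler_wpM2l ?normc_ge0.
split; last by rewrite (ftransD _ sM psiM') (ftransZ _ _ psiM) IH.
exists (normc (s i) * M + M') => x xpi; apply: le_trans (le_normcD _ _) _.
by apply: lerD; [exact: sM|exact: psiM'].
Qed.

Definition adjoint_coef (b : multinom n) : C :=
  mpoly.mcoeff b P * ('i%C)^-1 ^+ mdeg b * (-1) ^+ mdeg b.

Definition adjoint phi : V -> C :=
  fun x => \sum_(b <- mpoly.msupp P) adjoint_coef b * toC (mpartial b phi) x.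

Lemma ftrans_adjoint zeta phi : test_function (@torus_cell R n) phi ->
  ftrans zeta (adjoint phi) = mpoly.meval zeta P * ftrans zeta (toC phi).
Proof.
move=> tphi; rewrite /adjoint.
have [|_ ->] := @ftrans_sum _ (mpoly.msupp P) adjoint_coef
    (fun b => toC (mpartial b phi)) zeta.
  move=> b; have [tb _] := ftrans_mpartial zeta b tphi.
  have [M M0 phiM] := test_function_bounded tb.
  by exists M; exact: box_bounded_toC.
rewrite mpoly.mevalE mulr_suml; apply: eq_bigr => b _.
have [_ ->] := ftrans_mpartial zeta b tphi.
rewrite mulrA; congr (_ * _).
have -> : \prod_j (- ('i%C * zeta j)) ^+ mpoly.fun_of_multinom b j =
    (- 'i%C) ^+ mdeg b * \prod_j zeta j ^+ mpoly.fun_of_multinom b j.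
  rewrite mpoly.mdegE -prodrXr -big_split; apply: eq_bigr => j _.
  by rewrite -mulNr exprMn.
rewrite /adjoint_coef mulrA -[_ * _ * _ * (- 'i%C) ^+ _]mulrA -exprMn.
rewrite -[_ * _ * _ ^+ _]mulrA -exprMn.
rewrite mulN1r opprK mulVf ?expr1n ?mulr1//.
by apply/eqP => /(congr1 (fun z : C => Im z)) /= /eqP; rewrite oner_eq0.
Qed.

Let r00 : 0 <= r0.
Proof. by have /andP[h1 h2] := rad_bound 0; exact: le_trans h1 h2. Qed.

Lemma circle_mean_ftrans m phi : test_function (@torus_cell R n) phi ->
  clim (circle_mean rad m (fun z => ftrans (shift_freq m w z) (toC phi))) =
  ftrans (zfreq R m) (toC phi).
Proof.
move=> tphi; have [M0 M00 phiM0] := test_function_bounded tphi.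
have bphi := box_bounded_toC phiM0.
apply: cvg_clim.
pose T : R := r0 * (pi * \sum_j `|w j|).
have T0 : 0 <= T by rewrite mulr_ge0// mulr_ge0 ?pi_ge0// sumr_ge0.
pose eps (M : nat) : R := 2 * (expR T * exp_coeff (2 * T) M.+1).
pose D := ftconst (zfreq R m) * M0.
have eps0 : (fun M => eps M * D) @ \oo --> 0.
  rewrite -[X in _ --> X](mul0r D); apply: cvgMl.
  rewrite -[X in _ --> X](mulr0 2); apply: cvgMr.
  rewrite -[X in _ --> X](mulr0 (expR T)); apply: cvgMr.
  have := cvg_series_cvg_0 (is_cvg_series_exp_coeff (2 * T)).
  by rewrite -cvg_shiftS.
apply: cvg0_le eps0 _; apply: nearW => M.
rewrite ger0_norm ?normc_ge0//.
pose g (j : 'I_M.+1) : V -> C := fun x =>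
  echar (fun i => circle_pt rad m M.+1 j * (w i)%:C) x * toC phi x.
have gb j : exists B, box_bounded B (g j).
  exists (expR (imnorm (fun i => circle_pt rad m M.+1 j * (w i)%:C)) * M0) => x xpi.
  rewrite Normc.normcM; apply: ler_pM; rewrite ?normc_ge0//.
    exact: echar_le.
  exact: bphi.
have -> : circle_mean rad m (fun z => ftrans (shift_freq m w z) (toC phi)) M =
    ftrans (zfreq R m) (fun x => \sum_(j < M.+1) M.+1%:R^-1 * g j x).
  have [_ ->] := @ftrans_sum _ (index_enum 'I_M.+1) (fun=> M.+1%:R^-1) g (zfreq R m) gb.
  rewrite -mulr_sumr; congr (_ * _); apply: eq_bigr => j _.
  by rewrite /g ftrans_echar.
have [[B HB] _] := @ftrans_sum _ (index_enum 'I_M.+1) (fun=> M.+1%:R^-1) g (zfreq R m) gb.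
have bN : box_bounded M0 (fun x => -1 * toC phi x).
  by move=> x xpi; rewrite mulN1r normcN; exact: bphi.
rewrite -[X in _ - X]mul1r -mulNr -(ftransZ _ _ bphi) -(ftransD _ HB bN).
rewrite /D mulrCA; apply: ftrans_le => x xpi.
rewrite -mulr_sumr /g -mulr_suml mulrA -mulrDl Normc.normcM.
apply: ler_pM; rewrite ?normc_ge0//; last exact: bphi.
pose z : C := 'i%C * ((rad m) * \sum_i w i * x 0 i)%:C.
have -> : \sum_(j < M.+1) echar (fun i => circle_pt rad m M.+1 j * (w i)%:C) x =
    \sum_(j < M.+1) cexp (unity_root R M.+1 j * z).
  apply: eq_bigr => j _; rewrite /echar; congr cexp.
  rewrite /z /circle_pt rmorphM rmorph_sum /= mulrCA; congr (_ * _).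
  rewrite mulrA mulr_sumr; apply: eq_bigr => i _.
  by rewrite rmorphM [unity_root _ _ _ * _]mulrC mulrA.
apply: le_trans (circle_mean_cexp z (ltn0Sn M)) _.
have zT : normc z <= T.
  have /andP[rm0 rm] := rad_bound m.
  rewrite /z Normc.normcM normc_i mul1r normcR normrM (ger0_norm rm0).
  apply: ler_pM => //; apply: le_trans (ler_norm_sum _ _ _) _.
  rewrite mulr_sumr; apply: ler_sum => i _; rewrite normrM mulrC.
  by rewrite ler_wpM2r.
rewrite /eps /exp_coeff ler_wpM2l// -mulrA; apply: ler_pM; rewrite ?expR_ge0//.
- by rewrite mulr_ge0 ?invr_ge0// exprn_ge0// mulr_ge0 ?normc_ge0.
- by rewrite ler_expR.
- rewrite ler_wpM2r ?invr_ge0//.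
  have n0 : 0 <= 2 * normc z by rewrite mulr_ge0 ?normc_ge0.
  have nT : 2 * normc z <= 2 * T by rewrite ler_wpM2l.
  by apply: lerXn2r => //; rewrite nnegrE (le_trans n0 nT).
Qed.

Lemma mode_adjoint m phi : test_function (@torus_cell R n) phi ->
  mode P w rad m (adjoint phi) = ftrans (zfreq R m) (toC phi).
Proof.
move=> tphi; rewrite -circle_mean_ftrans//; congr clim; apply/funext => M.
congr (_ * _); apply: eq_bigr => j _.
rewrite ftrans_adjoint// mulrAC divff ?mul1r//.
have := P_lower (normc_circle_pt rad_bound m M.+1 j).
by move=> /(lt_le_trans c0) h; apply: contraTneq h => ->; rewrite Normc.normc0 ltxx.
Qed.

Lemma solution_diffop a (N : nat) A phi : 0 <= A -> growth N A a ->
  test_function (@torus_cell R n) phi ->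
  diffop P (fun phi => solution P w rad a (toC phi)) phi =
  clim (fun N => \sum_(m <- box n N) a m * ftrans (zfreq R m) (toC phi)).
Proof.
move=> A0 aA tphi.
transitivity (solution P w rad a (adjoint phi)).
  have rb b : rapid w r0 (toC (mpartial b phi)).
    have [tb _] := ftrans_mpartial (fun=> 0) b tphi.
    exact: (rapid_test _ rad_bound tb).
  have [_ ->] := @rapid_solution_sum _ _ P w c r0 rad c0 rad_bound P_lower a N A _
    (mpoly.msupp P) adjoint_coef (fun b => toC (mpartial b phi)) A0 aA rb.
  by rewrite /diffop; apply: eq_bigr => b _; rewrite /distr_deriv mulrA.
congr clim; apply/funext => M; apply: eq_bigr => m _.
by rewrite mode_adjoint.
Qed.

End Equation.

Section FourierSeriesPairing.
Import (canonicals) mpoly.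
Variables (R : realType) (n : nat).
Local Notation V := 'rV[R]_n.
Local Notation C := R[i].
Local Notation partial := (@partial R n).
Implicit Types (f : functional R n) (phi : V -> R) (m : 'rV[int]_n) (x : V).
Implicit Types (al be : 'rV[int]_n -> R) (s : seq 'rV[int]_n).

Definition trig_sum s al be : V -> R :=
  fun x => \sum_(m <- s) trigf m (al m) (be m) x.

Lemma differentiable_trig_sum s al be x : differentiable (trig_sum s al be) x.
Proof.
elim: s => [|m s IH].
  rewrite (_ : trig_sum _ _ _ = cst 0); first exact: differentiable_cst.
  by apply/funext => y; rewrite /trig_sum big_nil.
rewrite (_ : trig_sum _ _ _ = trigf m (al m) (be m) + trig_sum s al be).
  by apply: differentiableD => //; exact: differentiable_trigf.
by apply/funext => y; rewrite /trig_sum big_cons.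
Qed.

Lemma partialD (g h : V -> R) j : (forall x, differentiable g x) ->
  (forall x, differentiable h x) ->
  partial j (fun x => g x + h x) = fun x => partial j g x + partial j h x.
Proof.
move=> dg dh; apply/funext => x.
rewrite /partial (_ : (fun x => g x + h x) = g + h)// deriveD//.
  by apply: diff_derivable; exact: dg.
by apply: diff_derivable; exact: dh.
Qed.

Lemma partial_trig_sum s al be j :
  partial j (trig_sum s al be) =
  trig_sum s (fun m => (m 0 j)%:~R * be m) (fun m => - ((m 0 j)%:~R * al m)).
Proof.
elim: s => [|m s IH].
  rewrite (_ : trig_sum _ al be = cst 0); last first.
    by apply/funext => y; rewrite /trig_sum big_nil.
  by apply/funext => y; rewrite /partial derive_cst /trig_sum big_nil.
rewrite (_ : trig_sum _ al be = fun x => trigf m (al m) (be m) x + trig_sum s al be x).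
  rewrite partialD => [|x|x];
    [|exact: differentiable_trigf|exact: differentiable_trig_sum].
  by rewrite IH partial_trigf; apply/funext => x; rewrite [in RHS]/trig_sum big_cons.
by apply/funext => y; rewrite /trig_sum big_cons.
Qed.

Lemma smooth_trig_sum s al be : smooth (trig_sum s al be).
Proof.
have H (l : seq 'I_n) : exists al' be', foldr partial (trig_sum s al be) l = trig_sum s al' be'.
  elim: l => [|j l [al' [be' IH]]]; first by exists al, be.
  by rewrite /= IH partial_trig_sum; do 2 eexists.
move=> l x; have [al' [be' ->]] := H l; exact: differentiable_trig_sum.
Qed.

Lemma linear_on0 f : linear_on (@smooth R n) f -> f (fun=> 0) = 0.
Proof.
move=> lf; have s0 : smooth (fun _ : V => 0 : R).
  rewrite (_ : (fun _ => _) = trig_sum [::] (fun=> 0) (fun=> 0)); first exact: smooth_trig_sum.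
  by apply/funext => y; rewrite /trig_sum big_nil.
have := lf 1 _ _ s0 s0; rewrite (_ : (fun x => _) = fun=> 0); last first.
  by apply/funext => x; rewrite mulr0 addr0.
rewrite rmorph1 mul1r => /eqP.
by rewrite -[X in X == _]addr0 (inj_eq (addrI _)) eq_sym => /eqP.
Qed.

Lemma linear_trigf f m (a b : R) : linear_on (@smooth R n) f ->
  f (trigf m a b) = a%:C * f (trigf m 1 0) + b%:C * f (trigf m 0 1).
Proof.
move=> lf.
have E0 : trigf m 0 0 = fun=> 0 :> R.
  by apply/funext => x; rewrite /trigf !mul0r addr0.
rewrite (_ : trigf m a b = fun x => a * trigf m 1 0 x + trigf m 0 b x); last first.
  by apply/funext => x; rewrite /trigf; ring.
rewrite lf; [|exact: smooth_trigf|exact: smooth_trigf]; congr (_ + _).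
rewrite (_ : trigf m 0 b = fun x => b * trigf m 0 1 x + trigf m 0 0 x); last first.
  by apply/funext => x; rewrite /trigf; ring.
rewrite lf; [|exact: smooth_trigf|exact: smooth_trigf].
by rewrite E0 linear_on0// addr0.
Qed.

Lemma linear_trig_sum f s al be : linear_on (@smooth R n) f ->
  f (trig_sum s al be) =
  \sum_(m <- s) ((al m)%:C * f (trigf m 1 0) + (be m)%:C * f (trigf m 0 1)).
Proof.
move=> lf; elim: s => [|m s IH].
  rewrite big_nil -(linear_on0 lf); congr f.
  by apply/funext => y; rewrite /trig_sum big_nil.
rewrite big_cons -IH -linear_trigf// -[f (trigf _ _ _)]mul1r -[1](rmorph1 (real_complex R)).
rewrite -lf; [|exact: smooth_trigf|exact: smooth_trig_sum].
by congr f; apply/funext => y; rewrite mul1r /trig_sum big_cons.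
Qed.

Definition fcoef phi m : C := (((2 * pi) ^+ n)^-1)%:C * ftrans (zfreq R m) (toC phi).
Arguments fcoef : simpl never.

Definition fseries_Re N phi : V -> R :=
  trig_sum (box n N) (fun m => Re (fcoef phi m)) (fun m => Im (fcoef phi m)).

Definition fseries_Im N phi : V -> R :=
  trig_sum (box n N) (fun m => Im (fcoef phi m)) (fun m => - Re (fcoef phi m)).

Lemma fpartialE N phi x :
  fpartial N phi x = (fseries_Re N phi x)%:C + 'i%C * (fseries_Im N phi x)%:C.
Proof.
have H m : fcoef phi m * echar (fun j => - zfreq R m j) x =
    (trigf m (Re (fcoef phi m)) (Im (fcoef phi m)) x)%:C +
    'i%C * (trigf m (Im (fcoef phi m)) (- Re (fcoef phi m)) x)%:C.
  rewrite echarN /toC; move: (fcoef phi m) => [u v].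
  by apply: complex_ext; rewrite /trigf /=; ring.
rewrite /fpartial mulr_sumr /fseries_Re /fseries_Im /trig_sum.
rewrite !(rmorph_sum (real_complex R)) mulr_sumr -big_split; apply: eq_bigr => m _.
by rewrite mulrA; exact: H.
Qed.

Lemma fcoef_partial phi j m : test_function (@torus_cell R n) phi ->
  Re (fcoef (partial j phi) m) = (m 0 j)%:~R * Im (fcoef phi m) /\
  Im (fcoef (partial j phi) m) = - ((m 0 j)%:~R * Re (fcoef phi m)).
Proof.
move=> tphi; rewrite /fcoef ftrans_partial// mulrCA -/(fcoef phi m).
by case: (fcoef phi m) => u v; rewrite /zfreq; split; rewrite /=; ring.
Qed.

Lemma partial_fseries N phi j : test_function (@torus_cell R n) phi ->
  partial j (fseries_Re N phi) = fseries_Re N (partial j phi) /\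
  partial j (fseries_Im N phi) = fseries_Im N (partial j phi).
Proof.
move=> tphi; split; rewrite partial_trig_sum; apply/funext => x; apply: eq_bigr => m _;
  by have [-> ->] := fcoef_partial j m tphi; rewrite ?opprK ?mulrN.
Qed.

Definition remainder_Re N phi : V -> R := fun x => phi x - fseries_Re N phi x.

Lemma partial_remainder N phi j : test_function (@torus_cell R n) phi ->
  partial j (remainder_Re N phi) = remainder_Re N (partial j phi).
Proof.
move=> tphi; have [sphi _ _] := tphi; apply/funext => x.
rewrite /remainder_Re -(partial_fseries N j tphi).1 /partial.
rewrite (_ : (fun x => _) = phi - fseries_Re N phi)//.
rewrite deriveB//; apply: diff_derivable; first exact: smooth_differentiable.
exact: differentiable_trig_sum.
Qed.

Lemma mpartial_remainder N phi (b : multinom n) : test_function (@torus_cell R n) phi ->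
  mpartial b (remainder_Re N phi) = remainder_Re N (mpartial b phi) /\
  mpartial b (fseries_Im N phi) = fseries_Im N (mpartial b phi).
Proof.
move=> tphi; rewrite /mpartial.
have it k j g : test_function (@torus_cell R n) g ->
    iter k (partial j) (remainder_Re N g) = remainder_Re N (iter k (partial j) g) /\
    iter k (partial j) (fseries_Im N g) = fseries_Im N (iter k (partial j) g).
  move=> tg; elim: k => // k [IH1 IH2]; rewrite !iterS IH1 IH2.
  have tk := test_function_iter j k tg.
  by rewrite partial_remainder// (partial_fseries N j tk).2.
pose D g l := foldr (fun j => iter (mpoly.fun_of_multinom b j) (partial j)) g l.
suff [_] : test_function (@torus_cell R n) (D phi (enum 'I_n)) /\
  (D (remainder_Re N phi) (enum 'I_n) = remainder_Re N (D phi (enum 'I_n)) /\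
   D (fseries_Im N phi) (enum 'I_n) = fseries_Im N (D phi (enum 'I_n))) by [].
elim: (enum 'I_n) => [//|j l [tl [IH1 IH2]]].
rewrite /D /= -!/(D _ _) IH1 IH2.
by split; [exact: test_function_iter|exact: it].
Qed.

Lemma smooth_remainder N phi : test_function (@torus_cell R n) phi ->
  smooth (remainder_Re N phi).
Proof.
move=> tphi l x.
have [tl ->] : test_function (@torus_cell R n) (foldr partial phi l) /\
    foldr partial (remainder_Re N phi) l = remainder_Re N (foldr partial phi l).
  elim: l => [//|j l [tl IH]] /=; rewrite IH partial_remainder//.
  by split => //; exact: test_function_partial.
have [sl _ _] := tl; apply: differentiableB; first exact: smooth_differentiable.
exact: differentiable_trig_sum.
Qed.

Lemma remainder_le N0 phi : test_function (@torus_cell R n) phi ->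
  exists2 B : R, 0 <= B & forall N (b : multinom n) x, (mdeg b <= N0)%N ->
    torus_cell x ->
    `|mpartial b (remainder_Re N phi) x| <= B / N.+1%:R /\
    `|mpartial b (fseries_Im N phi) x| <= B / N.+1%:R.
Proof.
move=> tphi.
have key (b : multinom n) : exists B : R, 0 <= B /\ forall N x, torus_cell x ->
    `|mpartial b (remainder_Re N phi) x| <= B / N.+1%:R /\
    `|mpartial b (fseries_Im N phi) x| <= B / N.+1%:R.
  have [tb _] := ftrans_mpartial (fun=> 0) b tphi.
  have [B B0 HB] := fourier_inversion tb.
  exists B; split => // N x xc; have := HB N x xc.
  have [-> ->] := mpartial_remainder N b tphi.
  set g := mpartial b phi; rewrite fpartialE => h.
  split; apply: le_trans h.
    apply: le_trans (Re_le_normc _).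
    rewrite /toC /remainder_Re le_eqVlt; apply/orP; left; apply/eqP.
    by congr (`|_|); rewrite /=; ring.
  apply: le_trans (Im_le_normc _).
  rewrite /toC le_eqVlt -normrN; apply/orP; left; apply/eqP.
  by congr (`|_|); rewrite /=; ring.
have /choice[B BP] := key.
exists (\sum_(b : mpoly.bmultinom n N0.+1) B (mpoly.bmnm b)).
  by apply: sumr_ge0 => b _; have [] := BP (mpoly.bmnm b).
move=> N b x bN xc.
have [B0 /(_ N x xc)[h1 h2]] := BP b.
have bB : B b <= \sum_(b : mpoly.bmultinom n N0.+1) B (mpoly.bmnm b).
  rewrite (bigD1 (mpoly.BMultinom (bN : (mdeg b < N0.+1)%N)))//= lerDl.
  by apply: sumr_ge0 => b' _; have [] := BP (mpoly.bmnm b').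
by split; [apply: le_trans h1 _|apply: le_trans h2 _]; rewrite ler_wpM2r ?invr_ge0.
Qed.

Lemma fourier_series_pairing f phi : compact_distribution_on (@torus_cell R n) f ->
  test_function (@torus_cell R n) phi ->
  clim (fun N => \sum_(m <- box n N) fourier_coef f m * ftrans (zfreq R m) (toC phi)) =
  f phi.
Proof.
move=> [lf [K [Cf [N0 [cK Kc fC]]]]] tphi; have [sphi _ _] := tphi.
have [B B0 HB] := remainder_le N0 tphi.
have E N : \sum_(m <- box n N) fourier_coef f m * ftrans (zfreq R m) (toC phi) =
    f (fseries_Re N phi) + 'i%C * f (fseries_Im N phi).
  rewrite !linear_trig_sum// mulr_sumr -big_split; apply: eq_bigr => m _.
  rewrite /fourier_coef cosE sinE mulrAC -/(fcoef phi m).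
  rewrite {1}[fcoef phi m]complexE /=.
  have -> : (- Re (fcoef phi m))%:C = - (Re (fcoef phi m))%:C by rewrite rmorphN.
  move: (f _) (f _) (_%:C) (_%:C) => v u b a.
  have i2 : ('i%C : C) * 'i%C = -1 by rewrite -expr2 sqr_i.
  have -> : (a + 'i%C * b) * (u - 'i%C * v) =
    a * u + b * v * - ('i%C * 'i%C) + 'i%C * (b * u + - a * v) by ring.
  by rewrite i2 opprK mulr1.
have fD N : f phi = f (remainder_Re N phi) + f (fseries_Re N phi).
  rewrite -[f (remainder_Re N phi)]mul1r -[1](rmorph1 (real_complex R)).
  rewrite -lf; [|exact: smooth_remainder|exact: smooth_trig_sum].
  by congr f; apply/funext => x; rewrite mul1r /remainder_Re subrK.
apply: cvg_clim.
have B1 : (fun N => 2 * (`|Cf| * B) * N.+1%:R^-1) @ \oo --> (0 : R).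
  by rewrite -[X in _ --> X](mulr0 (2 * (`|Cf| * B))); apply: cvgMr; exact: cvg_harmonic.
apply: cvg0_le B1 _; apply: nearW => N; rewrite ger0_norm ?normc_ge0//.
rewrite E (fD N).
have -> : f (fseries_Re N phi) + 'i%C * f (fseries_Im N phi) -
    (f (remainder_Re N phi) + f (fseries_Re N phi)) =
    'i%C * f (fseries_Im N phi) - f (remainder_Re N phi) by ring.
apply: le_trans (le_normcD _ _) _; rewrite normcN Normc.normcM normc_i mul1r.
have BN : 0 <= B / N.+1%:R by rewrite divr_ge0.
have h1 : normc (f (fseries_Im N phi)) <= `|Cf| * (B / N.+1%:R).
  apply: le_trans (fC _ (B / N.+1%:R) _ _ _) _ => //; first exact: smooth_trig_sum.
    by move=> b x bN /Kc xc; have [] := HB N b x bN xc.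
  by rewrite ler_wpM2r// ler_norm.
have h2 : normc (f (remainder_Re N phi)) <= `|Cf| * (B / N.+1%:R).
  apply: le_trans (fC _ (B / N.+1%:R) _ _ _) _ => //; first exact: smooth_remainder.
    by move=> b x bN /Kc xc; have [] := HB N b x bN xc.
  by rewrite ler_wpM2r// ler_norm.
by apply: le_trans (lerD h1 h2) _; rewrite le_eqVlt; apply/orP; left; apply/eqP; ring.
Qed.

End FourierSeriesPairing.

Section SobolevEstimate.
Variables (R : realType) (n : nat).
Implicit Types (m l k : 'rV[int]_n).

Lemma esum_interchange (T T' : choiceType) (g : T -> T' -> \bar R) :
  (forall i j, (0 <= g i j)%E) ->
  (\esum_(i in [set: T]) \esum_(j in [set: T']) g i j =
   \esum_(j in [set: T']) \esum_(i in [set: T]) g i j)%E.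
Proof.
move=> g0; rewrite (@esum_esum _ _ _ setT (fun=> setT))// (@esum_esum _ _ _ setT (fun=> setT))//.
rewrite (reindex_esum (setT `*`` (fun=> setT)) _ (fun x : T' * T => (x.2, x.1)))//; split => //=.
- by move=> [i1 i2] [j1 j2] /= _ _ [] -> ->.
- by move=> [i j] _; exists (j, i).
Qed.

Lemma esumZ_le (T : choiceType) (D : R) (g : T -> R) : 0 <= D ->
  (forall i, 0 <= g i) ->
  (\esum_(i in [set: T]) (D * g i)%:E <= D%:E * \esum_(i in [set: T]) (g i)%:E)%E.
Proof.
move=> D0 g0; apply: ge_ereal_sup => _ [X [finX XT] <-].
have -> : (\sum_(i \in X) (D * g i)%:E = D%:E * \sum_(i \in X) (g i)%:E)%E.
  rewrite !fsbig_finite//= ge0_sume_distrr//.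
  by move=> i _; rewrite lee_fin.
apply: lee_pmul => //.
- by rewrite fsbig_finite//=; apply: sume_ge0 => i _; rewrite lee_fin.
- by apply: ereal_sup_ubound; exists X.
Qed.

Lemma sum_le_esum (s : seq 'rV[int]_n) (g : 'rV[int]_n -> R) : uniq s ->
  (forall m, 0 <= g m) ->
  ((\sum_(m <- s) g m)%:E <= \esum_(m in [set: 'rV[int]_n]) (g m)%:E)%E.
Proof.
move=> us g0; apply: esum_ge; exists [set` s].
  by split => //; exact: finite_seq.
rewrite fsbig_finite; last exact: finite_seq.
rewrite -sumEFin le_eqVlt; apply/orP; left; apply/eqP; apply: perm_big.
apply: uniq_perm => //; first exact: finmap.fset_uniq.
move=> m; rewrite in_fset_set; last exact: finite_seq.
by apply/idP/idP; rewrite inE.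
Qed.

Lemma esum_le_uniq (g : 'rV[int]_n -> R) (B : R) :
  (forall s, uniq s -> \sum_(m <- s) g m <= B) ->
  (\esum_(m in [set: 'rV[int]_n]) (g m)%:E <= B%:E)%E.
Proof.
move=> gB; apply: ge_ereal_sup => _ [X [finX _] <-].
by rewrite fsbig_finite//= sumEFin lee_fin gB ?finmap.fset_uniq.
Qed.

Lemma normZ2N m : normZ2 R (- m) = normZ2 R m.
Proof. by apply: eq_bigr => j _; rewrite mxE intrN sqrrN. Qed.

Lemma japN m : jap R (- m) = jap R m.
Proof. by rewrite /jap normZ2N. Qed.

Lemma jap_sub m l : jap R l <= 2 * jap R m * jap R (m - l).
Proof.
have : normZ2 R l <= 2 * normZ2 R m + 2 * normZ2 R (m - l).
  rewrite /normZ2 !mulr_sumr -big_split; apply: ler_sum => j _ /=.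
  rewrite !mxE intrB -subr_ge0.
  set x : R := (l 0 j)%:~R; set y : R := (m 0 j)%:~R.
  by rewrite (_ : _ - _ = (2 * y - x) ^+ 2) ?sqr_ge0//; ring.
have N0 k : 0 <= normZ2 R k by apply: sumr_ge0 => j _; exact: sqr_ge0.
have := N0 m; have := N0 (m - l); rewrite /jap; nra.
Qed.

Lemma peetre (rho : R) (K : nat) m l : `|rho| <= K%:R ->
  jap R l `^ rho <= 2 ^+ K * jap R m `^ rho * jap R (m - l) ^+ K.
Proof.
have key (s : R) m' l' : 0 <= s -> s <= K%:R ->
    jap R l' `^ s <= jap R m' `^ s * (2 * jap R (m' - l')) ^+ K.
  move=> s0 sK.
  have j0 k : 0 <= jap R k := ltW (jap_gt0 R k).
  have j2 : 0 <= 2 * jap R (m' - l') by rewrite mulr_ge0.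
  apply: (@le_trans _ _ ((jap R m' * (2 * jap R (m' - l'))) `^ s)).
    apply: ge0_ler_powR; rewrite ?nnegrE ?mulr_ge0//.
    by rewrite mulrCA mulrA jap_sub.
  rewrite powRM// ler_wpM2l ?powR_ge0// -powR_mulrn//.
  apply: ler_powR => //; have := jap_ge1 R (m' - l'); lra.
have -> : 2 ^+ K * jap R m `^ rho * jap R (m - l) ^+ K =
   jap R m `^ rho * (2 * jap R (m - l)) ^+ K by rewrite exprMn; ring.
move=> rK; have [r0|r0] := leP 0 rho.
  by apply: key => //; rewrite -(ger0_norm r0).
have := key (- rho) l m; rewrite oppr_ge0 ltW// -(ltr0_norm r0) => /(_ isT rK).
rewrite (ltr0_norm r0) !powRN -(opprB m l) japN => h.
have jm : 0 < jap R m `^ rho by rewrite powR_gt0// jap_gt0.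
have jl : 0 < jap R l `^ rho by rewrite powR_gt0// jap_gt0.
by move: h; rewrite ler_pdivlMl// ler_pdivrMr// [leRHS]mulrC.
Qed.

Lemma cauchy_schwarz (s : seq 'rV[int]_n) (x y : 'rV[int]_n -> R) :
  (forall m, 0 <= y m) ->
  (\sum_(m <- s) x m * y m) ^+ 2 <= (\sum_(m <- s) y m) * \sum_(m <- s) x m ^+ 2 * y m.
Proof.
move=> y0.
have Y0 : 0 <= \sum_(m <- s) y m by apply: sumr_ge0.
have key t : 0 <= t ^+ 2 * (\sum_(m <- s) y m) - 2 * t * (\sum_(m <- s) x m * y m) +
    \sum_(m <- s) x m ^+ 2 * y m.
  rewrite !mulr_sumr -sumrB -big_split; apply: sumr_ge0 => m _ /=.
  have -> : t ^+ 2 * y m - 2 * t * (x m * y m) + x m ^+ 2 * y m =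
    (t - x m) ^+ 2 * y m by ring.
  by rewrite mulr_ge0 ?sqr_ge0.
have [Y00|Yn0] := eqVneq (\sum_(m <- s) y m) 0.
  rewrite Y00 mul0r (_ : \sum_(m <- s) x m * y m = 0) ?expr0n//.
  rewrite big_seq big1// => m ms.
  have : y m <= \sum_(m <- s) y m by rewrite (big_rem m)//= lerDl sumr_ge0.
  by rewrite Y00 => ym; rewrite (_ : y m = 0) ?mulr0//; apply/eqP; rewrite eq_le ym y0.
have Yp : 0 < \sum_(m <- s) y m by rewrite lt_neqAle eq_sym Yn0.
have := key ((\sum_(m <- s) x m * y m) / \sum_(m <- s) y m).
set Y := \sum_(m <- s) y m in Yp *; set X := \sum_(m <- s) x m * y m.
set Z := \sum_(m <- s) x m ^+ 2 * y m.
have -> : (X / Y) ^+ 2 * Y - 2 * (X / Y) * X + Z = (Y * Z - X ^+ 2) / Y.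
  by field; rewrite gt_eqF.
by rewrite pmulr_lge0 ?invr_gt0// subr_ge0.
Qed.

Lemma normc_clim_sqr_le (x : nat -> R[i]) (t : R) (X : \bar R) : bounded_seq x -> 0 < t ->
  (forall N, ((normc (x N) ^+ 2 * t)%:E <= X)%E) ->
  ((normc (clim x) ^+ 2 * t)%:E <= 4%:E * X)%E.
Proof.
move=> bx t0 xX; case: X xX => [r| |] xX.
- have xr N : normc (x N) <= Num.sqrt (r / t).
    rewrite -[leLHS]ger0_norm ?normc_ge0// -sqrtr_sqr ler_wsqrtr//.
    by rewrite ler_pdivlMr// -lee_fin.
  have r0 : 0 <= r / t.
    rewrite divr_ge0 ?(ltW t0)//; have := xX 0%N; rewrite lee_fin; apply: le_trans.
    by rewrite mulr_ge0 ?sqr_ge0 ?ltW.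
  have := normc_clim_le bx (nearW _ xr) => h.
  rewrite -EFinM lee_fin -ler_pdivlMr//.
  apply: (@le_trans _ _ ((2 * Num.sqrt (r / t)) ^+ 2)).
    have s0 : 0 <= 2 * Num.sqrt (r / t) by rewrite mulr_ge0 ?sqrtr_ge0.
    apply: lerXn2r; [by rewrite nnegrE normc_ge0|by rewrite nnegrE|exact: h].
  rewrite exprMn sqr_sqrtr// le_eqVlt; apply/orP; left; apply/eqP; ring.
- by rewrite gt0_muley ?lte_fin// leey.
- by have := xX 0%N.
Qed.

End SobolevEstimate.

Section SolutionSobolev.
Variables (R : realType) (n : nat) (P : mpolynomial n R[i]).
Variables (w : 'I_n -> R) (c r0 : R) (rad : 'rV[int]_n -> R).
Hypothesis c0 : 0 < c.
Hypothesis rad_bound : forall m, 0 <= rad m <= r0.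
Hypothesis P_lower : forall m z, normc z = rad m ->
  c <= normc (mpoly.meval (shift_freq m w z) P).
Local Notation V := 'rV[R]_n.
Local Notation C := R[i].
Implicit Types (phi eta : V -> R) (m l : 'rV[int]_n) (z : C).
Implicit Types (a : 'rV[int]_n -> C).

Definition modulate l eta : V -> C :=
  fun x => echar (fun j => - zfreq R l j) x * toC eta x.

Lemma ftrans_modulate m l z eta :
  ftrans (shift_freq m w z) (modulate l eta) = ftrans (shift_freq (m - l) w z) (toC eta).
Proof.
rewrite /modulate ftrans_echar; congr ftrans; apply/funext => j.
by rewrite /shift_freq /zfreq !mxE intrB rmorphB addrAC.
Qed.

Let r00 : 0 <= r0.
Proof. by have /andP[h1 h2] := rad_bound 0; exact: le_trans h1 h2. Qed.

Lemma rapid_modulate l eta : test_function (@torus_cell R n) eta ->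
  rapid w r0 (modulate l eta).
Proof.
move=> teta; have [M M0 etaM] := test_function_bounded teta; split.
  exists M => x xpi; rewrite Normc.normcM.
  have -> : normc (echar (fun j => - zfreq R l j) x) = 1.
    rewrite echarN /toC /trigf (_ : _ - _ = Complex (cos (dotZ l x)) (- sin (dotZ l x))).
      by rewrite /= sqrrN cos2Dsin2 sqrtr1.
    by apply: complex_ext; rewrite /=; ring.
  by rewrite mul1r; exact: box_bounded_toC.
move=> K; have [B B0 HB] := ftrans_decay w K r00.
have [M' M0' dM] := derivs_le_ex K teta.
have j0 k : 0 <= jap R k := ltW (jap_gt0 R k).
exists ((2 * jap R (- l)) ^+ K * (B * M')); first by rewrite mulr_ge0 ?exprn_ge0 ?mulr_ge0.
move=> m z zr; rewrite ftrans_modulate.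
have := HB eta M' (m - l) z teta dM zr.
move=> /(ler_wpM2l (_ : 0 <= (2 * jap R (- l)) ^+ K)) h.
apply: le_trans (h _); last by rewrite exprn_ge0// mulr_ge0.
rewrite mulrA -exprMn ler_wpM2r ?normc_ge0//; apply: lerXn2r.
- by rewrite nnegrE.
- by rewrite nnegrE !mulr_ge0.
- have := jap_sub R (m - l) m; rewrite (_ : m - l - m = - l); last by rewrite addrAC subrr sub0r.
  by rewrite -[X in _ <= X -> _]mulrA [jap R (m - l) * _]mulrC mulrA.
Qed.

Lemma rapid_comb (s t : C) l eta : test_function (@torus_cell R n) eta ->
  rapid w r0 (fun x => s * modulate l eta x + t * modulate (- l) eta x).
Proof.
move=> teta; apply: rapidZD; first exact: rapid_modulate.
rewrite (_ : (fun x => _) = fun x => t * modulate (- l) eta x + 0).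
  by apply: rapidZD; [exact: rapid_modulate|exact: rapid0].
by apply/funext => x; rewrite addr0.
Qed.

Lemma modulateN l eta x : modulate (- l) eta x =
  (toC (trigf l 1 0) x + 'i%C * toC (trigf l 0 1) x) * toC eta x.
Proof.
rewrite /modulate -echarP; congr (echar _ x * _).
by apply/funext => j; rewrite /zfreq mxE intrN rmorphN opprK.
Qed.

Lemma solution_modulate a (N : nat) A l eta : 0 <= A -> growth N A a ->
  test_function (@torus_cell R n) eta ->
  solution P w rad a (toC (fun x => eta x * cos (dotZ l x))) -
  'i%C * solution P w rad a (toC (fun x => eta x * sin (dotZ l x))) =
  solution P w rad a (modulate l eta).
Proof.
move=> A0 aA teta.
have tc x : toC (trigf l 1 0) x = (cos (dotZ l x))%:C.
  by rewrite /toC /trigf mul1r mul0r addr0.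
have ts x : toC (trigf l 0 1) x = (sin (dotZ l x))%:C.
  by rewrite /toC /trigf mul1r mul0r add0r.
have cM (u v : R) : (u * v)%:C = u%:C * v%:C :> C by rewrite rmorphM.
have two : (2 : C) != 0 by rewrite pnatr_eq0.
have i2 : ('i%C : C) * 'i%C = -1 by rewrite -expr2 sqr_i.
have rc : rapid w r0 (toC (fun x => eta x * cos (dotZ l x))).
  rewrite (_ : toC _ = fun x => 2^-1 * modulate l eta x + 2^-1 * modulate (- l) eta x).
    exact: rapid_comb.
  apply/funext => x; rewrite modulateN /modulate echarN.
  rewrite tc ts /toC cM.
  by move: (eta x)%:C (cos _)%:C (sin _)%:C => u v t; field.
have rs : rapid w r0 (toC (fun x => eta x * sin (dotZ l x))).
  rewrite (_ : toC _ = fun x => ('i%C / 2) * modulate l eta x +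
      (- ('i%C / 2)) * modulate (- l) eta x).
    exact: rapid_comb.
  apply/funext => x; rewrite modulateN /modulate echarN.
  rewrite tc ts /toC cM.
  move: (eta x)%:C (cos _)%:C (sin _)%:C => u v t.
  have -> : 'i%C / 2 * ((v - 'i%C * t) * u) + - ('i%C / 2) * ((v + 'i%C * t) * u) =
    u * t * - ('i%C * 'i%C) by field.
  by rewrite i2 opprK mulr1.
have := solutionZD c0 rad_bound P_lower (- 'i%C) A0 aA rs rc.
rewrite mulNr addrC => <-; congr solution; apply/funext => x.
rewrite /modulate echarN tc ts /toC !cM.
by move: (eta x)%:C (cos _)%:C (sin _)%:C => u v t; ring.
Qed.

(* Cauchy-Schwarz against the summable kernel [jap (m - l) ^- (n + k)], whose
   surplus factor [jap (m - l) ^- k] pays, by Peetre's inequality, for moving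
   the Sobolev weight from [l] to [m]. *)
Lemma solution_sobolev eta (rho : R) : test_function (@torus_cell R n) eta ->
  exists2 D : R, 0 <= D & forall a (N : nat) (A : R), 0 <= A -> growth N A a ->
    (\esum_(l in [set: 'rV[int]_n])
       (normc (solution P w rad a (modulate l eta)) ^+ 2 * jap R l `^ rho)%:E <=
     D%:E * \esum_(m in [set: 'rV[int]_n]) (normc (a m) ^+ 2 * jap R m `^ rho)%:E)%E.
Proof.
move=> teta; pose k := (Num.truncn `|rho|).+1.
have rk : `|rho| <= k%:R by have /andP[_ /ltW] := truncn_itv (normr_ge0 rho).
pose K := (n + k)%N.
have [B0' B00 HB] := ftrans_decay w K r00.
have [M' M0' dM] := derivs_le_ex K teta.
pose B := B0' * M'.
have B0 : 0 <= B by exact: mulr_ge0.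
have {}HB m z : normc z <= r0 -> jap R m ^+ K * normc (ftrans (shift_freq m w z) (toC eta)) <= B.
  by move=> zr; exact: HB.
pose E := 2 * (B / c).
have E0 : 0 <= E by rewrite mulr_ge0// divr_ge0// ltW.
have jp m : 0 < jap R m := jap_gt0 R m.
have j0 m : 0 <= jap R m := ltW (jp m).
have modeE m l : normc (mode P w rad m (modulate l eta)) <= E * (jap R (m - l) ^+ K)^-1.
  have jK : 0 < jap R (m - l) ^+ K by rewrite exprn_gt0.
  have [|_ /le_trans] := @mode_bound R n P w c r0 rad c0 rad_bound P_lower m
      (modulate l eta) (B / jap R (m - l) ^+ K).
    by move=> z /(HB (m - l)); rewrite ftrans_modulate ler_pdivlMr// mulrC.
  by apply; rewrite /E le_eqVlt; apply/orP; left; apply/eqP; ring.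
pose D1 := E ^+ 2 * 5 ^+ n * 2 ^+ k.
have D10 : 0 <= D1 by rewrite mulr_ge0 ?exprn_ge0// mulr_ge0 ?exprn_ge0.
exists (4 * (D1 * 5 ^+ n)); first by rewrite mulr_ge0// mulr_ge0 ?exprn_ge0.
move=> a N A A0 aA.
pose g m := normc (a m) ^+ 2 * jap R m `^ rho.
have g0 m : 0 <= g m by rewrite mulr_ge0 ?sqr_ge0 ?powR_ge0.
pose h l m := D1 * (g m * (jap R (m - l) ^+ n)^-1).
have h0 l m : 0 <= h l m.
  by rewrite mulr_ge0// mulr_ge0// invr_ge0 exprn_ge0.
have step l M : ((normc (\sum_(m <- box n M) a m * mode P w rad m (modulate l eta)) ^+ 2 *
    jap R l `^ rho)%:E <= \esum_(m in [set: 'rV[int]_n]) (h l m)%:E)%E.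
  apply: le_trans (sum_le_esum (box_uniq n M) (h0 l)); rewrite lee_fin.
  set X := normc _; pose kap m := (jap R (m - l) ^+ K)^-1.
  have kap0 m : 0 <= kap m by rewrite invr_ge0 exprn_ge0.
  have X1 : X <= E * \sum_(m <- box n M) normc (a m) * kap m.
    rewrite mulr_sumr; apply: le_trans (normc_sum _ _ _) _; apply: ler_sum => m _.
    by rewrite Normc.normcM mulrCA ler_wpM2l ?normc_ge0.
  have X2 : X ^+ 2 <= E ^+ 2 * (5 ^+ n * \sum_(m <- box n M) normc (a m) ^+ 2 * kap m).
    apply: (@le_trans _ _ ((E * \sum_(m <- box n M) normc (a m) * kap m) ^+ 2)).
      apply: lerXn2r X1; rewrite nnegrE ?normc_ge0// mulr_ge0// sumr_ge0// => m _.
      by rewrite mulr_ge0 ?normc_ge0.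
    rewrite exprMn ler_wpM2l ?sqr_ge0//.
    apply: le_trans (cauchy_schwarz (box n M) (fun m => normc (a m)) kap0) _.
    rewrite ler_wpM2r//.
      by apply: sumr_ge0 => m _; rewrite mulr_ge0 ?sqr_ge0.
    apply: le_trans (sum_jap_shift R l (box_uniq n M)); apply: ler_sum => m _.
    rewrite /kap lef_pV2 ?posrE ?exprn_gt0//; apply: ler_weXn2l; first exact: jap_ge1.
    exact: leq_addr.
  apply: le_trans (ler_wpM2r (powR_ge0 _ _) X2) _.
  have -> : E ^+ 2 * (5 ^+ n * \sum_(m <- box n M) normc (a m) ^+ 2 * kap m) *
      jap R l `^ rho = \sum_(m <- box n M)
      E ^+ 2 * 5 ^+ n * (normc (a m) ^+ 2 * kap m * jap R l `^ rho).
    by rewrite -mulr_sumr -mulr_suml; ring.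
  apply: ler_sum => m _; rewrite /h /D1 -[leRHS]mulrA ler_wpM2l//.
    by rewrite mulr_ge0 ?exprn_ge0.
  have jk : 0 < jap R (m - l) ^+ k by rewrite exprn_gt0.
  have jn : 0 < jap R (m - l) ^+ n by rewrite exprn_gt0.
  apply: le_trans (ler_wpM2l _ (peetre m l rk)) _.
    by rewrite mulr_ge0 ?sqr_ge0.
  rewrite /g /kap /K exprD le_eqVlt; apply/orP; left; apply/eqP.
  by field; rewrite !gt_eqF.
have h40 l m : (0 <= (4 * h l m)%:E)%E by rewrite lee_fin mulr_ge0.
apply: (@le_trans _ _ (\esum_(l in [set: 'rV[int]_n])
   \esum_(m in [set: 'rV[int]_n]) (4 * h l m)%:E)%E).
  apply: le_esum => l _.
  have jl : 0 < jap R l `^ rho by exact: powR_gt0.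
  have bs := rapid_solution c0 rad_bound P_lower A0 aA (rapid_modulate l teta).
  apply: le_trans (normc_clim_sqr_le bs jl (step l)) _.
  have h4 m : 0 <= 4 * h l m by rewrite mulr_ge0.
  have := @esumZ_le R _ 4^-1 (fun m => 4 * h l m) _ h4.
  rewrite invr_ge0 => /(_ (ler0n _ 4)) H.
  rewrite (_ : (\esum_(m in [set: 'rV[int]_n]) (h l m)%:E)%E =
    (\esum_(m in [set: 'rV[int]_n]) (4^-1 * (4 * h l m))%:E)%E); last first.
    by apply: eq_esum => m _; rewrite mulKf.
  apply: le_trans (lee_wpmul2l _ H) _; first by rewrite lee_fin.
  by rewrite muleA -EFinM divff// mul1e.
rewrite esum_interchange//.
apply: le_trans (esumZ_le _ g0); last by rewrite mulr_ge0// mulr_ge0 ?exprn_ge0.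
apply: le_esum => m _; apply: esum_le_uniq => s us.
rewrite (eq_bigr (fun l => 4 * D1 * g m * (jap R (l - m) ^+ n)^-1)); last first.
  by move=> l _; rewrite /h -(opprB l m) japN !mulrA.
rewrite -mulr_sumr.
have -> : 4 * (D1 * 5 ^+ n) * g m = 4 * D1 * g m * 5 ^+ n by ring.
by rewrite ler_wpM2l ?sum_jap_shift// mulr_ge0// mulr_ge0.
Qed.

End SolutionSobolev.

Lemma sobolev_norm_le (R : realType) (n : nat) (f g : functional R n)
    (rho s D : R) : rho <= s -> 0 <= D ->
  (\esum_(l in [set: 'rV[int]_n]) (normc (fourier_coef f l) ^+ 2 * (1 + normZ2 R l) `^ rho)%:E <=
   D%:E * \esum_(l in [set: 'rV[int]_n])
     (normc (fourier_coef g l) ^+ 2 * (1 + normZ2 R l) `^ rho)%:E)%E ->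
  (sobolev_norm rho f <= (D `^ 2^-1 + 1)%:E * sobolev_norm s g)%E.
Proof.
move=> rs D0 H; rewrite /sobolev_norm.
set F := (\esum_(l in _) _)%E in H *; set G := (\esum_(l in _) _)%E in H.
set S := (\esum_(l in _) _)%E.
have F0 : (0 <= F)%E.
  by apply: esum_ge0 => l _; rewrite lee_fin mulr_ge0 ?sqr_ge0 ?powR_ge0.
have S0 : (0 <= S)%E.
  by apply: esum_ge0 => l _; rewrite lee_fin mulr_ge0 ?sqr_ge0 ?powR_ge0.
have GS : (G <= S)%E.
  apply: le_esum => l _; rewrite lee_fin ler_wpM2l ?sqr_ge0//.
  by apply: ler_powR => //; exact: jap_ge1.
have FS : (F <= D%:E * S)%E.
  by apply: le_trans H _; rewrite lee_wpmul2l// lee_fin.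
apply: (@le_trans _ _ ((D%:E * S) `^ 2^-1)%E).
  by apply: gt0_ler_poweR FS; rewrite ?in_itv /= ?leey ?andbT// mule_ge0// lee_fin.
rewrite poweRM ?lee_fin// poweR_EFin lee_wpmul2r ?poweR_ge0//.
by rewrite lee_fin lerDl.
Qed.

Theorem corollary2 (R : realType) (n : nat) (hn : (0 < n)%N)
    (P : mpolynomial n R[i]) (p : R)
    (hP : muckenhoupt p (fun xi => Normc.normc (symbol P xi)))
    (Omega Omega' : set 'rV[R]_n)
    (openOmega : open Omega) (openOmega' : open Omega')
    (subOmega : Omega `<=` Omega')
    (relOmega' : compactly_contained Omega' (@torus_cell R n))
    (eta : 'rV[R]_n -> R) (smooth_eta : smooth eta)
    (eta1 : forall x, closure Omega x -> eta x = 1)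
    (supp_eta : supp eta `<=` Omega') :
  exists C : R -> R, (forall rho, 0 < C rho) /\
    forall f : functional R n, compact_distribution_on (@torus_cell R n) f ->
      exists u : functional R n,
        [/\ distribution_on (@torus_cell R n) u,
            distr_eq (@torus_cell R n) (diffop P u) f &
            forall rho : R,
              (sobolev_norm rho (distr_mul eta u) <=
               (C rho)%:E * sobolev_norm (rho + n%:R * p) f)%E].
Proof.
have P0 := muckenhoupt_symbol_neq0 hP.
have p1 := muckenhoupt_ge1 hP.
have [w [c [r0 [c0 r00 Hr]]]] := symbol_lower_bound P0.
have /choice[rad radP] : forall m, exists r : R, 0 <= r <= r0 /\
    forall z, normc z = r -> c <= normc (mpoly.meval (shift_freq m w z) P).
  by move=> m; have [r ? ?] := Hr m; exists r.
have rad_bound m : 0 <= rad m <= r0 by have [] := radP m.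
have P_lower m z : normc z = rad m -> c <= normc (mpoly.meval (shift_freq m w z) P).
  by have [_] := radP m; exact.
have teta : test_function (@torus_cell R n) eta.
  have [cO Oc] := relOmega'.
  apply: (sub_compact_test cO Oc smooth_eta) => x /supp_eta; exact: subset_closure.
have /choice[D DP] := fun rho => let: ex_intro2 D D0 H :=
  @solution_sobolev R n P w c r0 rad c0 rad_bound P_lower eta rho teta in
  ex_intro (fun D => 0 <= D /\ forall a (N : nat) (A : R), 0 <= A -> growth N A a ->
    (\esum_(l in [set: 'rV[int]_n])
       (normc (solution P w rad a (modulate l eta)) ^+ 2 * jap R l `^ rho)%:E <=
     D%:E * \esum_(m in [set: 'rV[int]_n]) (normc (a m) ^+ 2 * jap R m `^ rho)%:E)%E)
    D (conj D0 H).
pose Q : R := ((2 * pi) ^+ n)^-1.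
have Q0 : 0 <= Q by rewrite invr_ge0 exprn_ge0// mulr_ge0 ?pi_ge0.
exists (fun rho => (Q ^+ 2 * D rho) `^ 2^-1 + 1); split.
  by move=> rho; rewrite ltr_wpDl ?powR_ge0.
move=> f cf; have [N [A [A0 aA]]] := fourier_coef_growth cf.
exists (fun phi => solution P w rad (fourier_coef f) (toC phi)); split.
- exact: (solution_distribution c0 rad_bound P_lower A0 aA).
- move=> phi tphi.
  rewrite (solution_diffop c0 rad_bound P_lower A0 aA tphi).
  exact: fourier_series_pairing.
move=> rho; have [D0 HD] := DP rho.
apply: sobolev_norm_le.
- by rewrite lerDl mulr_ge0// (le_trans ler01).
- by rewrite mulr_ge0 ?sqr_ge0.
have nQ : normc Q%:C = Q by rewrite normcR ger0_norm.
have E l : fourier_coef (distr_mul eta (fun phi => solution P w rad (fourier_coef f) (toC phi))) l =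
    Q%:C * solution P w rad (fourier_coef f) (modulate l eta).
  by rewrite /fourier_coef /distr_mul (solution_modulate c0 rad_bound P_lower _ A0 aA).
rewrite (eq_esum (b := fun l => (Q ^+ 2 * (normc (solution P w rad (fourier_coef f)
   (modulate l eta)) ^+ 2 * jap R l `^ rho))%:E)); last first.
  by move=> l _; rewrite E Normc.normcM nQ exprMn -[X in X%:E]mulrA.
apply: le_trans (esumZ_le _ _) _; rewrite ?sqr_ge0//.
  by move=> l; rewrite mulr_ge0 ?sqr_ge0 ?powR_ge0.
rewrite [(Q ^+ 2 * D rho)%:E]EFinM -muleA; apply: lee_wpmul2l.
  by rewrite lee_fin sqr_ge0.
exact: HD A0 aA.
Qed.
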